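(* There exist absolute constants $c, C>0$ such that for every measurable set $S\subset\mathbb{R}$ with $0<|S|<\infty$ there is a discrete set $\Lambda\subset\mathbb{R}$ such that the exponential system $E(\Lambda)=\{e^{i\lambda t}\}_{\lambda\in\Lambda}$ is a frame in $L^2(S)$ with frame bounds $c|S|$ and $C|S|$; that is, $$c|S|\,\|F\|^2\le \sum_{\lambda\in\Lambda}\left|\int_S F(t)e^{-i\lambda t}\,dt\right|^2\le C|S|\,\|F\|^2\qquad \forall F\in L^2(S).$$
   Context: $|S|$ denotes the Lebesgue measure of $S$, and $\|F\|$ is the norm of $L^2(S)$ with respect to Lebesgue measure. A system of vectors $E=\{u_j\}$ in a Hilbert space $H$ is a frame with frame bounds $a,A>0$ if $a\|h\|^2\le\sum_{u_j\in E}|\langle h,u_j\rangle|^2\le A\|h\|^2$ for all $h\in H$. The set $S$ need not be bounded, and the constants $c,C$ do not depend on $S$. *)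

(* Defs.v *)
From mathcomp Require Import all_boot all_order all_algebra.
From mathcomp Require Import all_classical all_reals all_analysis.
From mathcomp Require Import complex.

Set Implicit Arguments.
Unset Strict Implicit.
Unset Printing Implicit Defensive.

Import Order.TTheory GRing.Theory Num.Theory.
Import numFieldNormedType.Exports.

Local Open Scope classical_set_scope.
Local Open Scope ring_scope.
Local Open Scope complex_scope.

Local Notation normc := ComplexField.Normc.normc.

(* [lebesgue_measure] only lives on the Borel sets; Lebesgue-measurable sets and
   functions are those of the Caratheodory sigma-algebra, which is the domain of
   [completed_lebesgue_measure]. *)
Notation lebesgueTypeR R := (caratheodory_type (@wlength R idfun)^*%mu).

Definition Lmeasurable (R : realType) (S : set R) : Prop :=
  measurable (S : set (lebesgueTypeR R)).

Definition Lmeasurable_fun (R : realType) (S : set R) (f : R -> R) : Prop :=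
  measurable_fun (S : set (lebesgueTypeR R)) (f : lebesgueTypeR R -> R).

Definition Lmeasure (R : realType) (S : set R) : \bar R :=
  @completed_lebesgue_measure R S.

Definition cintegral (R : realType) (S : set R) (F : R -> R[i]) : R[i] :=
  (\int[@completed_lebesgue_measure R]_(t in S) complex.Re (F t)) +i*
  (\int[@completed_lebesgue_measure R]_(t in S) complex.Im (F t)).

(* Elements of L^2(S) are represented by functions on the whole line; everything
   below depends only on their values almost everywhere on S. *)
Definition inL2 (R : realType) (S : set R) (F : R -> R[i]) : Prop :=
  [/\ Lmeasurable_fun S (fun t => complex.Re (F t)),
      Lmeasurable_fun S (fun t => complex.Im (F t)) &
      (\int[@completed_lebesgue_measure R]_(t in S)
         ((normc (F t)) ^+ 2)%:E < +oo)%E].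

Definition L2dot (R : realType) (S : set R) (F G : R -> R[i]) : R[i] :=
  cintegral S (fun t => F t * conjc (G t)).

Definition L2norm (R : realType) (S : set R) (F : R -> R[i]) : R :=
  Num.sqrt (\int[@completed_lebesgue_measure R]_(t in S) (normc (F t)) ^+ 2).

Definition L2frame (R : realType) (I : choiceType) (S : set R)
    (J : set I) (u : I -> R -> R[i]) (a A : R) : Prop :=
  [/\ 0 < a, 0 < A, (forall j, J j -> inL2 S (u j)) &
      forall F : R -> R[i], inL2 S F ->
        ((a * L2norm S F ^+ 2)%:E
           <= \esum_(j in J) ((normc (L2dot S F (u j))) ^+ 2)%:E
           <= (A * L2norm S F ^+ 2)%:E)%E].

(* t |-> e^{i l t} *)
Definition expsys (R : realType) (l t : R) : R[i] :=
  cos (l * t) +i* sin (l * t).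

(* No accumulation point on the line, equivalently finitely many points in every
   bounded interval. *)
Definition discrete_set (R : realType) (L : set R) : Prop :=
  limit_point L = set0.

(* Main.v *)
Require Import Defs.
From mathcomp Require Import all_boot all_order all_algebra.
From mathcomp Require Import all_classical all_reals all_analysis.
From mathcomp Require Import complex measurable_realfun.
From mathcomp Require Import ring lra zify.

(** The frame of exponentials is a limit of selections of rows from Fourier
    matrices, and the selection rests on the solution of the Kadison-Singer
    problem by Marcus, Spielman and Srivastava.

    Reduction. The set S lies in an open set U of measure at most 2 |S|, and
    L^2(S) is contained in L^2(U) by extension by zero; so it suffices to find a
    frame for L^2(U) whose bounds are absolute multiples of |U|. For step
    functions on the dyadic cells of length 2^-k inside U, the integrals against
    the exponentials with frequencies in a suitable arithmetic progression are,
    up to a factor comparable to the length of a cell, the coefficients with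
    respect to the rows of a Fourier matrix of order N restricted to the set D of
    the columns that correspond to cells in U. After normalization the rows form
    a Parseval frame of vectors of the same square norm #|D| / N. From it one has
    to select rows that still form a frame, with both bounds comparable to
    #|D| / N ([fourier_selection]); for the step functions this gives bounds
    comparable to |U|, whatever the level is ([level_open]).

    Selection. A Parseval frame of short vectors can be split into two parts
    whose frame operators are both close to one half of the identity
    ([parseval_halving]). After normalization of one part by the square root of
    its frame operator the step is repeated ([halving], [halving_iter]), and the
    losses add up to a constant factor. The splitting itself is a barrier
    argument for p (y, y') = det (sum y_j v_j v_j^* ) det (sum y'_j v_j v_j^* ).
    To put v_j into one of the parts is to lower y_j or y'_j by 2, and the average
    of the two outcomes is the operator p - p_j - p_j', which is [pairop].
    Averaging preserves real stability ([stable_pairop]), and real stability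
    gives the inequality of [rayleigh]. Thanks to it each averaging step is
    compensated by moving two coordinates slightly upwards, at no cost to the
    barriers of the other coordinates ([barrier_pairop]). Hence the total average
    is positive above an explicit point. Undoing the averages one at a time keeps
    the positivity for one of the two outcomes ([above_shift]); this chooses the
    parts, and positivity above the final point bounds both frame operators.
    Determinants enter only as functions that are affine in each variable, so
    polynomials are not mentioned.

    Limit. A modulated indicator function of a fixed family of cells shows that
    the selected frequencies have at most a fixed number of members in each window
    of fixed length ([level_count]). So they have a limit set, taken along an
    ultrafilter and window by window, which is discrete. Transforms of step
    functions decay like the inverse of the frequency, so nothing is lost at
    infinity and both bounds survive in the limit up to the number of frequencies
    that may have merged ([limit_set_sum], [step_frame]). Since a step function of
    one level is a step function of all later levels, the limit set serves all
    levels at once. Density of the step functions extends first the upper and then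
    the lower bound to all of L^2(U) ([fourier_upper], [fourier_lower]). *)

Set Implicit Arguments.
Unset Strict Implicit.
Unset Printing Implicit Defensive.
Import Order.TTheory GRing.Theory Num.Theory.
Import numFieldNormedType.Exports.

Local Open Scope ring_scope.

(** * Multiaffine functions and the barrier argument *)

Section Multiaffine.
Variables (K : fieldType) (I : finType).
Implicit Types (f : {ffun I -> K} -> K) (x : {ffun I -> K}).

Definition spike (i : I) (w : K) : {ffun I -> K} :=
  [ffun j => if j == i then w else 0].

Definition diff (i : I) f : {ffun I -> K} -> K := fun x => f (x + spike i 1) - f x.

(** Functions that are affine in each coordinate play the part of multiaffine
    polynomials; [diff i f] is then the i-th partial derivative. *)
Definition multiaffine f := forall i x w,
  f (x + spike i w) = f x + w * diff i f x.

Lemma spikeD i v w : spike i v + spike i w = spike i (v + w).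
Proof. by apply/ffunP => j; rewrite !ffunE; case: eqP; rewrite ?addr0. Qed.

Lemma diffC i j f x : diff i (diff j f) x = diff j (diff i f) x.
Proof. by rewrite /diff (addrAC x); ring. Qed.

Lemma multiaffine_diff i f : multiaffine f -> multiaffine (diff i f).
Proof.
move=> af j x w; rewrite diffC {1}/diff -addrA [spike _ w + _]addrC addrA !af.
by rewrite /diff; ring.
Qed.

Lemma multiaffineB f g : multiaffine f -> multiaffine g ->
  multiaffine (fun x => f x - g x).
Proof. by move=> af ag i x w; rewrite af ag /diff; ring. Qed.

Lemma multiaffine2 f i j x a b : multiaffine f ->
  f (x + spike i a + spike j b) =
  f x + a * diff i f x + b * diff j f x + a * b * diff i (diff j f) x.
Proof.
move=> af; rewrite af (multiaffine_diff _ af) af; ring.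
Qed.

Lemma ffun_sum_spike (x : {ffun I -> K}) : x = \sum_i spike i (x i).
Proof.
apply/ffunP => j; rewrite sum_ffunE (bigD1 j) //= big1 => [|i ij].
  by rewrite !ffunE eqxx addr0.
by rewrite !ffunE eq_sym (negbTE ij).
Qed.

Lemma diff_diff0 f i x : multiaffine f -> diff i (diff i f) x = 0.
Proof.
move=> af; have := af i x (1 + 1); rewrite -spikeD /diff addrA => ->.
by rewrite /diff; ring.
Qed.

(** For a multiaffine f this is the average of the two functions obtained by
    lowering the i-th, respectively the j-th, coordinate by 2. *)
Definition pairop i j f : {ffun I -> K} -> K :=
  fun x => f x - diff i f x - diff j f x.

Lemma multiaffine_pairop i j f : multiaffine f -> multiaffine (pairop i j f).
Proof.
move=> af; exact: multiaffineB (multiaffineB af (multiaffine_diff i af))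
  (multiaffine_diff j af).
Qed.

Lemma diff_pairop k i j f x :
  diff k (pairop i j f) x = pairop i j (diff k f) x.
Proof. by rewrite /pairop /= !(diffC _ k) /diff; ring. Qed.

End Multiaffine.

Section Barrier.
Variables (R : realFieldType) (I : finType).
Implicit Types (P : {ffun I -> R} -> R) (x t : {ffun I -> R}).

Definition nonneg t := forall i, 0 <= t i.

(** In the usual picture x lies above all the zeros of P. *)
Definition above P x := forall t, nonneg t -> 0 < P (x + t).

(** The negative correlation inequality satisfied by real stable multiaffine
    polynomials. *)
Definition rayleigh P := forall i j x, i != j ->
  P x * diff i (diff j P) x <= diff i P x * diff j P x.

(** The logarithmic derivative of P in the direction k. It measures how far x is
    from the zeros of P in that direction. *)
Definition barrier k P x := diff k P x / P x.

Lemma nonnegD t s : nonneg t -> nonneg s -> nonneg (t + s).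
Proof. by move=> t0 s0 i; rewrite ffunE addr_ge0. Qed.

Lemma nonneg_spike i (a : R) : 0 <= a -> nonneg (spike i a).
Proof. by move=> a0 j; rewrite !ffunE; case: eqP. Qed.

Lemma above_gt0 P x : above P x -> 0 < P x.
Proof. by move=> /(_ 0); rewrite addr0; apply=> i; rewrite ffunE. Qed.

Lemma aboveD P x t : nonneg t -> above P x -> above P (x + t).
Proof. by move=> t0 Px s s0; rewrite -addrA; apply: Px; apply: nonnegD. Qed.

Lemma affine_slope_ge0 (u v : R) : (forall a, 0 <= a -> 0 <= u + a * v) -> 0 <= v.
Proof.
move=> h; rewrite leNgt; apply/negP => v0.
have u0 : 0 <= u by have := h 0 (lexx _); rewrite mul0r addr0.
have /h : 0 <= (u + 1) / - v.
  by rewrite divr_ge0 ?addr_ge0 ?oppr_ge0 // ltW.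
have -> : u + (u + 1) / - v * v = -1 by field; rewrite lt_eqF.
by lra.
Qed.

(** Unlike [above], this weak form passes to the derivatives. *)
Definition wabove P x := forall t, nonneg t -> 0 <= P (x + t).

Lemma wabove_diff i P x : multiaffine P -> wabove P x -> wabove (diff i P) x.
Proof.
move=> aP Px t t0; apply: (@affine_slope_ge0 (P (x + t))) => a a0.
rewrite -aP -addrA; apply: Px; apply: nonnegD => //; exact: nonneg_spike.
Qed.

Lemma wabove_ge0 P x : wabove P x -> 0 <= P x.
Proof. by move=> /(_ 0); rewrite addr0; apply=> i; rewrite ffunE. Qed.

Lemma above_wabove P x : above P x -> wabove P x.
Proof. by move=> Px t /Px/ltW. Qed.

(** Write Q for the averaged function. Above x both Q_i = P_i - P_ij, Q_j = P_j - P_ij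
    and Q_ij = P_ij are nonnegative, hence P = Q + P_i + P_j >= Q > 0. *)
Lemma above_pairop i j P x : multiaffine P ->
  above (pairop i j P) x -> above P x.
Proof.
move=> aP Tx t t0.
have Ty : above (pairop i j P) (x + t) by apply: aboveD.
set y := x + t in Ty *.
have aT := multiaffine_pairop i j aP.
have wT := above_wabove Ty.
have di0 : 0 <= diff i (pairop i j P) y.
  exact: (wabove_ge0 (wabove_diff i aT wT)).
have dj0 : 0 <= diff j (pairop i j P) y.
  exact: (wabove_ge0 (wabove_diff j aT wT)).
have dij0 : 0 <= diff i (diff j (pairop i j P)) y.
  exact: (wabove_ge0 (wabove_diff i (multiaffine_diff _ aT) (wabove_diff j aT wT))).
have := above_gt0 Ty.
have dd k z : diff k (diff k P) z = 0 by exact: diff_diff0.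
have dd2 k l z : diff k (diff k (diff l P)) z = 0.
  by apply: diff_diff0; apply: multiaffine_diff.
have Ei z : diff i (pairop i j P) z = diff i P z - diff j (diff i P) z.
  by rewrite diff_pairop /pairop dd subr0.
have Ej z : diff j (pairop i j P) z = diff j P z - diff i (diff j P) z.
  by rewrite diff_pairop /pairop dd subr0.
move: di0 dj0 dij0; rewrite Ei Ej.
have -> : diff i (diff j (pairop i j P)) y = diff i (diff j P) y.
  rewrite {1}/diff !Ej.
  transitivity (diff i (diff j P) y - diff i (diff i (diff j P)) y).
    by rewrite /diff; ring.
  by rewrite dd2 subr0.
rewrite [diff j (diff i P) y]diffC.
rewrite /pairop; lra.
Qed.

Lemma diff_ge0 i P x : multiaffine P -> above P x -> 0 <= diff i P x.
Proof. by move=> aP /above_wabove/(wabove_diff i aP)/wabove_ge0. Qed.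

Lemma nonincreasing_orthant P x t (g : {ffun I -> R} -> R) :
  (forall y i a, above P y -> 0 <= a -> g (y + spike i a) <= g y) ->
  above P x -> nonneg t -> g (x + t) <= g x.
Proof.
move=> h Px t0; rewrite [t]ffun_sum_spike -big_enum.
elim: (enum I) x Px => [|i s IH] x Px; first by rewrite big_nil addr0.
rewrite big_cons addrA; apply: le_trans (h x i (t i) Px (t0 i)).
by apply: IH; apply: aboveD Px; exact: nonneg_spike (t0 i).
Qed.

(** Along a coordinate other than k this is the Rayleigh inequality; along k the
    function is affine with a nonnegative slope. *)
Lemma barrier_nonincreasing k P x t : multiaffine P -> rayleigh P ->
  above P x -> nonneg t -> barrier k P (x + t) <= barrier k P x.
Proof.
move=> aP rP Px t0.
apply: (@nonincreasing_orthant P _ _ (barrier k P)) => // y i a Py a0.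
rewrite /barrier ler_pdivrMr; last first.
  by apply: above_gt0; apply: aboveD Py; exact: nonneg_spike a0.
rewrite mulrAC ler_pdivlMr ?above_gt0 // aP multiaffine_diff //.
have Py0 := above_gt0 Py; have dk0 := diff_ge0 k aP Py.
case: (eqVneq i k) => [->|/(rP i k y)].
  by rewrite diff_diff0 // mulr0 addr0 mulrDr lerDl; nra.
by nra.
Qed.

Lemma pairop_above i j P x : multiaffine P -> rayleigh P -> above P x ->
  barrier i P x + barrier j P x < 1 -> above (pairop i j P) x.
Proof.
move=> aP rP Px h t t0.
have Pt : 0 < P (x + t) by exact: Px.
have hi := barrier_nonincreasing i aP rP Px t0.
have hj := barrier_nonincreasing j aP rP Px t0.
have : barrier i P (x + t) + barrier j P (x + t) < 1.
  by apply: le_lt_trans h; apply: lerD.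
by rewrite /barrier -mulrDl ltr_pdivrMr // mul1r /pairop; lra.
Qed.

(** If neither of the averaged functions is positive above x, then both barriers are
    at least 1/2 at some point above x, hence at x, where their sum is below 1. *)
Lemma above_shift i j P x : multiaffine P -> rayleigh P ->
  above (pairop i j P) x ->
  above P (x - spike i 2) \/ above P (x - spike j 2).
Proof.
move=> aP rP Tx; have Px := above_pairop aP Tx.
have sh k y : P (y - spike k 2) = P y - 2 * diff k P y.
  have -> : - spike k 2 = spike k (- 2) :> {ffun I -> R}.
    by apply/ffunP => l; rewrite !ffunE; case: eqP; rewrite ?oppr0.
  by rewrite aP; ring.
have step k : ~ above P (x - spike k 2) -> 1/2 <= barrier k P x.
  move=> nP; rewrite leNgt; apply/negP => bk; apply: nP => t t0.
  have Pt : 0 < P (x + t) by exact: Px.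
  have := le_lt_trans (barrier_nonincreasing k aP rP Px t0) bk.
  rewrite addrAC sh /barrier ltr_pdivrMr //; lra.
have T0 : barrier i P x + barrier j P x < 1.
  have := above_gt0 Tx; have := above_gt0 Px.
  by rewrite /barrier -mulrDl => P0; rewrite ltr_pdivrMr // mul1r /pairop; lra.

have [|/step bi] := pselect (above P (x - spike i 2)); first by left.
have [|/step bj] := pselect (above P (x - spike j 2)); first by right.
by move: T0; lra.
Qed.

(** The heart of the barrier argument, for the values p, pi, ..., pijk of a function
    and its derivatives at one point: moving the two averaged coordinates up by d
    compensates for the average. The quadratic hypothesis is the Rayleigh inequality
    for i and j along the coordinate k; it is used at the zero z = - p / pk. *)
Lemma barrier_shift_ineq (p pi pj pk pij pik pjk pijk d : R) :
  0 < p -> 0 <= pi -> 0 <= pj -> 0 < pk ->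
  0 <= pik -> 0 <= pjk -> 0 <= pijk ->
  p * pik <= pi * pk -> p * pjk <= pj * pk ->
  (forall z, (p + z * pk) * (pij + z * pijk) <= (pi + z * pik) * (pj + z * pjk)) ->
  1 <= d -> d <= 2 -> d * (pi + pj) <= (d - 1) * p ->
  (pk + (d - 1) * (pik + pjk) + d * (d - 2) * pijk) * p <=
  pk * (p + (d - 1) * (pi + pj) + d * (d - 2) * pij).
Proof.
move=> p0 pi0 pj0 pk0 pik0 pjk0 pijk0 hi hj hq d1 d2 hd.
pose r := p / pk; have rE : p = r * pk by rewrite /r divfK // gt_eqF.
have r0 : 0 < r by rewrite divr_gt0.
pose mi := pi - r * pik; pose mj := pj - r * pjk; pose ka := pij - r * pijk.
have mi0 : 0 <= mi by rewrite subr_ge0 -(ler_pM2r pk0) mulrAC -rE.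
have mj0 : 0 <= mj by rewrite subr_ge0 -(ler_pM2r pk0) mulrAC -rE.
have quad w : 0 <= mi * mj + w * (mi * pjk + mj * pik - pk * ka) +
                   w ^+ 2 * (pik * pjk - pk * pijk).
  have := hq (w - r); rewrite rE -subr_ge0; congr (0 <= _).
  by rewrite /mi /mj /ka; ring.
(* The coefficients of a quadratic that is nonnegative on the whole line. *)
have disc : pk * ka <= (mi + mj) * (pik + pjk).
  suff : 0 <= (mi * pjk + mj * pik - pk * ka) + (mi * pik + mj * pjk) by lra.
  have [mi1|mi1] := ltP 0 mi; last first.
    have {mi1} mi1 : mi = 0 by lra.
    suff : 0 <= mj * pik - pk * ka.
      have : 0 <= mj * pjk by rewrite mulr_ge0.
      by rewrite mi1; lra.
    apply: (@affine_slope_ge0 `|pik * pjk - pk * pijk|) => a.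
    rewrite le_eqVlt => /orP[/eqP<-|a0]; first by rewrite mul0r addr0.
    have := quad a^-1; rewrite mi1 -(pmulr_rge0 _ (mulr_gt0 a0 a0)).
    have -> : a * a * (0 * mj + a^-1 * (0 * pjk + mj * pik - pk * ka) +
      a^-1 ^+ 2 * (pik * pjk - pk * pijk)) =
      (pik * pjk - pk * pijk) + a * (mj * pik - pk * ka).
      by field; rewrite gt_eqF.
    by move=> /le_trans; apply; rewrite lerD2r ler_norm.
  have [pjk1|pjk1] := ltP 0 pjk; last first.
    have {pjk1} pjk1 : pjk = 0 by lra.
    suff : 0 <= mi * pjk + mj * pik - pk * ka.
      have : 0 <= mi * pik by rewrite mulr_ge0.
      by rewrite pjk1; lra.
    apply: (@affine_slope_ge0 (mi * mj)) => a a0; apply: le_trans (quad a) _.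
    rewrite pjk1 gerDl mulr0 add0r mulrN oppr_le0.
    by rewrite !mulr_ge0 // ?sqr_ge0 // ltW.
  have w0 : 0 < mi / pjk by rewrite divr_gt0.
  have := quad (mi / pjk).
  have E : mi / pjk * pjk = mi by rewrite divfK // gt_eqF.
  set w := mi / pjk in w0 E *; move=> q.
  rewrite -(pmulr_rge0 _ w0); apply: le_trans q _; rewrite -subr_ge0.
  have -> : w * (mi * pjk + mj * pik - pk * ka + (mi * pik + mj * pjk)) -
    (mi * mj + w * (mi * pjk + mj * pik - pk * ka) + w ^+ 2 * (pik * pjk - pk * pijk))
    = w ^+ 2 * (pk * pijk) by rewrite -E; ring.
  exact: mulr_ge0 (sqr_ge0 _) (mulr_ge0 (ltW pk0) pijk0).
have kam : d * ka <= (d - 1) * (mi + mj).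
  have mm : 0 <= mi + mj by apply: addr_ge0.
  have pp : d * (pik + pjk) <= (d - 1) * pk.
    have : d * (r * (pik + pjk)) <= d * (pi + pj).
      by apply: ler_wpM2l; [lra | move: mi0 mj0; rewrite /mi /mj; lra].
    have e1 : r * ((d - 1) * pk) = (d - 1) * p by rewrite [in RHS]rE; ring.
    have e2 : r * (d * (pik + pjk)) = d * (r * (pik + pjk)) by ring.
    by move=> h; rewrite -(ler_pM2l r0) e1 e2; apply: le_trans hd.
  rewrite -(ler_pM2l pk0).
  have h1 : d * (pk * ka) <= d * ((mi + mj) * (pik + pjk)).
    by apply: ler_wpM2l => //; lra.
  have h2 : (mi + mj) * (d * (pik + pjk)) <= (mi + mj) * ((d - 1) * pk).
    exact: ler_wpM2l.
  have e1 : pk * (d * ka) = d * (pk * ka) by ring.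
  have e2 : d * ((mi + mj) * (pik + pjk)) = (mi + mj) * (d * (pik + pjk)) by ring.
  have e3 : pk * ((d - 1) * (mi + mj)) = (mi + mj) * ((d - 1) * pk) by ring.
  by rewrite e1 e3; apply: le_trans h1 _; rewrite e2.
rewrite -subr_ge0.
have -> : pk * (p + (d - 1) * (pi + pj) + d * (d - 2) * pij) -
   (pk + (d - 1) * (pik + pjk) + d * (d - 2) * pijk) * p
  = pk * ((d - 1) * (mi + mj) - (2 - d) * (d * ka)).
  by rewrite /mi /mj /ka rE; ring.
apply: mulr_ge0; first exact: ltW.
have := ler_wpM2l (_ : 0 <= 2 - d) kam; rewrite subr_ge0 => /(_ d2).
have : 0 <= (d - 1) ^+ 2 * (mi + mj) by exact: mulr_ge0 (sqr_ge0 _) (addr_ge0 mi0 mj0).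
lra.
Qed.

Lemma pairop_diag i j P x d : multiaffine P ->
  pairop i j P (x + spike i d + spike j d) =
  P x + (d - 1) * (diff i P x + diff j P x) + d * (d - 2) * diff i (diff j P) x.
Proof.
move=> aP; rewrite /pairop multiaffine2 //.
have dd k l z : diff k (diff l (diff k P)) z = 0.
  transitivity (diff l (diff k (diff k P)) z); first exact: diffC.
  by rewrite {1}/diff !diff_diff0 // subr0.
rewrite (multiaffine2 i j x d d (multiaffine_diff i aP)).
rewrite (multiaffine2 i j x d d (multiaffine_diff j aP)).
rewrite !diff_diff0 // dd (diffC j i).
have -> : diff i (diff j (diff j P)) x = 0.
  by rewrite {1}/diff !diff_diff0 // subr0.
by ring.
Qed.

(** When the derivative in the direction k vanishes at x, the Rayleigh inequality
    makes all mixed derivatives involving k vanish too; otherwise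
    [barrier_shift_ineq] applies. *)
Lemma barrier_pairop i j k P x d : multiaffine P -> rayleigh P -> above P x ->
  i != k -> j != k -> i != j -> 1 <= d -> d <= 2 ->
  barrier i P x + barrier j P x <= 1 - d^-1 ->
  barrier k (pairop i j P) (x + spike i d + spike j d) <= barrier k P x.
Proof.
move=> aP rP Px ik jk ij d1 d2 hd.
have d0 : 0 < d by lra.
have Px0 := above_gt0 Px.
have b1 : barrier i P x + barrier j P x < 1.
  by apply: le_lt_trans hd _; rewrite gtrBl invr_gt0.
have aT : above (pairop i j P) (x + spike i d + spike j d).
  by do 2 (apply: aboveD; first by apply: nonneg_spike; lra); apply: pairop_above.
rewrite /barrier ler_pdivrMr ?above_gt0 // mulrAC ler_pdivlMr //.
have -> : diff k (pairop i j P) (x + spike i d + spike j d) =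
          pairop i j (diff k P) (x + spike i d + spike j d) by exact: diff_pairop.
rewrite !pairop_diag //; last exact: multiaffine_diff.
have wP := above_wabove Px.
have ge k' : 0 <= diff k' P x by exact: diff_ge0.
have ge2 k' l : 0 <= diff k' (diff l P) x.
  exact: wabove_ge0 (wabove_diff _ (multiaffine_diff _ aP) (wabove_diff _ aP wP)).
have ge3 : 0 <= diff i (diff j (diff k P)) x.
  apply: wabove_ge0; apply: wabove_diff; first by do 2 apply: multiaffine_diff.
  by apply: wabove_diff; [exact: multiaffine_diff | exact: wabove_diff].
have hd' : d * (diff i P x + diff j P x) <= (d - 1) * P x.
  move: (hd); rewrite /barrier -mulrDl ler_pdivrMr // => h.
  rewrite -(ler_pM2l d0) in h; apply: le_trans h _.
  suff -> : d * ((1 - d^-1) * P x) = (d - 1) * P x by [].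
  by field; rewrite gt_eqF.
have [k0|k0] := ltP 0 (diff k P x).
  apply: barrier_shift_ineq => //; try by [exact: ge2 | exact: ge].
  - by have := rP i k x ik.
  - by have := rP j k x jk.
  move=> z; have := rP i j (x + spike k z) ij.
  have aj := multiaffine_diff j aP.
  rewrite aP (multiaffine_diff i aj) (multiaffine_diff i aP) aj.
  suff -> : diff k (diff i (diff j P)) x = diff i (diff j (diff k P)) x.
    by rewrite !(diffC k).
  have E : diff k (diff j P) = diff j (diff k P) by apply/funext => w; exact: diffC.
  by rewrite diffC E.
have {k0}k0 : diff k P x = 0 by apply/eqP; rewrite eq_le k0 ge.
have z2 l : l != k -> diff l (diff k P) x = 0.
  move=> lk; apply/eqP; rewrite eq_le ge2 andbT -(pmulr_rle0 _ Px0).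
  by have := rP l k x lk; rewrite k0 mulr0.
have z3 : diff i (diff j (diff k P)) x <= 0.
  have Pj : 0 < P (x + spike j 1) by apply: Px; apply: nonneg_spike.
  rewrite -(pmulr_rle0 _ Pj).
  have ak := multiaffine_diff k aP.
  have := rP i k (x + spike j 1) ik; rewrite (multiaffine_diff i ak) ak.
  rewrite k0 (z2 _ ik) (z2 _ jk) mulr0 !add0r mulr0 mul1r.
  suff -> : diff j (diff i (diff k P)) x = diff i (diff j (diff k P)) x by [].
  exact: diffC.
have {}z3 : diff i (diff j (diff k P)) x = 0 by apply/eqP; rewrite eq_le z3 ge3.
by rewrite k0 (z2 _ ik) (z2 _ jk) z3 !(addr0, mulr0, mul0r).
Qed.

End Barrier.

Section PairedVariables.
Variables (R : realFieldType) (J : finType).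
Notation I := (J * bool)%type.
Implicit Types (P : {ffun I -> R} -> R) (x : {ffun I -> R}) (s : seq J).

Definition pairops (K : fieldType) (s : seq J) (f : {ffun I -> K} -> K) :=
  foldr (fun j => pairop (j, false) (j, true)) f s.

(** Averaging one pair after the other moves two coordinates by d each time. The
    barriers in the remaining directions do not grow, so that their bound at the
    starting point pays for every later step. *)
Lemma above_pairops s P x d e :
  (forall s', multiaffine (pairops s' P) /\ rayleigh (pairops s' P)) ->
  uniq s -> 1 <= d -> d <= 2 -> e + e <= 1 - d^-1 -> above P x ->
  (forall k, barrier k P x <= e) ->
  above (pairops s P) (x + \sum_(j <- s) (spike (j, false) d + spike (j, true) d)).
Proof.
move=> hP us d1 d2 ed Px bx.
suff : above (pairops s P) (x + \sum_(j <- s) (spike (j, false) d + spike (j, true) d))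
  /\ forall k, k.1 \notin s ->
     barrier k (pairops s P) (x + \sum_(j <- s) (spike (j, false) d + spike (j, true) d))
       <= e by case.
have d0 : 0 < d by lra.
elim: s us => [_|j s IH] /=; first by rewrite big_nil addr0.
case/andP => js us; have := IH us.
have -> : x + \sum_(l <- j :: s) (spike (l, false) d + spike (l, true) d) =
  x + \sum_(l <- s) (spike (l, false) d + spike (l, true) d) +
  spike (j, false) d + spike (j, true) d.
  rewrite big_cons; set S := \sum_(l <- s) _.
  by rewrite [_ + _ + S]addrC !addrA.
set y := x + _ => -[Py by_].
have [aP rP] := hP s.
have bj : barrier (j, false) (pairops s P) y + barrier (j, true) (pairops s P) y
    <= 1 - d^-1 by apply: le_trans ed; apply: lerD; apply: by_.
split.
  apply: aboveD; first by apply: nonneg_spike; lra.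
  apply: aboveD; first by apply: nonneg_spike; lra.
  apply: pairop_above => //; apply: le_lt_trans bj _.
  by rewrite gtrBl invr_gt0.
move=> k; rewrite in_cons negb_or => /andP[kj ks]; apply: le_trans (by_ k ks).
case: k kj {ks} => k b /= kj.
by apply: barrier_pairop; rewrite // xpair_eqE ?[j == k]eq_sym ?(negbTE kj) ?andbF.
Qed.

(** The averages are undone one at a time with [above_shift]. *)
Lemma above_choice s P x :
  (forall s', multiaffine (pairops s' P) /\ rayleigh (pairops s' P)) ->
  uniq s -> above (pairops s P) x ->
  exists sg : J -> bool, above P (x - \sum_(j <- s) spike (j, sg j) 2).
Proof.
move=> hP; elim: s x => [|j s IH] x /=.
  by exists (fun=> true); rewrite big_nil subr0.
case/andP=> js us Tx; have [aP rP] := hP s.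
suff [b /(IH _ us)[sg hsg]] : exists b, above (pairops s P) (x - spike (j, b) 2).
  exists (fun l => if l == j then b else sg l); rewrite big_cons eqxx opprD addrA.
  suff -> : \sum_(l <- s) spike (l, if l == j then b else sg l) 2 =
            \sum_(l <- s) spike (l, sg l) 2 :> {ffun I -> R} by [].
  apply: eq_big_seq => l ls; case: eqP => // lj; by rewrite lj (negbTE js) in ls.
by have [?|?] := above_shift aP rP Tx; [exists false | exists true].
Qed.

End PairedVariables.

(** * Stable multiaffine functions *)

Section Stable.
Local Open Scope complex_scope.
Variables (R : rcfType) (I : finType).
Local Notation C := R[i].
Local Notation Re := (@complex.Re R).
Local Notation Im := (@complex.Im R).
Implicit Types (p : {ffun I -> C} -> C) (z : {ffun I -> C}) (x : {ffun I -> R}).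

Definition cvec x : {ffun I -> C} := [ffun i => (x i)%:C].

Definition conjv z : {ffun I -> C} := [ffun i => conjc (z i)].

(** Real stability. *)
Definition stable p := [/\ multiaffine p,
  forall z, p (conjv z) = conjc (p z) &
  forall z, (forall i, 0 < Im (z i)) -> p z != 0].

Definition rtrace p x : R := Re (p (cvec x)).

Lemma cvecD x y : cvec (x + y) = cvec x + cvec y.
Proof. by apply/ffunP => i; rewrite !ffunE rmorphD. Qed.

Lemma cvec_spike (i : I) (w : R) : cvec (spike i w) = spike i w%:C.
Proof. by apply/ffunP => j; rewrite !ffunE; case: eqP. Qed.

Lemma rtrace_diff i p x : diff i (rtrace p) x = rtrace (diff i p) x.
Proof. by rewrite /rtrace /diff cvecD cvec_spike raddfB. Qed.

Lemma rtrace_multiaffine p : multiaffine p -> multiaffine (rtrace p).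
Proof.
move=> ap i x w; rewrite rtrace_diff /rtrace cvecD cvec_spike ap raddfD /=.
by case: (diff i p _) => a b; rewrite /= mul0r subr0.
Qed.

Lemma stable_real p x : stable p -> p (cvec x) = (rtrace p x)%:C.
Proof.
case=> _ cp _; have : p (cvec x) = conjc (p (cvec x)).
  rewrite -cp; congr p; apply/ffunP => i; rewrite !ffunE.
  by rewrite /= oppr0.
rewrite /rtrace; case: (p _) => a b [] ?; congr (_ +i* _); lra.
Qed.

(** As a function of its i-th coordinate alone, p vanishes at z_i - p / p_i, which
    must not lie in the open upper half plane. *)
Lemma stable_open p i z : stable p -> (forall j, 0 < Im (z j)) ->
  diff i p z = 0 \/ Im (diff i p z * conjc (p z)) < 0.
Proof.
case=> ap _ np z0; case: (eqVneq (diff i p z) 0) => [->|a0]; first by left.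
right; rewrite ltNge; apply/negP => h.
suff /np : forall j, 0 < Im ((z + spike i (- (p z / diff i p z))) j).
  by rewrite ap mulNr divfK // subrr eqxx.
move=> j; rewrite !ffunE; case: eqP => [_|_]; last by rewrite addr0.
rewrite raddfD /=; apply: ltr_pwDl => //.
move: h a0; case: (diff i p z) => a b; case: (p z) => c d.
rewrite eq_complex /= => h ab.
have n0 : 0 < a ^+ 2 + b ^+ 2.
  have := sqr_ge0 a; have := sqr_ge0 b.
  rewrite lt_def addr_ge0 ?sqr_ge0 // andbT paddr_eq0 ?sqr_ge0 // !sqrf_eq0 ab.
  by [].
have -> : - (c * - (b / (a ^+ 2 + b ^+ 2)) + d * (a / (a ^+ 2 + b ^+ 2))) =
    (b * c - a * d) / (a ^+ 2 + b ^+ 2).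
  by field; rewrite gt_eqF.
rewrite divr_ge0 // ?(ltW n0) //; move: h => /=; lra.
Qed.

(** The limit for e tending to 0, with an explicit small e. *)
Lemma quad_limit (u v w : R) :
  (forall e, 0 < e -> u + e * v + e ^+ 2 * w <= 0) -> u <= 0.
Proof.
move=> h; rewrite leNgt; apply/negP => u0.
pose B := `|v| + `|w| + u + 1.
have B0 : 0 < B by rewrite /B; have := normr_ge0 v; have := normr_ge0 w; lra.
have := h (u / (2 * B)) ; rewrite divr_gt0 ?mulr_gt0 // => /(_ isT).
set e := u / (2 * B).
have e0 : 0 < e by rewrite divr_gt0 ?mulr_gt0.
have eB : e * B = u / 2 by rewrite /e; field; rewrite gt_eqF.
have e1 : e <= 1.
  rewrite /e ler_pdivrMr ?mulr_gt0 // mul1r /B.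
  by have := normr_ge0 v; have := normr_ge0 w; lra.
have v1 : - `|v| <= v by rewrite lerNl -normrN ler_norm.
have w1 : - `|w| <= w by rewrite lerNl -normrN ler_norm.
have : e * (- `|v|) <= e * v by rewrite ler_wpM2l // ltW.
have : e * (e * (- `|w|)) <= e * (e * w) by rewrite !ler_wpM2l // ltW.
have : e * (e * `|w|) <= 1 * (e * `|w|).
  by rewrite ler_wpM2r // mulr_ge0 // ltW.
have : e * (`|v| + `|w|) <= e * B.
  by rewrite ler_wpM2l ?ltW // /B; lra.
rewrite eB expr2; lra.
Qed.

(** The sign condition of [stable_open] extends to real coordinates, which are moved
    into the upper half plane one at a time by an amount tending to 0. *)
Lemma stable_closed p i z : stable p -> (forall j, 0 <= Im (z j)) ->
  Im (diff i p z * conjc (p z)) <= 0.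
Proof.
move=> sp; have [ap _ _] := sp.
have [n] := ubnP #|[pred j | Im (z j) == 0]|.
elim: n z => // n IH z zn z0.
have [j /= /eqP zj|zpos] := pickP [pred j | Im (z j) == 0]; last first.
  have [j|->|/ltW//] := @stable_open p i z sp; last by rewrite mul0r.
  by rewrite lt_def z0 andbT; have := zpos j; rewrite /= => ->.
have key e : 0 < e ->
  Im (diff i p (z + spike j (0 +i* e)) * conjc (p (z + spike j (0 +i* e)))) <= 0.
  move=> e0; apply: IH; last first.
    move=> k; rewrite !ffunE; case: eqP => [_|_]; last by rewrite addr0.
    by rewrite raddfD /= addr_ge0 // ltW.
  rewrite -ltnS; apply: leq_trans zn; rewrite ltnS; apply: proper_card.
  apply/properP; split.
    apply/fintype.subsetP => k; rewrite !inE !ffunE; case: (k =P j) => [->|_].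
      by rewrite raddfD /= zj add0r (gt_eqF e0).
    by rewrite addr0.
  exists j; rewrite !inE ?zj // !ffunE eqxx raddfD /= zj add0r.
  by rewrite gt_eqF.
move: key; have ad := multiaffine_diff i ap.
case: (diff i p z) (ad j z) => a1 a2 Ea; case: (p z) (ap j z) => c1 c2 Ec.
case Eb: (diff j (diff i p) z) Ea => [b1 b2] Ea.
case Ed: (diff j p z) Ec => [d1 d2] Ec.
move=> key; apply: (@quad_limit _
  (b1 * c1 + b2 * c2 - a2 * d2 - a1 * d1) (b2 * d1 - b1 * d2)) => e e0.
have := key e e0; rewrite Ea Ec /=; lra.
Qed.

(** Put the imaginary unit on top of the j-th coordinate of a real point: the imaginary
    part controlled by [stable_closed] becomes the difference of the two sides. *)
Lemma stable_rayleigh p : stable p -> rayleigh (rtrace p).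
Proof.
move=> sp i j x ij; have [ap _ _] := sp.
have := @stable_closed p i (cvec x + spike j 'i) sp.
rewrite ap (multiaffine_diff i ap).
have dE k y : diff k p (cvec y) = (diff k (rtrace p) y)%:C.
  by rewrite /diff -(cvec_spike k 1) -cvecD !stable_real // rmorphB.
have ddE : diff j (diff i p) (cvec x) = (diff j (diff i (rtrace p)) x)%:C.
  rewrite /diff -(cvec_spike i 1) -(cvec_spike j 1) -!cvecD.
  by rewrite !stable_real // !rmorphB.
rewrite ddE !dE stable_real //= (diffC j) => h.
have /h : forall k, 0 <= Im ((cvec x + spike j 'i) k).
  by move=> k; rewrite !ffunE; case: eqP => _; rewrite /= ?addr0 ?add0r.
lra.
Qed.

(** If p = p_i + p_j somewhere in the upper half space, then
    |p|^2 = p_i conj p + p_j conj p would have a negative imaginary part. *)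
Lemma stable_pairop i j p : stable p -> stable (pairop i j p).
Proof.
move=> sp; have [ap cp np] := sp; split.
- exact: multiaffine_pairop.
- have sc k z : diff k p (conjv z) = conjc (diff k p z).
    have conjcB a b : conjc (a - b) = conjc a - conjc b :> C by exact: rmorphB.
    rewrite /diff conjcB -!cp; congr (p _ - _).
    by apply/ffunP => l; rewrite !ffunE raddfD /=; case: eqP; rewrite /= ?oppr0.
  by move=> z; rewrite /pairop cp !sc !raddfB.
move=> z z0; apply/eqP => T0; have /eqP pz := np z z0; apply: pz.
move: T0; rewrite /pairop => /eqP; rewrite subr_eq add0r subr_eq => /eqP pE.
have [ai|ai] := @stable_open p i z sp z0; have [aj|aj] := @stable_open p j z sp z0.
- by rewrite pE ai aj addr0.
- move: aj; rewrite ai addr0 in pE; rewrite -pE.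
  by case: (p z) => a b /=; rewrite mulrN mulrC addNr ltxx.
- move: ai; rewrite aj add0r in pE; rewrite -pE.
  by case: (p z) => a b /=; rewrite mulrN mulrC addNr ltxx.
have : Im (p z * conjc (p z)) = 0.
  by case: (p z) => a b /=; rewrite mulrN mulrC addNr.
have ImD a b : Im (a + b) = Im a + Im b by case: a => ? ?; case: b.
rewrite {1}pE mulrDl ImD => /eqP; rewrite lt_eqF // -[0]addr0.
exact: ltrD.
Qed.

Lemma rtrace_pairop i j p : rtrace (pairop i j p) = pairop i j (rtrace p).
Proof. by apply/funext => x; rewrite /pairop !rtrace_diff /rtrace !raddfB. Qed.

End Stable.

Lemma stable_pairops (R : rcfType) (J : finType) (s : seq J)
    (p : {ffun J * bool -> R[i]} -> R[i]) : stable p ->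
  multiaffine (pairops s (rtrace p)) /\ rayleigh (pairops s (rtrace p)).
Proof.
move=> sp; have [<- sq] : rtrace (pairops s p) = pairops s (rtrace p) /\
    stable (pairops s p).
  elim: s => [|j s [IH sq]] //=; split; first by rewrite rtrace_pairop IH.
  exact: stable_pairop.
by split; [apply: rtrace_multiaffine; case: sq | exact: stable_rayleigh].
Qed.

(** * Determinants of frame operators *)

Section Determinants.
Local Open Scope complex_scope.
Local Open Scope sesquilinear_scope.
Variables (K : fieldType) (n : nat).
Implicit Types (M : 'M[K]_n) (u : 'cV[K]_n) (a : 'rV[K]_n).

Let bordered w M u a := block_mx (1 : 'M[K]_1) (- (w *: a)) u M.

Lemma det_bordered w M u a : \det (bordered w M u a) = \det (M + w *: (u *m a)).
Proof.
have <- : \det (bordered w M u a *m block_mx 1 (w *: a) 0 1%:M) =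
    \det (bordered w M u a).
  by rewrite det_mulmx det_ublock !det1 !mulr1.
rewrite /bordered mulmx_block !mulmx1 !mulmx0 !mul1mx addrN !addr0 det_lblock.
by rewrite det1 mul1r -scalemxAr addrC.
Qed.

(** In a bordered matrix the parameter w sits in a single row, in which the determinant
    is linear. *)
Lemma det_rank1_affine M u a : exists c, forall w,
  \det (M + w *: (u *m a)) = \det M + w * c.
Proof.
exists (\det (block_mx (0 : 'M[K]_1) (- a) u M)) => w.
rewrite -det_bordered.
have -> : \det M = \det (bordered 0 M u a) by rewrite det_bordered scale0r addr0.
rewrite -[\det (bordered 0 _ _ _)]mul1r.
apply: (determinant_multilinear (i0 := lshift n (ord0 : 'I_1))).
- rewrite !rowKu !row_row_mx !scale_row_mx add_row_mx.
  by congr row_mx; apply/rowP => k; rewrite !mxE; ring.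
- by rewrite !(@row'Ku _ 0); rewrite [row' ord0 _]flatmx0 [in RHS]flatmx0.
- by rewrite !(@row'Ku _ 0); rewrite [row' ord0 _]flatmx0 [in RHS]flatmx0.
Qed.

Lemma det_scalar_rank1 t u a : t != 0 ->
  \det (t%:M + u *m a) = t ^+ n * (1 + (a *m u) 0 0 / t).
Proof.
move=> t0; have := det_bordered 1 (t%:M) u a; rewrite scale1r => <-.
have <- : \det (bordered 1 t%:M u a *m block_mx 1 0 (- t^-1 *: u) 1%:M)
   = \det (bordered 1 t%:M u a).
  by rewrite det_mulmx det_lblock !det1 !mulr1.
rewrite /bordered mulmx_block !mulmx1 !mulmx0 scale1r mul_scalar_mx scalerA.
rewrite mulrN divff // scaleN1r subrr !add0r det_ublock det_scalar mulrC.
have -> : - a *m (- t^-1 *: u) = t^-1 *: (a *m u).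
  by rewrite -scalemxAr mulNmx scaleNr scalerN opprK.
by congr (_ * _); rewrite det_mx11 !mxE mulrC.
Qed.
End Determinants.

Section Frames.
Local Open Scope complex_scope.
Local Open Scope sesquilinear_scope.
Variables (R : rcfType) (n : nat) (J : finType).
Local Notation C := R[i].
Local Notation Re := (@complex.Re R).
Local Notation Im := (@complex.Im R).
Implicit Types (v : J -> 'cV[C]_n) (u : 'rV[C]_n) (z : {ffun J -> C}).

Definition sqmod (c : C) : R := Re c ^+ 2 + Im c ^+ 2.

Lemma sqmodE (c : C) : c * conjc c = (sqmod c)%:C.
Proof. by case: c => a b; rewrite /sqmod /=; congr (_ +i* _); ring. Qed.

Lemma sqmod_ge0 c : 0 <= sqmod c.
Proof. by rewrite addr_ge0 ?sqr_ge0. Qed.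

Lemma sqmod_eq0 c : (sqmod c == 0) = (c == 0).
Proof. by rewrite paddr_eq0 ?sqr_ge0 // !sqrf_eq0 eq_complex. Qed.

Lemma sqmodM c d : sqmod (c * d) = sqmod c * sqmod d.
Proof. by case: c => a b; case: d => a' b'; rewrite /sqmod /=; ring. Qed.

Definition coef u (w : 'cV[C]_n) : C := (u *m w) 0 0.

Definition sqnorm u : R := \sum_k sqmod (u 0 k).

Definition sqnormc (w : 'cV[C]_n) : R := \sum_k sqmod (w k 0).

Definition frame_op v z : 'M[C]_n := \sum_j z j *: (v j *m (v j)^t*).

Lemma frame_opE v z u : (u *m frame_op v z *m u^t*) 0 0 =
  \sum_j z j * (sqmod (coef u (v j)))%:C.
Proof.
rewrite /frame_op mulmx_sumr mulmx_suml summxE; apply: eq_bigr => j _.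
rewrite -scalemxAr -scalemxAl mxE -sqmodE; congr (_ * _).
have cE k : (v j)^t* 0 k = conjc (v j k 0) by rewrite !mxE.
have -> : u *m (v j *m (v j)^t*) *m u^t* = (u *m v j) *m ((v j)^t* *m u^t*).
  by rewrite !mulmxA.
rewrite [LHS]mxE big_ord1 /coef; congr (_ * _).
rewrite !mxE rmorph_sum /=; apply: eq_bigr => k _.
by rewrite cE !mxE rmorphM mulrC.
Qed.

Definition framedet v z : C := \det (frame_op v z).

Lemma frame_opD v z j w :
  frame_op v (z + spike j w) = frame_op v z + w *: (v j *m (v j)^t*).
Proof.
rewrite /frame_op (bigD1 j) //= [in RHS](bigD1 j) //= !ffunE eqxx scalerDl.
rewrite -!addrA; congr (_ + _); rewrite addrC; congr (_ + _).
by apply: eq_bigr => k kj; rewrite !ffunE (negbTE kj) addr0.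
Qed.

Lemma framedet_multiaffine v : multiaffine (framedet v).
Proof.
move=> j z w; rewrite /diff /framedet !frame_opD scale1r.
have [c hc] := det_rank1_affine (frame_op v z) (v j) ((v j)^t*).
by have := hc 1; rewrite scale1r hc => ->; ring.
Qed.

Lemma frame_op_conj v z : frame_op v (conjv z) = (frame_op v z)^t*.
Proof.
apply/matrixP => a b; rewrite !mxE !summxE rmorph_sum; apply: eq_bigr => j _.
rewrite !mxE !ffunE rmorphM; congr (_ * _).
rewrite !big_ord1 !mxE rmorphM /= mulrC; congr (_ * _).
by rewrite [RHS]conjCK.
Qed.

Lemma framedet_conj v z : framedet v (conjv z) = conjc (framedet v z).
Proof. by rewrite /framedet frame_op_conj det_map_mx det_tr. Qed.

Definition parseval v := \sum_j v j *m (v j)^t* = 1%:M.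

Lemma sqnormE u : (u *m u^t*) 0 0 = (sqnorm u)%:C.
Proof.
rewrite mxE /sqnorm rmorph_sum; apply: eq_bigr => k _.
by rewrite !mxE sqmodE.
Qed.

Lemma parsevalE v u : parseval v -> \sum_j sqmod (coef u (v j)) = sqnorm u.
Proof.
move=> pv; have := frame_opE v [ffun=> 1] u.
have -> : frame_op v [ffun=> 1] = 1%:M.
  by rewrite -pv; apply: eq_bigr => j _; rewrite ffunE scale1r.
rewrite mulmx1 sqnormE => /(congr1 Re) /= ->.
by rewrite raddf_sum; apply: eq_bigr => j _; rewrite ffunE mul1r.
Qed.

Lemma sqnorm_eq0 u : (sqnorm u == 0) = (u == 0).
Proof.
rewrite psumr_eq0 => [|k _]; last exact: sqmod_ge0.
apply/allP/eqP => [h|-> k _]; last by rewrite /= mxE sqmod_eq0.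
apply/rowP => k; apply/eqP; rewrite [X in _ == X]mxE -sqmod_eq0.
by have := h k; rewrite mem_index_enum => /(_ isT).
Qed.

(** A null vector u of the frame operator turns into a linear relation between the
    weights, with coefficients |<u, v j>|^2; in a Parseval frame they are not all 0. *)
Lemma framedet_eq0 v z : parseval v -> framedet v z = 0 ->
  exists2 c : J -> R, \sum_j z j * (c j)%:C = 0 &
    (forall j, 0 <= c j) /\ exists j, 0 < c j.
Proof.
move=> pv /eqP/det0P[u u0 uM]; exists (fun j => sqmod (coef u (v j))).
  by rewrite -frame_opE uM mul0mx mxE.
split=> [j|]; first exact: sqmod_ge0.
apply: contrapT => h; move/negP: u0; apply; rewrite -sqnorm_eq0 -(parsevalE _ pv).
rewrite big1 // => j _; apply/eqP; rewrite eq_le sqmod_ge0 andbT leNgt.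
by apply/negP => cj; apply: h; exists j.
Qed.

(** Positive coefficients in the relation of [framedet_eq0] exclude weights that all
    have positive imaginary parts. *)
Lemma framedet_stable v : parseval v -> stable (framedet v).
Proof.
move=> pv; split; [exact: framedet_multiaffine | exact: framedet_conj |].
move=> z z0; apply/eqP => /(framedet_eq0 pv)[c /(congr1 Im) hc [c0 [j cj]]].
have : \sum_j Im (z j) * c j = 0.
  rewrite -[RHS]hc raddf_sum; apply: eq_bigr => k _.
  by case: (z k) => a b /=; rewrite mulr0 add0r.
move/eqP; rewrite psumr_eq0 => [|k _]; last by rewrite mulr_ge0 // ltW.
move/allP/(_ j); rewrite mem_index_enum => /(_ isT) /=.
by rewrite mulf_eq0 !gt_eqF.
Qed.

(** No zero is met on the way up, since at positive weights the frame operator is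
    invertible; the coordinates are raised one at a time. *)
Lemma framedet_real_gt0 v (x s : {ffun J -> R}) : parseval v ->
  (forall j, 0 < x j) -> nonneg s -> 0 < rtrace (framedet v) x ->
  0 < rtrace (framedet v) (x + s).
Proof.
move=> pv x0 s0; have st := framedet_stable pv.
have nz (y : {ffun J -> R}) : (forall j, 0 < y j) -> rtrace (framedet v) y != 0.
  move=> y0; apply/eqP => ry; have : framedet v (cvec y) = 0.
    by rewrite stable_real // ry.
  move/(framedet_eq0 pv) => [c /(congr1 Re) hc [c0 [j cj]]].
  have : \sum_j y j * c j = 0.
    rewrite -[RHS]hc raddf_sum; apply: eq_bigr => k _.
    by rewrite ffunE /= mulr0 subr0.
  move/eqP; rewrite psumr_eq0 => [|k _]; last by rewrite mulr_ge0 // ltW.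
  move/allP/(_ j); rewrite mem_index_enum => /(_ isT) /=.
  by rewrite mulf_eq0 !gt_eqF.
have ra := rtrace_multiaffine (framedet_multiaffine v).
rewrite [s]ffun_sum_spike -big_enum.
elim: (enum J) x x0 => [|j l IH] x x0 Ex; first by rewrite big_nil addr0.
rewrite big_cons addrA.
have x1 a : 0 <= a -> forall k, 0 < (x + spike j a) k.
  move=> a0 k; rewrite !ffunE; case: eqP => _; last by rewrite addr0.
  by apply: ltr_pwDl.
apply: IH; first exact: x1.
rewrite ra ltNge; apply/negP => h.
set d := diff j _ x in h.
have d0 : d < 0.
  rewrite ltNge; apply/negP => d0; move: h; rewrite leNgt => /negP; apply.
  by apply: ltr_pwDl => //; apply: mulr_ge0.
have /x1/nz : 0 <= rtrace (framedet v) x / - d.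
  by rewrite divr_ge0 ?oppr_ge0 // ltW.
rewrite ra -/d; set e := rtrace _ x.
have -> : e + e / - d * d = 0 by field; rewrite lt_eqF.
by rewrite eqxx.
Qed.

End Frames.

(** * Halving a frame *)

Section Halving.
Local Open Scope complex_scope.
Local Open Scope sesquilinear_scope.
Variables (R : rcfType) (n : nat) (J : finType).
Local Notation C := R[i].
Local Notation Re := (@complex.Re R).
Local Notation Im := (@complex.Im R).
Implicit Types (v : J -> 'cV[C]_n) (u : 'rV[C]_n).

Definition slice (K : nmodType) b (z : {ffun J * bool -> K}) : {ffun J -> K} :=
  [ffun j => z (j, b)].

(** Two copies of the determinant. Lowering the coordinate (j, b) by 2 records that
    the vector v j is put into the part b, so that an average over the pair
    (j, false), (j, true) is an average over the two places for v j. *)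
Definition pairdet v (z : {ffun J * bool -> C}) : C :=
  framedet v (slice false z) * framedet v (slice true z).

Lemma slice_spike (K : fieldType) b (z : {ffun J * bool -> K}) j b' w :
  slice b (z + spike (j, b') w) =
  if b == b' then slice b z + spike j w else slice b z.
Proof.
apply/ffunP => k; rewrite !ffunE xpair_eqE.
by case: (b =P b') => _; rewrite !ffunE ?andbT // andbF addr0.
Qed.

Lemma pairdet_stable v : parseval v -> stable (pairdet v).
Proof.
move=> pv; have [af cf nf] := framedet_stable pv; split.
- move=> [j b] z w; rewrite /diff /pairdet !slice_spike.
  by case: b => /=; rewrite !af /diff; ring.
- have sc b z : slice b (conjv z) = conjv (slice b z) :> {ffun J -> C}.
    by apply/ffunP => j; rewrite !ffunE.
  by move=> z; rewrite /pairdet !sc !cf rmorphM.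
by move=> z z0; rewrite mulf_neq0 // nf // => j; rewrite ffunE.
Qed.

Lemma slice_cvec b (x : {ffun J * bool -> R}) : slice b (cvec x) = cvec (slice b x).
Proof. by apply/ffunP => j; rewrite !ffunE. Qed.

Lemma rtrace_pairdet v x : parseval v -> rtrace (pairdet v) x =
  rtrace (framedet v) (slice false x) * rtrace (framedet v) (slice true x).
Proof.
move=> pv; have st := framedet_stable pv.
by rewrite {1}/rtrace /pairdet !slice_cvec !(stable_real _ st) /= mulr0 subr0.
Qed.

Lemma sqnormcE (w : 'cV[C]_n) : (w^t* *m w) 0 0 = (sqnormc w)%:C.
Proof.
rewrite mxE /sqnormc rmorph_sum; apply: eq_bigr => k _.
by rewrite !mxE mulrC [X in _ * X = _]/= sqmodE.
Qed.

Definition constv (t : R) : {ffun J -> R} := [ffun=> t].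

Lemma frame_op_constv v t : parseval v -> frame_op v (cvec (constv t)) = t%:C%:M.
Proof.
move=> pv; rewrite -scalemx1 -pv scaler_sumr; apply: eq_bigr => j _.
by rewrite !ffunE.
Qed.

Lemma framedet_constv v t : parseval v -> rtrace (framedet v) (constv t) = t ^+ n.
Proof.
by move=> pv; rewrite /rtrace /framedet frame_op_constv // det_scalar -rmorphXn.
Qed.

Lemma framedet_constv_diff v t j : parseval v -> t != 0 ->
  rtrace (framedet v) (constv t + spike j 1) = t ^+ n * (1 + sqnormc (v j) / t).
Proof.
move=> pv t0; rewrite /rtrace /framedet cvecD cvec_spike frame_opD scale1r.
rewrite frame_op_constv // det_scalar_rank1; last first.
  by rewrite eq_complex /= negb_and t0.
rewrite sqnormcE -[X in _ * (X + _)]/(1%:C) -fmorphV -!rmorphM -rmorphD.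
by rewrite -rmorphXn -rmorphM.
Qed.

Lemma pairdet_above v t : parseval v -> 0 < t ->
  above (rtrace (pairdet v)) [ffun=> t].
Proof.
move=> pv t0 s s0; rewrite rtrace_pairdet //.
have sE b : slice b ([ffun=> t] + s) = constv t + slice b s.
  by apply/ffunP => j; rewrite !ffunE.
rewrite !sE; apply: mulr_gt0; apply: framedet_real_gt0 => //;
  by [move=> j; rewrite ffunE | rewrite framedet_constv // exprn_gt0].
Qed.

(** At a multiple of the identity the rank one update of the determinant is explicit. *)
Lemma pairdet_barrier v t k : parseval v -> 0 < t ->
  barrier k (rtrace (pairdet v)) [ffun=> t] = sqnormc (v k.1) / t.
Proof.
move=> pv t0; have tn : t ^+ n != 0 by rewrite expf_neq0 // gt_eqF.
have sE b : slice b [ffun=> t] = constv t by apply/ffunP => j; rewrite !ffunE.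
case: k => j b; rewrite /barrier /diff !rtrace_pairdet // !slice_spike !sE.
by case: b => /=; rewrite framedet_constv_diff ?gt_eqF // !framedet_constv //; field;
  rewrite tn gt_eqF.
Qed.

(** The barrier argument starts at the constant weight r, where every barrier is at most
    r / 2; it allows the shift d = 1 / (1 - r), and r + d <= 1 + 3 r. In each part the
    frame operator, counted twice, then stays below 1 + 3 r. *)
Lemma parseval_choice v r : parseval v -> 0 < r -> r <= 1 / 2 ->
  (forall j, sqnormc (v j) <= r ^+ 2 / 2) ->
  exists sg : J -> bool, forall b t, 0 <= t ->
    framedet v (cvec [ffun j => 1 + 3 * r + t - (if sg j == b then 2 else 0)]) != 0.
Proof.
move=> pv r0 r2 hv; have sp := pairdet_stable pv.
pose d := (1 - r)^-1.
have r1 : 0 < 1 - r by lra.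
have d1 : 1 <= d by rewrite /d invf_ge1 //; lra.
have d2 : d <= 1 + 2 * r.
  rewrite /d -[_^-1]mul1r ler_pdivrMr //; nra.
have hb k : barrier k (rtrace (pairdet v)) [ffun=> r] <= r / 2.
  by rewrite pairdet_barrier // ler_pdivrMr // (le_trans (hv _)) //; lra.
have he : r / 2 + r / 2 <= 1 - d^-1 by rewrite /d invrK; lra.
have d2' : d <= 2 by lra.
have := above_pairops (fun s => stable_pairops s sp) (enum_uniq J) d1 d2' he
  (pairdet_above pv r0) hb.
move/(above_choice (fun s => stable_pairops s sp) (enum_uniq J)) => [sg hsg].
exists sg => b t t0.
have big b' : slice b' ([ffun=> r] + \sum_(j <- enum J)
      (spike (j, false) d + spike (j, true) d) - \sum_(j <- enum J) spike (j, sg j) 2)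
    = [ffun j => r + d - (if sg j == b' then 2 else 0)].
  apply/ffunP => j; rewrite !ffunE !sum_ffunE !big_enum /=; congr (_ + _ - _).
    rewrite (bigD1 j) //= big1 => [|i ij].
      by rewrite !ffunE !xpair_eqE eqxx /=; case: b'; rewrite /= ?addr0 ?add0r.
    by rewrite !ffunE !xpair_eqE eq_sym (negbTE ij) addr0.
  rewrite (bigD1 j) //= big1 => [|i ij].
    by rewrite !ffunE xpair_eqE eqxx addr0 /= eq_sym.
  by rewrite !ffunE xpair_eqE eq_sym (negbTE ij).
pose q : {ffun J * bool -> R} := [ffun k => 1 + 3 * r - (r + d) + if k.2 == b then t else 0].
have q0 : nonneg q.
  by move=> k; rewrite !ffunE addr_ge0 //; [lra | case: ifP].
have := hsg q q0; rewrite rtrace_pairdet // => /lt0r_neq0; rewrite mulf_eq0 negb_or.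
move=> /andP[nf nt]; rewrite stable_real; last exact: framedet_stable.
have sq b' : slice b' ([ffun=> r] + \sum_(j <- enum J)
      (spike (j, false) d + spike (j, true) d) - \sum_(j <- enum J) spike (j, sg j) 2 + q) =
   [ffun j => 1 + 3 * r + (if b' == b then t else 0) - (if sg j == b' then 2 else 0)].
  apply/ffunP => j; have := congr1 (fun f : {ffun J -> R} => f j) (big b').
  rewrite !ffunE /= => ->; case: ifP => _; case: ifP => _; ring.
rewrite eq_complex /= negb_and; apply/orP; left.
by case: b @q q0 sq nf nt => q q0 sq; rewrite !sq /=.
Qed.

End Halving.

Section Spectral.
Local Open Scope complex_scope.
Local Open Scope sesquilinear_scope.
Variables (R : rcfType) (n : nat).
Local Notation C := R[i].
Local Notation Re := (@complex.Re R).
Local Notation Im := (@complex.Im R).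
Implicit Types (u : 'rV[C]_n) (H : 'M[C]_n).

Lemma diag_formE u (s : 'rV[C]_n) :
  (u *m diag_mx s *m u^t*) 0 0 = \sum_k s 0 k * (sqmod (u 0 k))%:C.
Proof.
rewrite mxE; apply: eq_bigr => k _; rewrite mul_mx_diag !mxE -sqmodE.
by rewrite mulrAC mulrC.
Qed.

Lemma spectral_form H : H^t* = H ->
  exists2 P : 'M[C]_n, P \is unitarymx &
  exists s : 'rV[R]_n, H = P^t* *m diag_mx (map_mx (real_complex R) s) *m P.
Proof.
move=> HH; have hH : H \is hermsymmx.
  by apply/is_hermitianmxP; rewrite expr0 scale1r HH.
have /orthomx_spectralP E := hermitian_normalmx hH.
have /mxOverP sr := hermitian_spectral_diag_real hH.
move: E sr (spectral_unitarymx H); move: (spectralmx H) (spectral_diag H).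
move=> P d E sr uP; exists P => //; exists (map_mx Re d).
rewrite -(invmx_unitary uP) {1}E.
rewrite {1}(_ : d = map_mx (real_complex R) (map_mx Re d)); first by [].
apply/rowP => k; rewrite !mxE; have := sr 0 k; case: (d 0 k) => a b /=.
by rewrite realE !lecE /= => /orP[/andP[/eqP-> _]|/andP[/eqP<- _]].
Qed.

Lemma unitary_trl (P : 'M[C]_n) : P \is unitarymx -> P^t* *m P = 1%:M.
Proof. by move=> uP; rewrite -invmx_unitary // mulVmx // unitarymx_unit. Qed.

Lemma adjM m p q (A : 'M[C]_(m, p)) (B : 'M[C]_(p, q)) :
  (A *m B)^t* = B^t* *m A^t*.
Proof. by rewrite trmx_mul map_mxM. Qed.

Lemma spectral_formE (P : 'M[C]_n) (s : 'rV[R]_n) u :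
  Re ((u *m (P^t* *m diag_mx (map_mx (real_complex R) s) *m P) *m u^t*) 0 0) =
  \sum_k s 0 k * sqmod ((u *m P^t*) 0 k).
Proof.
have -> : u *m (P^t* *m diag_mx (map_mx (real_complex R) s) *m P) *m u^t* =
   (u *m P^t*) *m diag_mx (map_mx (real_complex R) s) *m (u *m P^t*)^t*.
  by rewrite adjM trmxCK !mulmxA.
rewrite diag_formE raddf_sum; apply: eq_bigr => k _.
by rewrite mxE /= mulr0 subr0.
Qed.

(** A negative eigenvalue - r would make H + r singular. *)
Lemma hermitian_psd H : H^t* = H ->
  (forall r : R, 0 <= r -> \det (H + r%:C%:M) != 0) ->
  forall u, 0 <= Re ((u *m H *m u^t*) 0 0).
Proof.
move=> /spectral_form[P uP [s E]] hd u; rewrite E spectral_formE.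
apply: sumr_ge0 => k _; apply: mulr_ge0; last exact: sqmod_ge0.
rewrite leNgt; apply/negP => sk.
have /hd/negP[] : 0 <= - s 0 k by rewrite oppr_ge0 ltW.
have -> : H + (- s 0 k)%:C%:M =
  P^t* *m diag_mx (map_mx (real_complex R) (s + const_mx (- s 0 k))) *m P.
  rewrite map_mxD raddfD /= mulmxDr mulmxDl -E map_const_mx; congr (_ + _).
  rewrite diag_const_mx -mulmxA mul_scalar_mx -scalemxAr unitary_trl //.
  by rewrite scalemx1.
rewrite !det_mulmx det_diag (bigD1 k) //= !mxE addrN !mul0r mulr0 mul0r.
by [].
Qed.

(** The square root of a positive definite form, used to turn a frame into a Parseval
    frame; the spectral lower bound a controls the norms of the new vectors. *)
Lemma form_sqrt H a : 0 < a -> H^t* = H ->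
  (forall u, a * sqnorm u <= Re ((u *m H *m u^t*) 0 0)) ->
  exists W V : 'M[C]_n, [/\ W *m W^t* = H, V *m W = 1%:M, W *m V = 1%:M &
    forall w : 'cV[C]_n, a * sqnormc (V *m w) <= sqnormc w].
Proof.
move=> a0 /spectral_form[P uP [s E]] ha.
have sa k : a <= s 0 k.
  have := ha (delta_mx 0 k *m P); rewrite E spectral_formE.
  have PP : P *m P^t* = 1%:M by apply/unitarymxP.
  rewrite -[sqnorm _]/(Re (sqnorm _)%:C) -sqnormE adjM.
  have -> : delta_mx 0 k *m P *m (P^t* *m (delta_mx 0 k)^t*) =
     delta_mx 0 k *m (delta_mx 0 k)^t* :> 'M[C]_1.
    by rewrite !mulmxA -[_ *m P *m _]mulmxA PP mulmx1.
  rewrite -mulmxA PP mulmx1.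
  have d0 l : l != k -> (delta_mx 0 k : 'rV[C]_n) 0 l = 0.
    by move=> lk; rewrite mxE eqxx (negbTE lk).
  have d1 : (delta_mx 0 k : 'rV[C]_n) 0 k = 1 by rewrite mxE !eqxx.
  rewrite sqnormE /= /sqnorm (bigD1 k) //= big1 => [|l lk]; last first.
    by rewrite d0 // /sqmod /= expr0n addr0.
  rewrite [X in _ <= X](bigD1 k) //= [X in _ <= _ + X]big1 => [|l lk]; last first.
    by rewrite d0 // /sqmod /= expr0n addr0 mulr0.
  by rewrite d1 /sqmod /= expr0n expr1n !addr0 !mulr1.
have s0 k : 0 < s 0 k by apply: lt_le_trans (sa k).
pose q : 'rV[R]_n := map_mx Num.sqrt s.
pose qi : 'rV[R]_n := map_mx (fun x => (Num.sqrt x)^-1) s.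
pose D (r : 'rV[R]_n) : 'M[C]_n := diag_mx (map_mx (real_complex R) r).
have DD r r' : D r *m D r' = D (\row_k (r 0 k * r' 0 k)).
  rewrite /D mulmx_diag; congr diag_mx; apply/rowP => k.
  by rewrite !mxE rmorphM.
have Dt r : (D r)^t* = D r.
  rewrite /D tr_diag_mx map_diag_mx; congr diag_mx; apply/rowP => k.
  by rewrite !mxE; exact: conjc_real.
have D1 (r r' : 'rV[R]_n) : (forall k, r 0 k * r' 0 k = 1) -> D r *m D r' = 1%:M.
  move=> rr; rewrite DD /D -(diag_const_mx); congr diag_mx; apply/rowP => k.
  by rewrite !mxE rr.
have Dw r (w : 'cV[C]_n) k : (D r *m w) k 0 = (r 0 k)%:C * w k 0.
  by rewrite /D mul_diag_mx !mxE.
rewrite -/(D s) in E; clearbody D.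
have qq k : q 0 k * qi 0 k = 1 by rewrite !mxE divff // gt_eqF // sqrtr_gt0.
exists (P^t* *m D q), (D qi *m P); split.
- rewrite adjM trmxCK Dt mulmxA -[_ *m D q *m D q]mulmxA DD E.
  rewrite (_ : \row_k (q 0 k * q 0 k) = s); first by [].
  by apply/rowP => k; rewrite !mxE -expr2 sqr_sqrtr // ltW.
- have PP : P *m P^t* = 1%:M by apply/unitarymxP.
  rewrite mulmxA -[_ *m P *m _]mulmxA PP mulmx1 D1 // => k.
  by rewrite mulrC.
- by rewrite mulmxA -[_ *m D q *m _]mulmxA D1 // mulmx1 unitary_trl.
move=> w; rewrite -mulmxA.
have -> : sqnormc w = sqnormc (P *m w).
  suff : (sqnormc w)%:C = (sqnormc (P *m w))%:C by case.
  by rewrite -!sqnormcE adjM mulmxA -[_ *m P]mulmxA unitary_trl // mulmx1.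
rewrite /sqnormc mulr_sumr; apply: ler_sum => k _.
rewrite Dw [qi 0 k]mxE sqmodM mulrA ler_piMl ?sqmod_ge0 //.
rewrite {1}/sqmod /= expr0n addr0 exprVn sqr_sqrtr; last exact: ltW.
by rewrite ler_pdivrMr // mul1r.
Qed.

End Spectral.

Section HalvingFrames.
Local Open Scope complex_scope.
Local Open Scope sesquilinear_scope.
Variables (R : rcfType) (n : nat) (T : finType).
Local Notation C := R[i].
Local Notation Re := (@complex.Re R).
Implicit Types (v : T -> 'cV[C]_n) (u : 'rV[C]_n) (X Y : {set T}).

Definition energy v X u : R := \sum_(j in X) sqmod (coef u (v j)).

(** The determinants of [parseval_choice] are those of (1 + 3 r) I - 2 A + t for all
    t >= 0, where A is the frame operator of one part; hence 2 A <= 1 + 3 r. *)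
Lemma parseval_halving v r : parseval v -> 0 < r -> r <= 1 / 2 ->
  (forall j, sqnormc (v j) <= r ^+ 2 / 2) ->
  exists Y, forall u,
    energy v Y u <= (1 + 3 * r) / 2 * sqnorm u /\
    energy v (~: Y) u <= (1 + 3 * r) / 2 * sqnorm u.
Proof.
move=> pv r0 r2 hv; have [sg hsg] := parseval_choice pv r0 r2 hv.
have key b u : \sum_(j | sg j == b) sqmod (coef u (v j)) <= (1 + 3 * r) / 2 * sqnorm u.
  pose x t : {ffun T -> R} := [ffun j => 1 + 3 * r + t - (if sg j == b then 2 else 0)].
  have xE t : frame_op v (cvec (x t)) = frame_op v (cvec (x 0)) + t%:C%:M.
    rewrite -(frame_op_constv t pv) /frame_op -big_split; apply: eq_bigr => j _ /=.
    by rewrite -scalerDl !ffunE -rmorphD /=; congr ((_)%:C *: _); ring.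
  have hH : (frame_op v (cvec (x 0)))^t* = frame_op v (cvec (x 0)).
    rewrite -frame_op_conj; congr frame_op; apply/ffunP => j.
    by rewrite !ffunE /= oppr0.
  have hdet t : 0 <= t -> \det (frame_op v (cvec (x 0)) + t%:C%:M) != 0.
    by move=> t0; rewrite -xE; apply: hsg.
  have := hermitian_psd hH hdet u.
  rewrite frame_opE -(parsevalE u pv) raddf_sum /=.
  have -> : \sum_j Re (cvec (x 0) j * (sqmod (coef u (v j)))%:C) =
     (1 + 3 * r) * \sum_j sqmod (coef u (v j)) -
       2 * \sum_(j | sg j == b) sqmod (coef u (v j)).
    rewrite !mulr_sumr [X in _ - X]big_mkcond -sumrB; apply: eq_bigr => j _.
    by rewrite !ffunE /= mulr0 subr0; case: ifP => _; ring.
  lra.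
exists [set j | sg j == true] => u; split.
  by rewrite /energy (eq_bigl (fun j => sg j == true)) // => j; rewrite inE.
rewrite /energy (eq_bigl (fun j => sg j == false)) // => j.
by rewrite !inE; case: (sg j).
Qed.

Lemma energy_setID v X Y u : Y \subset X ->
  energy v X u = energy v Y u + energy v (X :\: Y) u.
Proof.
by move=> YX; rewrite /energy (big_setID Y) /= (finset.setIidPr YX).
Qed.

(** The square root of the frame operator of X reduces the statement to Parseval frames. *)
Lemma halving v X a r : 0 < a -> 0 < r -> r <= 1 / 2 ->
  (forall j, sqnormc (v j) <= a * r ^+ 2 / 2) ->
  (forall u, a * sqnorm u <= energy v X u) ->
  exists2 Y : {set T}, Y \subset X & forall u,
    energy v Y u <= (1 + 3 * r) / 2 * energy v X u /\
    energy v (X :\: Y) u <= (1 + 3 * r) / 2 * energy v X u.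
Proof.
move=> a0 r0 r2 hv ha.
pose H : 'M[C]_n := \sum_(j in X) v j *m (v j)^t*.
pose x : {ffun T -> R} := [ffun j => (j \in X)%:R].
have HE : H = frame_op v (cvec x).
  rewrite /H /frame_op big_mkcond; apply: eq_bigr => j _; rewrite !ffunE.
  by case: ifP => _; rewrite ?scale1r ?scale0r.
have hH : H^t* = H.
  rewrite HE -frame_op_conj; congr frame_op; apply/ffunP => j.
  by rewrite !ffunE /= oppr0.
have HX u : Re ((u *m H *m u^t*) 0 0) = energy v X u.
  rewrite HE frame_opE raddf_sum /energy [RHS]big_mkcond; apply: eq_bigr => j _ /=.
  by rewrite !ffunE; case: ifP => _; rewrite ?mul1r ?mul0r.
have [|W [V [WW VW WV hV]]] := form_sqrt a0 hH _; first by move=> u; rewrite HX.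
pose w j : 'cV[C]_n := if j \in X then V *m v j else 0.
have pw : parseval w.
  rewrite /parseval; have -> : \sum_j w j *m (w j)^t* = V *m H *m V^t*.
    rewrite /H mulmx_sumr mulmx_suml [RHS]big_mkcond; apply: eq_bigr => j _.
    rewrite /w; case: ifP => _; last by rewrite mul0mx.
    by rewrite adjM !mulmxA.
  by rewrite -WW mulmxA VW mul1mx -adjM VW trmx1 map_mx1.
have hw j : sqnormc (w j) <= r ^+ 2 / 2.
  rewrite /w; case: ifP => _; last first.
    rewrite /sqnormc big1 => [|k _]; first by rewrite mulr_ge0 ?sqr_ge0 ?invr_ge0.
    by rewrite mxE /sqmod /= expr0n addr0.
  by rewrite -(ler_pM2l a0) mulrA; apply: le_trans (hV _) (hv j).
have [Y hY] := parseval_halving pw r0 r2 hw.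
have eE Z u : energy w Z (u *m W) = energy v (X :&: Z) u.
  rewrite /energy [LHS]big_mkcond [RHS]big_mkcond; apply: eq_bigr => j _.
  rewrite inE /coef /w; case: (j \in Z); rewrite ?andbF // andbT.
  case: ifP => _; last by rewrite mulmx0 mxE /sqmod /= expr0n addr0.
  by rewrite -mulmxA [W *m _]mulmxA WV mul1mx.
have nE u : sqnorm (u *m W) = energy v X u.
  rewrite -HX -[LHS]/(Re (sqnorm _)%:C) -sqnormE adjM -WW.
  by rewrite !mulmxA.
exists (X :&: Y) => [|u]; first exact: subsetIl.
have [] := hY (u *m W); rewrite !eE nE => h1 h2; split=> //.
by rewrite finset.setDE finset.setCI finset.setIUr finset.setICr finset.set0U.
Qed.

End HalvingFrames.

(** * Selecting a small subframe *)

Section Selection.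
Local Open Scope complex_scope.
Local Open Scope sesquilinear_scope.
Variables (R : rcfType) (n : nat) (T : finType).
Local Notation C := R[i].
Implicit Types (v : T -> 'cV[C]_n) (u : 'rV[C]_n) (X Y : {set T}).

(** Repeated halving, with r = sqrt (2 de / a) and frame bounds a and b. Every step
    multiplies b / a by (1 + 3 r) / (1 - 3 r) while r grows by a factor of
    at least 7/5, so that the accumulated losses form a geometric series; this is what
    the invariant b (1 - 15 r) <= a expresses. The process stops as soon as
    r > 1/100, that is, when a is comparable to de. *)
Lemma halving_iter v X a b r de : (0 < n)%N ->
  0 < a -> 0 < r -> r <= 1 / 50 -> a * r ^+ 2 = 2 * de -> b * (1 - 15 * r) <= a ->
  (forall j, sqnormc (v j) <= de) ->
  (forall u, a * sqnorm u <= energy v X u <= b * sqnorm u) ->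
  exists Y : {set T}, forall u,
    de * sqnorm u <= energy v Y u <= (300 * 100) * de * sqnorm u.
Proof.
move=> n0; have [k] := ubnP #|X|; elim: k X a b r => // k IH X a b r Xk.
move=> a0 r0 r50 ar bra hv hX.
have sn0 u : 0 <= sqnorm u by apply: sumr_ge0 => l _; apply: sqmod_ge0.
pose u1 : 'rV[C]_n := const_mx 1.
have u0 : 0 < sqnorm u1.
  rewrite lt_def sn0 andbT sqnorm_eq0; apply/eqP => /rowP/(_ (Ordinal n0)).
  by rewrite !mxE => /eqP; rewrite oner_eq0.
have [r100|r100] := ltP (1 / 100) r.
  exists X => w; have /andP[h1 h2] := hX w.
  have r2 : r ^+ 2 <= 1 / (50 * 50) by nra.
  have r3 : 1 / (100 * 100) <= r ^+ 2 by nra.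
  have da : de <= a by nra.
  have ad : a <= (200 * 100) * de by nra.
  have ba : b <= (300 * 100) * de by nra.
  by rewrite (le_trans _ h1) ?ler_wpM2r // (le_trans h2) ?ler_wpM2r.
have hv' j : sqnormc (v j) <= a * r ^+ 2 / 2 by rewrite ar mulrAC divff ?mul1r ?pnatr_eq0.
have [|Y YX hY] := halving a0 r0 _ hv' (fun u => proj1 (andP (hX u))); first by lra.
pose a' := a * (1 - 3 * r) / 2; pose b' := (1 + 3 * r) / 2 * b.
pose r' := Num.sqrt (2 * de / a').
have a'0 : 0 < a' by rewrite /a' divr_gt0 // mulr_gt0 //; lra.
have a'lb : a * (97 / 200) <= a' by rewrite /a'; nra.
have a'ub : a' <= a / 2 by rewrite /a'; nra.
have de0 : 0 < de by have := mulr_gt0 a0 (exprn_gt0 2 r0); rewrite ar; lra.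
have r'2 : a' * r' ^+ 2 = 2 * de.
  rewrite sqr_sqrtr; last by rewrite divr_ge0 ?(ltW a'0) //; lra.
  by rewrite mulrC divfK // gt_eqF.
have r'0 : 0 < r' by rewrite sqrtr_gt0 divr_gt0 //; lra.
have r'lb : 7 / 5 * r <= r'.
  rewrite leNgt; apply/negP => h.
  have : r' ^+ 2 < (7 / 5 * r) ^+ 2 by rewrite ltr_pXn2r // nnegrE; lra.
  nra.
have r'ub : r' <= 3 / 2 * r.
  rewrite leNgt; apply/negP => h.
  have : (3 / 2 * r) ^+ 2 < r' ^+ 2 by rewrite ltr_pXn2r // nnegrE; lra.
  nra.
have hY' u : a' * sqnorm u <= energy v Y u <= b' * sqnorm u.
  have [h1 h2] := hY u; have /andP[h3 h4] := hX u.
  have := energy_setID v u YX => h5; apply/andP; split.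
    rewrite /a'; suff : (1 - 3 * r) / 2 * (a * sqnorm u) <= energy v Y u by lra.
    apply: le_trans (_ : (1 - 3 * r) / 2 * energy v X u <= _); last by lra.
    by rewrite ler_wpM2l // divr_ge0 //; lra.
  apply: le_trans h1 _; rewrite /b' -[_ * b * _]mulrA ler_wpM2l // divr_ge0 //; lra.
apply: (IH Y a' b' r') => //; [|lra|].
  rewrite -ltnS; apply: leq_trans Xk; rewrite ltnS; apply: proper_card.
  rewrite properE YX; apply/negP => XY.
  have {XY}XY : X = Y by apply/eqP; rewrite finset.eqEsubset XY YX.
  have [h1 _] := hY u1; have /andP[h3 _] := hX u1.
  have := mulr_gt0 a0 u0; rewrite -XY in h1; nra.
rewrite /a' /b'.
have b0 : 0 <= b.
  rewrite -(pmulr_lge0 _ u0); have /andP[h1 h2] := hX u1.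
  by apply: le_trans h2; apply: le_trans h1; apply: ltW; apply: mulr_gt0.
have : (1 + 3 * r) / 2 * b * (1 - 15 * r') <= (1 + 3 * r) / 2 * b * (1 - 21 * r).
  by rewrite ler_wpM2l ?mulr_ge0 ?divr_ge0 //; lra.
have : (1 - 3 * r) / 2 * (b * (1 - 15 * r)) <= (1 - 3 * r) / 2 * a.
  by rewrite ler_wpM2l ?divr_ge0 //; lra.
have : 0 <= b * r ^+ 2 by rewrite mulr_ge0 // sqr_ge0.
lra.
Qed.

(** Halving starts with the bounds a = b = 1 when de is small; otherwise the whole frame
    does, because 1 is then at most a constant times de. *)
Theorem frame_selection v de : (0 < n)%N -> 0 < de -> de <= 1 -> parseval v ->
  (forall j, sqnormc (v j) <= de) ->
  exists Y : {set T}, forall u,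
    de * sqnorm u <= energy v Y u <= (300 * 100) * de * sqnorm u.
Proof.
move=> n0 de0 de1 pv hv.
have sn0 u : 0 <= sqnorm u by apply: sumr_ge0 => l _; apply: sqmod_ge0.
have hT u : energy v finset.setT u = sqnorm u.
  by rewrite -(parsevalE u pv) /energy; apply: eq_bigl => j; rewrite inE.
have [r1|r1] := leP (Num.sqrt (2 * de)) (1 / 50).
  apply: (@halving_iter v finset.setT 1 1 (Num.sqrt (2 * de))) => //.
  - by rewrite sqrtr_gt0; lra.
  - by rewrite mul1r sqr_sqrtr //; lra.
  - by move=> u; rewrite hT mul1r lexx.
have d1 : 1 <= (300 * 100) * de.
  have : (1 / 50) ^+ 2 < Num.sqrt (2 * de) ^+ 2.
    by rewrite ltr_pXn2r // nnegrE ?sqrtr_ge0 //; lra.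
  by rewrite sqr_sqrtr; [nra | lra].
by exists finset.setT => u; rewrite hT ler_piMl // -{1}[sqnorm u]mul1r ler_wpM2r.
Qed.

End Selection.

(** * Submatrices of the Fourier matrix *)

Section Fourier.
Local Open Scope complex_scope.
Local Open Scope sesquilinear_scope.
Variable R : realType.
Local Notation C := R[i].

Definition cis (x : R) : C := cos x +i* sin x.

Lemma cisD x y : cis (x + y) = cis x * cis y.
Proof. by rewrite /cis cosD sinD; simpc; congr (_ +i* _); ring. Qed.

Lemma cis0 : cis 0 = 1.
Proof. by rewrite /cis cos0 sin0. Qed.

Lemma cisN x : cis (- x) = conjc (cis x).
Proof. by rewrite /cis cosN sinN. Qed.

Lemma cisMn x k : cis (x *+ k) = cis x ^+ k.
Proof.
by elim: k => [|k IH]; rewrite ?mulr0n ?cis0 // mulrS cisD IH exprS.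
Qed.

Lemma sqmod_cis x : sqmod (cis x) = 1.
Proof. by rewrite /sqmod /= cos2Dsin2. Qed.

Lemma cos_lt1 (x : R) : 0 < `|x| -> `|x| < 2 * pi -> cos x < 1.
Proof.
move=> x0 x1; rewrite -cos_norm.
have -> : `|x| = (`|x| / 2) *+ 2 by rewrite -mulr_natr; field.
rewrite cos_mulr2n cos2sin2.
have : 0 < sin (`|x| / 2) by apply: sin_gt0_pi; apply/andP; split; lra.
by move=> /(exprn_gt0 2); rewrite -mulr_natr; lra.
Qed.

Lemma sum_cis (N : nat) (h : R) (j l : 'I_N) :
  \sum_(k < N) cis (2 * pi * (k%:R - h) * (j%:R - l%:R) / N%:R) =
  if j == l then N%:R else 0.
Proof.
have N0 : (N%:R : R) != 0 by rewrite pnatr_eq0 -lt0n (leq_ltn_trans _ (ltn_ord j)).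
case: eqP => [->|jl].
  under eq_bigr do rewrite subrr mulr0 mul0r cis0.
  by rewrite sumr_const card_ord.
set t := 2 * pi * (j%:R - l%:R) / N%:R : R.
have E k : cis (2 * pi * (k%:R - h) * (j%:R - l%:R) / N%:R) =
    cis (- (h * t)) * cis t ^+ k.
  by rewrite -cisMn -cisD -mulr_natr; congr cis; rewrite /t; field.
rewrite (eq_bigr (fun k : 'I_N => cis (- (h * t)) * cis t ^+ k)) => [|k _]; last exact: E.
rewrite -mulr_sumr; set S := \sum_(_ < _) _.
have t1 : cis t != 1.
  rewrite eq_complex /= negb_and lt_eqF //; apply: cos_lt1.
    have jl0 : j%:R - l%:R != 0 :> R.
      by rewrite subr_eq0 eqr_nat; apply/eqP => e; apply: jl; apply: ord_inj.
    have p0 : 2 * pi != 0 :> R by apply: lt0r_neq0; rewrite mulr_gt0 ?pi_gt0.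
    by rewrite normr_gt0 /t mulf_neq0 ?invr_neq0 // mulf_neq0.
  have jlN : `|j%:R - l%:R : R| < N%:R.
    have := ltn_ord j; have := ltn_ord l; rewrite -!(ltr_nat R) => h1 h2.
    have h3 := ler0n R j; have h4 := ler0n R l.
    by rewrite ltr_norml; apply/andP; split; lra.
  rewrite /t normrM normfV normrM normr_nat ger0_norm ?mulr_ge0 ?pi_ge0 //.
  rewrite ltr_pdivrMr ?ltr_pM2l ?mulr_gt0 ?pi_gt0 // lt_def N0 ler0n.
  by [].
have : (cis t - 1) * S = 0.
  rewrite -subrX1 -cisMn.
  have c1 m : cis ((2 * pi) *+ m) = 1.
    by rewrite cisMn /cis mulr_natl cos2pi sin2pi expr1n.
  have -> : t *+ N = (2 * pi) *+ j - (2 * pi) *+ l.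
    by rewrite -(mulr_natr t N) -(mulr_natr (2 * pi) j) -(mulr_natr (2 * pi) l) /t; field.
  by rewrite cisD cisN !c1 conjc1 mulr1 subrr.
move/eqP; rewrite mulf_eq0 subr_eq0 (negbTE t1) => /eqP->.
by rewrite mulr0.
Qed.

Lemma sqmodN (c : C) : sqmod (- c) = sqmod c.
Proof. by case: c => a b; rewrite /sqmod /= !sqrrN. Qed.

(** The rows of the Fourier matrix of order N, restricted to the columns in D and
    normalized, form a Parseval frame whose vectors all have square norm #|D| / N. The
    shift h makes room for frequencies that are symmetric about 0. *)
Theorem fourier_selection (N : nat) (h : R) (D : {set 'I_N}) : D != finset.set0 ->
  exists X : {set 'I_N}, forall f : 'I_N -> C,
    #|D|%:R * (\sum_(j in D) sqmod (f j)) <=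
    \sum_(k in X) sqmod (\sum_(j in D) f j * cis (- (2 * pi * (k%:R - h) / N%:R * j%:R)))
    <= 300 * 100 * #|D|%:R * \sum_(j in D) sqmod (f j).
Proof.
move=> /finset.set0Pn[j0 Dj0].
have N0 : (0 < N)%N := leq_ltn_trans (leq0n _) (ltn_ord j0).
have NR : (0 : R) < N%:R by rewrite ltr0n.
have D0 : (0 < #|D|)%N by apply/card_gt0P; exists j0.
pose c : R := Num.sqrt (N%:R^-1).
pose g (i : 'I_#|D|) : 'I_N := enum_val i.
have gI : injective g := enum_val_inj.
pose v (k : 'I_N) : 'cV[C]_#|D| :=
  \col_i (c%:C * cis (- (2 * pi * (k%:R - h) / N%:R * (g i)%:R))).
have cc : c * c = N%:R^-1 by rewrite -expr2 sqr_sqrtr // invr_ge0 ltW.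
have pv : parseval v.
  apply/matrixP => i l; rewrite summxE.
  transitivity (\sum_(k < N) (c * c)%:C *
      cis (2 * pi * (k%:R - h) * ((g l)%:R - (g i)%:R) / N%:R)).
    apply: eq_bigr => k _; rewrite !mxE big_ord1 !mxE.
    set x := - _; set y := - (_ * (g l)%:R).
    have -> : Num.conj (c%:C * cis y) = c%:C * cis (- y).
      rewrite (cisN y) -[X in _ = X * _](conjc_real c).
      exact: (rmorphM (@conjc R) (c%:C) (cis y)).
    rewrite mulrACA -rmorphM -cisD; congr (_ * cis _).
    by rewrite /x /y; field; rewrite gt_eqF.
  rewrite -mulr_sumr sum_cis mxE (inj_eq gI) [l == i]eq_sym cc.
  case: eqP => _; last by rewrite mulr0.
  by rewrite fmorphV rmorph_nat mulVf // pnatr_eq0 -lt0n.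
have hv k : sqnormc (v k) = #|D|%:R / N%:R.
  rewrite /sqnormc (eq_bigr (fun=> N%:R^-1)) => [|i _].
    by rewrite sumr_const card_ord -[LHS]mulr_natl.
  by rewrite mxE sqmodM sqmod_cis mulr1 /sqmod /= expr0n addr0 expr2.
have de1 : #|D|%:R / N%:R <= 1 :> R.
  by rewrite ler_pdivrMr // mul1r ler_nat -[X in (_ <= X)%N](card_ord N) max_card.
have de0 : 0 < #|D|%:R / N%:R :> R by rewrite divr_gt0 // ltr0n.
have [|X hX] := frame_selection D0 de0 de1 pv; first by move=> k; rewrite hv.
exists X => f; pose u : 'rV[C]_#|D| := \row_i f (g i).
have uE : sqnorm u = \sum_(j in D) sqmod (f j).
  rewrite /sqnorm (big_enum_val (fun j => sqmod (f j))) /=.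
  by apply: eq_bigr => i _; rewrite mxE.
have eE : energy v X u = N%:R^-1 * \sum_(k in X) sqmod
    (\sum_(j in D) f j * cis (- (2 * pi * (k%:R - h) / N%:R * j%:R))).
  rewrite /energy mulr_sumr; apply: eq_bigr => k _; rewrite /coef mxE.
  rewrite (big_enum_val (fun j => f j * cis (- (2 * pi * (k%:R - h) / N%:R * j%:R)))) /=.
  rewrite -[X in X * _](_ : sqmod c%:C = _); last first.
    by rewrite /sqmod /= expr0n addr0 expr2.
  rewrite -sqmodM mulr_sumr; congr sqmod; apply: eq_bigr => i _.
  by rewrite !mxE mulrCA.
have := hX u; rewrite eE uE => /andP[h1 h2]; apply/andP; split.
  by rewrite -(ler_pM2l (_ : 0 < N%:R^-1)) ?invr_gt0 // mulrA [N%:R^-1 * _]mulrC.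
rewrite -(ler_pM2l (_ : 0 < N%:R^-1)) ?invr_gt0 //; apply: le_trans h2 _.
by rewrite le_eqVlt; apply/orP; left; apply/eqP; field; rewrite gt_eqF.
Qed.

End Fourier.

(** * Fourier transforms of intervals *)

Section IntervalTransform.
Local Open Scope complex_scope.
Variable R : realType.
Local Notation C := R[i].

(** The integral of e^(-ilt) over the interval from a to b, in closed form. *)
Definition ihat (a b l : R) : C :=
  if l == 0 then (b - a)%:C
  else ((sin (l * b) - sin (l * a)) / l) +i* ((cos (l * b) - cos (l * a)) / l).

Lemma ihatD a b c l : ihat a b l + ihat b c l = ihat a c l.
Proof.
rewrite /ihat; case: eqP => [_|/eqP l0].
  by rewrite -rmorphD; congr (_%:C); ring.
by simpc; congr (_ +i* _); field.
Qed.

Lemma ihat_shift a h l : ihat a (a + h) l = cis (- (l * a)) * ihat 0 h l.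
Proof.
rewrite /ihat; case: eqP => [->|/eqP l0].
  by rewrite mul0r oppr0 cis0 mul1r; congr (_%:C); ring.
rewrite /cis !mulr0 cos0 sin0 cosN sinN mulrDr sinD cosD.
by simpc; congr (_ +i* _); field.
Qed.

Lemma ihat_decay a b l : sqmod (ihat a b l) * l ^+ 2 <= 8.
Proof.
rewrite /ihat; case: eqP => [->|/eqP l0]; first by rewrite expr0n mulr0.
rewrite /sqmod /=.
have -> : (((sin (l * b) - sin (l * a)) / l) ^+ 2 +
   ((cos (l * b) - cos (l * a)) / l) ^+ 2) * l ^+ 2 =
   (sin (l * b) - sin (l * a)) ^+ 2 + (cos (l * b) - cos (l * a)) ^+ 2 by field.
have := cos2Dsin2 (l * a); have := cos2Dsin2 (l * b).
have := sqr_ge0 (sin (l * b) + sin (l * a)).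
have := sqr_ge0 (cos (l * b) + cos (l * a)).
set s := sin _; set t := sin _; set u := cos _; set v := cos _; nra.
Qed.

Lemma cos_ge_cos1 (x : R) : `|x| <= 1 -> cos 1 <= cos x.
Proof.
move=> x1; have p2 := pi_ge2 R.
have h1 : 1 \in `[0, pi : R] by rewrite in_itv /=; lra.
have h2 : `|x| \in `[0, pi : R] by rewrite in_itv /= normr_ge0 /=; lra.
by rewrite -(cos_norm x) leNgt (ltr_cos h1 h2) -leNgt.
Qed.

Lemma sin_mvt (y : R) : 0 <= y -> exists2 c, 0 <= c <= y & sin y = cos c * y.
Proof.
move=> y0; have [|c] := @MVT_segment R sin cos 0 y y0 (fun x _ => is_derive_sin x).
  exact/continuous_subspaceT/continuous_sin.
by rewrite in_itv /= sin0 !subr0 => cy e; exists c.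
Qed.

Lemma sin_le_id (y : R) : 0 <= y -> sin y <= y.
Proof.
by move=> y0; have [c _ ->] := sin_mvt y0; rewrite ler_piMl // cos_le1.
Qed.

Lemma sin_ge (y : R) : 0 <= y -> y <= pi / 2 -> cos 1 / 2 * y <= sin y.
Proof.
move=> y0 yp; have c1 := cos1_gt0 R.
have [y1|y1] := leP y 1.
  have [c /andP[c0 cy] ->] := sin_mvt y0; rewrite ler_wpM2r //.
  apply: le_trans (_ : cos 1 <= _); first lra.
  by apply: cos_ge_cos1; rewrite ger0_norm // (le_trans cy).
have y2 : y <= 2 by apply: le_trans yp _; exact/ltW/pihalf_lt2.
have [c /andP[c0 cy] e] := sin_mvt (ler01 : (0 : R) <= 1).
have c2 : cos 1 <= sin (1 : R).
  by rewrite e mulr1; apply: cos_ge_cos1; rewrite ger0_norm.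
have s1 : sin 1 <= sin y.
  have p1 := pihalf_ge1 R.
  have h1 : 1 \in `[- (pi / 2), pi / 2 : R] by rewrite in_itv /=; lra.
  have h2 : y \in `[- (pi / 2), pi / 2 : R] by rewrite in_itv /=; lra.
  by rewrite leNgt (ltr_sin h2 h1) -leNgt ltW.
nra.
Qed.

Lemma ihat0_sqmod h l : l != 0 ->
  sqmod (ihat 0 h l) = (2 * sin (`|l * h| / 2) / l) ^+ 2.
Proof.
move=> l0; rewrite /ihat (negbTE l0) /sqmod /= !mulr0 sin0 cos0 subr0.
set y := `|l * h| / 2.
have yE : `|l * h| = y *+ 2 by rewrite -[RHS]mulr_natr /y; field.
have E2 : cos (l * h) = 1 - 2 * sin y ^+ 2.
  rewrite -cos_norm yE cos_mulr2n cos2sin2 -[(1 - _) *+ 2]mulr_natl; ring.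
have E1 : sin (l * h) ^+ 2 = 1 - (1 - 2 * sin y ^+ 2) ^+ 2 by rewrite sin2cos2 E2.
by rewrite !exprMn E1 E2; field.
Qed.

Lemma ihat0_le h l : 0 <= h -> sqmod (ihat 0 h l) <= h ^+ 2.
Proof.
move=> h0; have [->|l0] := eqVneq l 0.
  by rewrite /ihat eqxx /sqmod /= subr0 expr0n addr0.
rewrite ihat0_sqmod // exprMn exprVn ler_pdivrMr; last first.
  by rewrite lt_def sqr_ge0 sqrf_eq0 l0.
have y0 : 0 <= `|l * h| / 2 by rewrite divr_ge0.
have := sin_le_id y0; set y := _ / 2 in y0 *; move=> s1.
have s2 : - y <= sin y.
  have [yp|yp] := leP y pi; first by have := @sin_ge0_pi R y; rewrite y0 yp => /(_ isT); lra.
  by have := sin_geN1 y; have := pi_ge2 R; lra.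
have : (2 * sin y) ^+ 2 <= (2 * y) ^+ 2 by nra.
suff -> : (2 * y) ^+ 2 = h ^+ 2 * l ^+ 2 by [].
by rewrite /y mulrC divfK // real_normK ?num_real // exprMn mulrC.
Qed.

(** Up to the frequency pi / h the transform of an interval of length h stays
    comparable to h, as sin y is comparable to y up to pi / 2. *)
Lemma ihat0_ge h l : 0 <= h -> `|l| * h <= pi ->
  (cos 1 / 2) ^+ 2 * h ^+ 2 <= sqmod (ihat 0 h l).
Proof.
move=> h0 lh; have c1 := cos1_gt0 R.
have [->|l0] := eqVneq l 0.
  rewrite /ihat eqxx /sqmod /= subr0 expr0n addr0 ler_piMl ?sqr_ge0 //.
  by have := cos_le1 (1 : R); nra.
rewrite ihat0_sqmod // [X in _ <= X]exprMn exprVn ler_pdivlMr; last first.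
  by rewrite lt_def sqr_ge0 sqrf_eq0 l0.
have y0 : 0 <= `|l * h| / 2 by rewrite divr_ge0.
have yp : `|l * h| / 2 <= pi / 2.
  by rewrite ler_pM2r ?invr_gt0 // normrM (ger0_norm h0).
have := sin_ge y0 yp; set y := _ / 2 in y0 yp *; move=> s1.
have : (2 * (cos 1 / 2 * y)) ^+ 2 <= (2 * sin y) ^+ 2.
  rewrite ler_pXn2r ?nnegrE ?mulr_ge0 //; try lra.
  by apply: le_trans s1; rewrite !mulr_ge0 //; lra.
suff -> : (2 * (cos 1 / 2 * y)) ^+ 2 = (cos 1 / 2) ^+ 2 * h ^+ 2 * l ^+ 2 by [].
have e : (2 * y) ^+ 2 = h ^+ 2 * l ^+ 2.
  by rewrite /y mulrC divfK // real_normK ?num_real // exprMn mulrC.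
by rewrite -[RHS]mulrA -e; ring.
Qed.

End IntervalTransform.

(** * Frequencies for one dyadic level *)

Section Level.
Local Open Scope complex_scope.
Variable R : realType.
Local Notation C := R[i].

(** Level k divides the interval from - 2^k to 2^k into cells of length 2^-k. *)
Definition mesh (k : nat) : R := (2 ^+ k)^-1.
Definition ncells (k : nat) : nat := (2 * 4 ^ k)%N.
Definition node (k j : nat) : R := j%:R * mesh k - 2 ^+ k.

Lemma mesh_gt0 k : 0 < mesh k.
Proof. by rewrite invr_gt0 exprn_gt0. Qed.

Lemma ncells_gt0 k : (0 < ncells k)%N.
Proof. by rewrite muln_gt0 expn_gt0. Qed.

Lemma ncells_mesh k : (ncells k)%:R * mesh k = 2 * 2 ^+ k.
Proof.
rewrite /ncells natrM natrX /mesh -mulrA; congr (_ * _).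
have -> : (4 : R) = 2 * 2 by ring.
by rewrite exprMn mulfK // expf_neq0 // pnatr_eq0.
Qed.

Lemma nodeS k j : node k j.+1 = node k j + mesh k.
Proof. by rewrite /node -addn1 natrD; ring. Qed.

(** The frequencies for which the exponentials at the nodes are the rows of a Fourier
    matrix, centred so that they do not exceed pi / mesh in absolute value. *)
Definition freq k (n : nat) : R :=
  2 * pi * (n%:R - (ncells k)%:R / 2) / (ncells k)%:R / mesh k.

Lemma freq_mesh k n : freq k n * mesh k = 2 * pi * (n%:R - (ncells k)%:R / 2) / (ncells k)%:R.
Proof. by rewrite /freq divfK // gt_eqF // mesh_gt0. Qed.

Lemma freq_bound k n : (n < ncells k)%N -> `|freq k n| * mesh k <= pi.
Proof.
move=> nk; have N0 : (0 : R) < (ncells k)%:R by rewrite ltr0n ncells_gt0.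
rewrite -[X in _ * X](ger0_norm (ltW (mesh_gt0 k))) -normrM freq_mesh.
rewrite !normrM normfV !(ger0_norm (ltW N0)) (ger0_norm (pi_ge0 R)) ger0_norm //.
rewrite ler_pdivrMr //.
have : `|n%:R - (ncells k)%:R / 2| <= (ncells k)%:R / 2 :> R.
  move: nk; rewrite -(ltr_nat R) => nk; have := ler0n R n => n0.
  by rewrite ler_norml; apply/andP; split; lra.
by have := pi_ge0 R; nra.
Qed.

Lemma freq_inj k : injective (freq k).
Proof.
move=> n m; rewrite /freq => e.
have N0 : (ncells k)%:R != 0 :> R by rewrite pnatr_eq0 -lt0n ncells_gt0.
have p0 : (2 : R) * pi != 0 by apply: lt0r_neq0; rewrite mulr_gt0 ?pi_gt0.
have /mulIf e1 : (mesh k)^-1 != 0 by rewrite invr_neq0 // gt_eqF // mesh_gt0.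
have /mulIf e2 : ((ncells k)%:R)^-1 != 0 :> R by rewrite invr_neq0.
by move/e1/e2/(mulfI p0)/addIr/eqP: e; rewrite eqr_nat => /eqP.
Qed.

(** Locked, because unification would unfold the numeral to unary notation. *)
Definition upper_const : R := locked (300 * 100).

Lemma upper_const_gt0 : 0 < upper_const.
Proof. by rewrite /upper_const -lock; apply: mulr_gt0; rewrite ltr0n. Qed.

(** At these frequencies the transform of a step function is a discrete Fourier
    transform times the transform of one cell, which is comparable to the mesh. *)
Lemma level_selection k (D : {set 'I_(ncells k)}) : D != finset.set0 ->
  exists X : seq R, [/\ uniq X,
    (forall f : 'I_(ncells k) -> C, \sum_(l <- X) sqmod (\sum_(j in D) f j * cis (- (l * node k j)))
       <= upper_const * #|D|%:R * \sum_(j in D) sqmod (f j)) &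
    forall f : 'I_(ncells k) -> C,
    (cos 1 / 2) ^+ 2 * (mesh k ^+ 2 * #|D|%:R * \sum_(j in D) sqmod (f j)) <=
    \sum_(l <- X) sqmod (\sum_(j in D) f j * ihat (node k j) (node k j.+1) l)
    <= upper_const * (mesh k ^+ 2 * #|D|%:R * \sum_(j in D) sqmod (f j))].
Proof.
move=> D0; have [Y hY] := fourier_selection ((ncells k)%:R / 2 : R) D0.
have N0 : (ncells k)%:R != 0 :> R by rewrite pnatr_eq0 -lt0n ncells_gt0.
exists [seq freq k (val n) | n <- enum Y].
have sumE (F : R -> R) : \sum_(l <- [seq freq k (val n) | n <- enum Y]) F l =
    \sum_(n in Y) F (freq k n) by rewrite big_map big_enum.
have expE (f : 'I_(ncells k) -> C) (n : 'I_(ncells k)) :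
    \sum_(j in D) f j * cis (- (freq k n * node k j)) =
    cis (freq k n * 2 ^+ k) * \sum_(j in D) f j *
      cis (- (2 * pi * (n%:R - (ncells k)%:R / 2) / (ncells k)%:R * j%:R)).
  rewrite mulr_sumr; apply: eq_bigr => j _; rewrite mulrCA -cisD; congr (_ * cis _).
  by rewrite -freq_mesh /node; ring.
have ihatE (f : 'I_(ncells k) -> C) l :
    \sum_(j in D) f j * ihat (node k j) (node k j.+1) l =
    ihat 0 (mesh k) l * \sum_(j in D) f j * cis (- (l * node k j)).
  rewrite mulr_sumr; apply: eq_bigr => j _.
  by rewrite nodeS ihat_shift; ring.
have sE (f : 'I_(ncells k) -> C) (n : 'I_(ncells k)) :
   sqmod (\sum_(j in D) f j * cis (- (freq k n * node k j))) =
   sqmod (\sum_(j in D) f j *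
      cis (- (2 * pi * (n%:R - (ncells k)%:R / 2) / (ncells k)%:R * j%:R))).
  by rewrite expE sqmodM sqmod_cis mul1r.
have h0 := ltW (mesh_gt0 k).
split.
- by rewrite map_inj_uniq ?enum_uniq // => n m /freq_inj/ord_inj.
- move=> f; rewrite sumE; under eq_bigr do rewrite sE.
  by rewrite /upper_const -lock; have /andP[_ h] := hY f; exact: h.
move=> f; rewrite sumE.
have /andP[h1 h2] := hY f; apply/andP; split.
  apply: le_trans (_ : (cos 1 / 2) ^+ 2 * mesh k ^+ 2 *
     (\sum_(n in Y) sqmod (\sum_(j in D) f j * cis (- (2 * pi * (n%:R - (ncells k)%:R / 2) / (ncells k)%:R * j%:R)))) <= _).
    have := ler_wpM2l (mulr_ge0 (sqr_ge0 (cos (1 : R) / 2)) (sqr_ge0 (mesh k))) h1.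
    by apply: le_trans; rewrite le_eqVlt; apply/orP; left; apply/eqP; ring.
  rewrite mulr_sumr; apply: ler_sum => n _; rewrite ihatE sqmodM sE ler_wpM2r ?sqmod_ge0 //.
  by apply: ihat0_ge => //; apply: freq_bound.
apply: le_trans (_ : mesh k ^+ 2 *
     (\sum_(n in Y) sqmod (\sum_(j in D) f j * cis (- (2 * pi * (n%:R - (ncells k)%:R / 2) / (ncells k)%:R * j%:R)))) <= _).
  rewrite mulr_sumr; apply: ler_sum => n _; rewrite ihatE sqmodM sE ler_wpM2r ?sqmod_ge0 //.
  exact: ihat0_le.
apply: le_trans (ler_wpM2l (sqr_ge0 _) h2) _.
by rewrite /upper_const -lock le_eqVlt; apply/orP; left; apply/eqP; ring.
Qed.

(** Test the upper bound on the indicator of D' modulated by mu: at every frequency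
    within 1 / rad of mu the sum is at least cos 1 * #|D'| in absolute value, because
    all phases are at most 1. *)
Lemma level_count k (D D' : {set 'I_(ncells k)}) (X : seq R) (rad mu : R) : 0 < rad ->
  (forall f : 'I_(ncells k) -> C, \sum_(l <- X) sqmod (\sum_(j in D) f j * cis (- (l * node k j)))
       <= upper_const * #|D|%:R * \sum_(j in D) sqmod (f j)) ->
  D' \subset D -> D' != finset.set0 -> (forall j, j \in D' -> `|node k j| <= rad) ->
  (count (fun l => `|l - mu| <= rad^-1) X)%:R * (cos 1) ^+ 2 * #|D'|%:R
     <= upper_const * #|D|%:R.
Proof.
move=> rad0 hX D'D D'0 hD'; have c1 := cos1_gt0 R.
have m0 : (0 : R) < #|D'|%:R by rewrite ltr0n card_gt0.
pose f (j : 'I_(ncells k)) : C := if j \in D' then cis (mu * node k j) else 0.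
have fE : \sum_(j in D) sqmod (f j) = #|D'|%:R.
  rewrite (big_setID D') /= (finset.setIidPr D'D) [X in _ + X]big1 => [|j].
    rewrite addr0 (eq_bigr (fun=> 1)) => [|j jD]; first by rewrite sumr_const.
    by rewrite /f jD sqmod_cis.
  by rewrite inE => /andP[/negbTE jD _]; rewrite /f jD /sqmod /= expr0n addr0.
have main l : `|l - mu| <= rad^-1 ->
    (cos 1 * #|D'|%:R) ^+ 2 <= sqmod (\sum_(j in D) f j * cis (- (l * node k j))).
  move=> lmu; rewrite (big_setID D') /= (finset.setIidPr D'D) [X in _ + X]big1 => [|j]; last first.
    by rewrite inE => /andP[/negbTE jD _]; rewrite /f jD mul0r.
  rewrite addr0; set S := \sum_(_ in _) _.
  have ReS : cos 1 * #|D'|%:R <= complex.Re S.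
    rewrite raddf_sum /= mulr_natr -sumr_const; apply: ler_sum => j jD.
    rewrite /f jD -cisD; apply: cos_ge_cos1.
    have -> : mu * node k j + - (l * node k j) = - ((l - mu) * node k j) by ring.
    rewrite normrN normrM -(mulVf (lt0r_neq0 rad0)).
    by apply: ler_pM => //; apply: hD'.
  rewrite /sqmod; apply: ler_wpDr; first exact: sqr_ge0.
  have cm : 0 <= cos 1 * #|D'|%:R :> R by rewrite mulr_ge0 // ltW.
  by rewrite ler_pXn2r // nnegrE // (le_trans cm).
have := hX f; rewrite fE => h.
rewrite -(ler_pM2r m0); apply: le_trans h.
apply: le_trans (_ : \sum_(l <- X | `|l - mu| <= rad^-1) (cos 1 * #|D'|%:R) ^+ 2 <= _).
  rewrite big_const_seq iter_addr_0 -[X in _ <= X]mulr_natl.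
  by rewrite le_eqVlt; apply/orP; left; apply/eqP; ring.
rewrite big_mkcond; apply: ler_sum => l _; case: ifP => [/main//|_].
exact: sqmod_ge0.
Qed.

End Level.

Local Open Scope classical_set_scope.
Local Open Scope ring_scope.

(** * Limits of locally bounded point sets *)

Lemma ler_sum_uniq_subset (R : numDomainType) (T : eqType) (s t : seq T) (g : T -> R) :
  uniq s -> {subset s <= t} -> (forall x, 0 <= g x) ->
  \sum_(x <- s) g x <= \sum_(x <- t) g x.
Proof.
move=> us st g0; elim: s us t st => [|x s IH] /=.
  by move=> _ t _; rewrite big_nil sumr_ge0.
case/andP=> xs us t st.
have xt : x \in t by apply: st; rewrite mem_head.
rewrite big_cons (perm_big _ (perm_to_rem xt)) big_cons lerD2l; apply: IH => // y ys.
have yt : y \in t by apply: st; rewrite in_cons ys orbT.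
have : y \in x :: rem x t by rewrite -(perm_mem (perm_to_rem xt)).
by rewrite in_cons => /predU1P[yx|//]; rewrite yx (negbTE xs) in ys.
Qed.

Section Limit.
Variables (R : realType) (X : nat -> seq R) (eta : R) (B : nat).
Hypothesis eta0 : 0 < eta.
Hypothesis uX : forall k, uniq (X k).

(** Half-open intervals of length eta, numbered by the sign of their points and by
    the distance to the origin. *)
Definition window (x : R) : bool * nat := (0 <= x, Num.truncn (`|x| / eta)).

Hypothesis hB : forall k c, (count (fun x => window x == c) (X k) <= B)%N.

Let window_list k c := [seq x <- X k | window x == c].

Definition window_left (c : bool * nat) : R :=
  if c.1 then eta * c.2%:R else - (eta * c.2.+1%:R).

Lemma window_itv x c : window x = c -> window_left c <= x <= window_left c + eta.
Proof.
move=> <-; rewrite /window_left /window /=.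
have x0 : 0 <= `|x| / eta by rewrite divr_ge0 // ltW.
have /andP[] := truncn_itv x0; rewrite ler_pdivlMr // ltr_pdivrMr // => h1 h2.
have h3 : eta * (Num.truncn (`|x| / eta)).+1%:R = eta * (Num.truncn (`|x| / eta))%:R + eta.
  by rewrite -[in LHS]addn1 natrD; ring.
move: h1 h2; rewrite mulrC [_ * eta]mulrC h3.
set w := eta * _ => h1 h2.
have [x1|x1] := leP 0 x.
  by rewrite (ger0_norm x1) in h1 h2; apply/andP; split; lra.
by rewrite (ltr0_norm x1) in h1 h2; apply/andP; split; lra.
Qed.

(** The b-th point of X k in the window c, where i = (c, b); an arbitrary point of the
    closed window if there is no such point. *)
Definition window_pt k (i : (bool * nat) * nat) := nth (window_left i.1) (window_list k i.1) i.2.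

Lemma window_pt_itv k i : window_left i.1 <= window_pt k i <= window_left i.1 + eta.
Proof.
rewrite /window_pt; have [bs|sb] := ltnP i.2 (size (window_list k i.1)).
  apply: window_itv; apply/eqP.
  by have := mem_nth (window_left i.1) bs; rewrite mem_filter => /andP[].
by rewrite nth_default // lexx lerDl ltW.
Qed.

Lemma exists_ultra : exists U : set_system nat, UltraFilter U /\ \oo `<=` U.
Proof. exact: ultraFilterLemma. Qed.

Definition level_filter := projT1 (cid exists_ultra).
Local Instance level_filter_ultra : UltraFilter level_filter.
Proof. by have [] := projT2 (cid exists_ultra). Qed.
Lemma level_filter_oo : \oo `<=` level_filter.
Proof. by have [] := projT2 (cid exists_ultra). Qed.

Lemma window_pt_cvg i : exists l, window_left i.1 <= l <= window_left i.1 + eta /\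
  (fun k => window_pt k i) @ level_filter --> l.
Proof.
have := @segment_compact R (window_left i.1) (window_left i.1 + eta).
move=> /(_ ((fun k => window_pt k i) @ level_filter) _)[].
  apply: filterS (@filterT _ level_filter _) => k _ /=; rewrite in_itv /=; exact: window_pt_itv.
move=> l [+ cl]; rewrite /= in_itv /= => lb; exists l; split=> //.
move=> V Vl; have [//|nV] := in_ultra_setVsetC ((fun k => window_pt k i) @^-1` V) level_filter_ultra.
have [y []] := cl (~` V) V nV Vl.
by [].
Qed.

Definition limit_pt i := projT1 (cid (window_pt_cvg i)).

Lemma limit_pt_itv i : window_left i.1 <= limit_pt i <= window_left i.1 + eta.
Proof. by have [] := projT2 (cid (window_pt_cvg i)). Qed.

Lemma limit_pt_cvg i : (fun k => window_pt k i) @ level_filter --> limit_pt i.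
Proof. by have [] := projT2 (cid (window_pt_cvg i)). Qed.

Definition persistent i := level_filter [set k | (i.2 < size (window_list k i.1))%N].

(** For every window c and every b < B the b-th point of X k in c has a limit along an
    ultrafilter finer than k -> oo. It is kept if the point exists for most k. *)
Definition limit_set := [set x | exists2 i, (i.2 < B)%N /\ persistent i & x = limit_pt i].

Definition window_term (g : R -> R) k i := if (i.2 < size (window_list k i.1))%N then g (window_pt k i) else 0.

Lemma window_term_cvg (g : R -> R) i : continuous g ->
  window_term g ^~ i @ level_filter --> (if `[< persistent i >] then g (limit_pt i) else 0).
Proof.
move=> cg; have [ai|nai] := asboolP.
  apply: (@cvg_trans _ ((fun k => g (window_pt k i)) @ level_filter)).
    apply: near_eq_cvg; apply: filterS ai => k /= h.
    by rewrite /window_term h.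
  by apply: continuous_cvg; [exact: cg | exact: limit_pt_cvg].
have [//|h] := in_ultra_setVsetC [set k | (i.2 < size (window_list k i.1))%N] level_filter_ultra.
apply: (@cvg_trans _ ((fun k => 0 : R) @ level_filter)); last exact: cvg_cst.
apply: near_eq_cvg; apply: filterS h => k /= /negP h.
by rewrite /window_term (negbTE h).
Qed.

Lemma sum_window_term_cvg g (I : Type) (s : seq I) (f : I -> (bool * nat) * nat) : continuous g ->
  (fun k => \sum_(i <- s) window_term g k (f i)) @ level_filter -->
  \sum_(i <- s) (if `[< persistent (f i) >] then g (limit_pt (f i)) else 0).
Proof.
move=> cg; elim: s => [|i s IH].
  under eq_fun do rewrite big_nil.
  by rewrite big_nil; exact: cvg_cst.
under eq_fun do rewrite big_cons.
by rewrite big_cons; apply: cvgD => //; exact: window_term_cvg.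
Qed.

Lemma sum_window_term_le g k s : (forall x, 0 <= g x) -> uniq s ->
  \sum_(i <- s) window_term g k i <= \sum_(x <- X k) g x.
Proof.
move=> g0 us; rewrite /window_term -big_mkcond -big_filter.
rewrite -(big_map (window_pt k) xpredT g).
apply: ler_sum_uniq_subset => //.
  rewrite map_inj_in_uniq ?filter_uniq // => -[c b] [c' b'].
  rewrite !mem_filter /window_pt /= => /andP[h _] /andP[h' _] e.
  have := mem_nth (window_left c) h; rewrite mem_filter => /andP[/eqP hc _].
  have := mem_nth (window_left c') h'; rewrite mem_filter => /andP[/eqP hc' _].
  have cc : c = c' by rewrite -hc e hc'.
  subst c'; congr (_, _); apply/eqP.
  by move/eqP: e; rewrite nth_uniq // filter_uniq.
move=> x /mapP[[c b]]; rewrite mem_filter /= => /andP[h _] ->.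
by have := mem_nth (window_left c) h; rewrite mem_filter => /andP[].
Qed.

(** Distinct points of the limit set come from distinct indices, so that a finite sum
    over the limit set is a limit of partial sums over X k. *)
Lemma esum_limit_set_le (g : R -> R) hi k0 : continuous g -> (forall x, 0 <= g x) ->
  (forall k, (k0 <= k)%N -> \sum_(x <- X k) g x <= hi) ->
  (\esum_(x in limit_set) (g x)%:E <= hi%:E)%E.
Proof.
move=> cg g0 hhi; apply: ub_ereal_sup => _ [A [fA AL] <-].
have /finite_seqP[s As] := fA.
pose xs := undup s.
have Axs : A = [set` xs] by rewrite As; apply/seteqP; split=> x /=; rewrite mem_undup.
rewrite Axs -fsbig_seq ?undup_uniq // sumEFin lee_fin.
have ch x : exists i, A x -> persistent i /\ x = limit_pt i.
  have [/AL[i [_ ai] xi]|nA] := pselect (A x); first by exists i.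
  by exists ((true, 0%N), 0%N).
pose idx x := projT1 (cid (ch x)).
have hidx x : A x -> persistent (idx x) /\ x = limit_pt (idx x) by exact: (projT2 (cid (ch x))).
have xsA x : x \in xs -> A x by rewrite Axs.
have us : uniq (map idx xs).
  rewrite map_inj_in_uniq ?undup_uniq // => x y /xsA/hidx[_ hx] /xsA/hidx[_ hy] e.
  by rewrite hx hy e.
have -> : \sum_(x <- xs) g x =
    \sum_(i <- map idx xs) (if `[< persistent i >] then g (limit_pt i) else 0).
  rewrite big_map; apply: eq_big_seq => x /xsA/hidx[ax {1}->].
  by case: asboolP.
have := @sum_window_term_cvg g _ (map idx xs) id cg.
apply: (@closed_cvg _ _ _ _ _ (fun y => y <= hi)); first exact: closed_le.
apply: level_filter_oo; exists k0 => // k /= hk.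
by apply: le_trans (hhi k hk); apply: sum_window_term_le.
Qed.

(** Windows of the same sign whose numbers differ by at least 2 are separated, which
    is why the windows are split by the parity of their number. *)
Lemma limit_pt_inj (s : bool) par b m m' :
  limit_pt ((s, (m.*2 + par)%N), b) = limit_pt ((s, (m'.*2 + par)%N), b) -> m = m'.
Proof.
wlog mm : m m' / (m < m')%N => [hw|].
  by case: (ltngtP m m') => // h e; [apply: hw | symmetry; apply: hw].
have /andP[] := limit_pt_itv ((s, (m.*2 + par)%N), b).
have /andP[] := limit_pt_itv ((s, (m'.*2 + par)%N), b).
rewrite /window_left /= => h1 h2 h3 h4 e; exfalso.
have : ((m.*2 + par).+2 <= m'.*2 + par)%N by rewrite -!addSn leq_add2r -doubleS leq_double.
rewrite -(ler_nat R) -(ler_pM2l eta0) => h5.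
have Sn n : eta * n.+1%:R = eta * n%:R + eta by rewrite -addn1 natrD mulrDr mulr1.
rewrite !Sn in h5 h1 h2 h3 h4; rewrite e in h3 h4.
set a := eta * (m.*2 + par)%:R in h1 h2 h3 h4 h5.
set a' := eta * (m'.*2 + par)%:R in h1 h2 h3 h4 h5.
by clearbody a a'; have := eta0; case: s h1 h2 h3 h4 {e} => /= h1 h2 h3 h4; lra.
Qed.

Lemma sum_limit_pt_le (g : R -> R) s par b M : (b < B)%N -> (forall x, 0 <= g x) ->
  ((\sum_(m < M) (if `[< persistent ((s, (m.*2 + par)%N), b) >]
      then g (limit_pt ((s, (m.*2 + par)%N), b)) else 0))%:E <=
   \esum_(x in limit_set) (g x)%:E)%E.
Proof.
move=> bB g0; rewrite -big_mkcond /=.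
pose f (m : 'I_M) := limit_pt ((s, (m.*2 + par)%N), b).
pose ms := seq.filter (fun m : 'I_M => `[< persistent ((s, (m.*2 + par)%N), b) >]) (index_enum 'I_M).
have ums : uniq (map f ms).
  rewrite map_inj_uniq ?filter_uniq ?index_enum_uniq // => m m' /limit_pt_inj.
  exact: ord_inj.
apply: esum_ge; exists [set` map f ms].
  split; first exact: finite_seq.
  move=> x /= /mapP[m]; rewrite mem_filter => /andP[/asboolP am _] ->.
  by exists ((s, (m.*2 + par)%N), b).
by rewrite -fsbig_seq // big_map sumEFin -big_filter -/ms.
Qed.

Lemma sum_window_le (g : R -> R) k c : (forall x, 0 <= g x) ->
  \sum_(x <- X k | window x == c) g x <= \sum_(b < B) window_term g k (c, val b).
Proof.
move=> g0; rewrite -big_filter -/(window_list k c) (big_nth (window_left c)).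
have sB : (size (window_list k c) <= B)%N by rewrite /window_list size_filter.
rewrite (big_nat_widen _ _ _ _ _ sB) big_mkord big_mkcond /=.
by apply: ler_sum => b _; rewrite /window_term /window_pt /=; case: ifP.
Qed.

Lemma sum_split (g : R -> R) k M : (forall x, 0 <= g x) ->
  \sum_(x <- X k) g x <=
  \sum_(i : bool * bool * 'I_M) \sum_(b < B)
     window_term g k ((i.1.1, (i.2.*2 + i.1.2)%N), val b) +
  \sum_(x <- X k | (M.*2 <= (window x).2)%N) g x.
Proof.
move=> g0; rewrite (bigID (fun x => ((window x).2 < M.*2)%N)) /=.
apply: lerD; last first.
  by rewrite le_eqVlt; apply/orP; left; apply/eqP; apply: eq_bigl => x; rewrite -leqNgt.
apply: le_trans (_ : \sum_(i : bool * bool * 'I_M)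
   \sum_(x <- X k | window x == (i.1.1, (i.2.*2 + i.1.2)%N)) g x <= _); last first.
  by apply: ler_sum => i _; apply: sum_window_le.
under [X in _ <= X]eq_bigr do rewrite big_mkcond.
rewrite exchange_big /= big_mkcond; apply: ler_sum => x _; case: ifP => h; last first.
  by apply: sumr_ge0 => i _; case: ifP.
have hm : ((window x).2./2 < M)%N by rewrite ltn_half_double.
rewrite (bigD1 ((window x).1, odd (window x).2, Ordinal hm)) //=.
rewrite addnC odd_double_half -/(window x) eqxx lerDl.
by apply: sumr_ge0 => i _; case: ifP.
Qed.

(** The window n contributes O(1 / n^2), because its points are at distance at least
    n * eta from the origin; a telescoping series bounds the total. *)
Lemma sum_tail_le (g : R -> R) k K N : (forall x, 0 <= g x) -> 0 <= K ->
  (forall x, g x * x ^+ 2 <= K) -> (1 < N)%N ->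
  \sum_(x <- X k | (N <= (window x).2)%N) g x <= 2 * B%:R * K / eta ^+ 2 / N.-1%:R.
Proof.
move=> g0 K0 gK N1.
pose W := (N + \max_(x <- X k) (window x).2).+1.
have xW x : x \in X k -> ((window x).2 < W)%N.
  by move=> xk; rewrite /W ltnS; apply: leq_trans (leq_addl _ _); apply: leq_bigmax_seq.
have NW : (N <= W)%N by rewrite /W -addnS leq_addr.
pose C := 2 * B%:R * K / eta ^+ 2.
have C0 : 0 <= C by rewrite !mulr_ge0 ?invr_ge0 ?sqr_ge0.
have cell_sum n : (N <= n)%N -> \sum_(x <- X k | (window x).2 == n) g x <= C * (n%:R^-1 ^+ 2).
  move=> Nn; have n0 : (0 < n)%N by apply: leq_trans Nn; apply: ltn_trans N1.
  apply: le_trans (_ : \sum_(x <- X k | (window x).2 == n) (K / eta ^+ 2 * n%:R^-1 ^+ 2) <= _).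
    apply: ler_sum => x /eqP xn.
    have x0 : 0 <= `|x| / eta by rewrite divr_ge0 // ltW.
    have xn' : Num.truncn (`|x| / eta) = n := xn.
    have /andP[+ _] := truncn_itv x0; rewrite xn' ler_pdivlMr // => h.
    have h2 : (n%:R * eta) ^+ 2 <= x ^+ 2.
      by rewrite -(real_normK (num_real x)) ler_pXn2r // nnegrE ?mulr_ge0 // ltW.
    have n1 : 0 < (n%:R * eta) ^+ 2 by rewrite exprn_gt0 // mulr_gt0 // ltr0n.
    have -> : K / eta ^+ 2 * n%:R^-1 ^+ 2 = K / (n%:R * eta) ^+ 2.
      by field; rewrite gt_eqF // pnatr_eq0 -lt0n n0.
    rewrite ler_pdivlMr //; apply: le_trans (gK x).
    by rewrite ler_wpM2l.
  rewrite big_const_seq iter_addr_0 -[X in X <= _]mulr_natl /C.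
  have cB : (count (fun x => (window x).2 == n) (X k) <= 2 * B)%N.
    rewrite mul2n -addnn.
    apply: leq_trans (leq_add (hB k (true, n)) (hB k (false, n))).
    rewrite -count_predUI; apply: leq_trans (leq_addr _ _); apply: sub_count => x /= /eqP <-.
    by rewrite /window /= !xpair_eqE eqxx; case: (0 <= x).
  have D0 : 0 <= K / eta ^+ 2 * n%:R^-1 ^+ 2 by rewrite !mulr_ge0 ?invr_ge0 ?sqr_ge0.
  rewrite -(ler_nat R) in cB; apply: le_trans (ler_wpM2r D0 cB) _.
  by rewrite natrM; lra.
apply: le_trans (_ : \sum_(N <= n < W) \sum_(x <- X k | (window x).2 == n) g x <= _).
  under [X in _ <= X]eq_bigr do rewrite big_mkcond.
  rewrite exchange_big /= big_mkcond big_seq [X in _ <= X]big_seq.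
  apply: ler_sum => x xk; case: ifP => h; last first.
    by apply: sumr_ge0 => n _; case: ifP.
  rewrite (bigD1_seq (window x).2) ?iota_uniq //=; last by rewrite mem_index_iota h xW.
  by rewrite eqxx lerDl; apply: sumr_ge0 => n _; case: ifP.
apply: le_trans (_ : \sum_(N <= n < W) C * (n.-1%:R^-1 - n%:R^-1) <= _).
  rewrite big_nat [X in _ <= X]big_nat; apply: ler_sum => n /andP[Nn _].
  apply: le_trans (cell_sum n Nn) _; apply: ler_wpM2l => //.
  have n1 : (1 < n)%N by apply: leq_trans Nn.
  case: n n1 {Nn} => // n; rewrite ltnS /= => n0.
  have n2 : (0 : R) < n%:R by rewrite ltr0n.
  have -> : n%:R^-1 - n.+1%:R^-1 = (n%:R * n.+1%:R)^-1 :> R.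
    by rewrite -[n.+1]addn1 natrD; field; rewrite !gt_eqF // addr_gt0.
  rewrite exprVn lef_pV2 ?posrE ?mulr_gt0 ?exprn_gt0 // ?ltr0n //.
  by rewrite expr2 ler_wpM2r // ler_nat.
rewrite -mulr_sumr -/C ler_wpM2l //.
have -> : \sum_(N <= n < W) (n.-1%:R^-1 - n%:R^-1) = N.-1%:R^-1 - W.-1%:R^-1 :> R.
  rewrite (telescope_sumr_eq (fun n => - (n.-1%:R^-1 : R))) //.
    by rewrite opprK addrC.
  by move=> n _; rewrite opprK addrC.
by rewrite gerBl invr_ge0.
Qed.

(** The decay of g prevents a loss of mass at infinity. In the lower bound several
    points of X k may have the same limit, at most 4 * B of them: two signs, two
    parities and B places in a window. *)
Theorem limit_set_sum (g : R -> R) lo hi K k0 : continuous g -> (forall x, 0 <= g x) ->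
  0 <= K -> (forall x, g x * x ^+ 2 <= K) ->
  (forall k, (k0 <= k)%N -> lo <= \sum_(x <- X k) g x <= hi) ->
  exists r : R, [/\ (\esum_(x in limit_set) (g x)%:E = r%:E)%E, r <= hi &
    lo <= (4 * B)%:R * r].
Proof.
move=> cg g0 K0 gK hX.
set e := (\esum_(x in limit_set) _)%E.
have e1 : (e <= hi%:E)%E.
  by apply: (@esum_limit_set_le g hi k0) => // k /hX/andP[].
have e0 : (0 <= e)%E by apply: esum_ge0 => x _; rewrite lee_fin.
have efin : e \is a fin_num.
  by rewrite ge0_fin_numE //; apply: le_lt_trans e1 _; rewrite ltry.
exists (fine e); split; first by rewrite fineK.
  by rewrite -lee_fin fineK.
set r := fine e.
pose C := 2 * B%:R * K / eta ^+ 2.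
have C0 : 0 <= C by rewrite !mulr_ge0 ?invr_ge0 ?sqr_ge0.
have main M : (0 < M)%N -> lo <= (4 * B)%:R * r + C / M.*2.-1%:R.
  move=> M0; have M2 : (1 < M.*2)%N by case: (M) M0.
  pose T k := \sum_(i : bool * bool * 'I_M) \sum_(b < B)
     window_term g k ((i.1.1, (i.2.*2 + i.1.2)%N), val b).
  have h1 : \forall k \near level_filter, lo - C / M.*2.-1%:R <= T k.
    apply: level_filter_oo; exists k0 => // k /= /hX/andP[h _].
    rewrite lerBlDr; apply: le_trans h _; apply: le_trans (sum_split k M g0) _.
    by rewrite lerD2l; apply: sum_tail_le.
  pose l := \sum_(i : bool * bool * 'I_M) \sum_(b < B)
     (if `[< persistent ((i.1.1, (i.2.*2 + i.1.2)%N), val b) >]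
      then g (limit_pt ((i.1.1, (i.2.*2 + i.1.2)%N), val b)) else 0).
  have Tl : T @ level_filter --> l.
    have := @sum_window_term_cvg g _
      [seq (i, b) | i <- index_enum (bool * bool * 'I_M)%type, b <- index_enum 'I_B]
      (fun ib => ((ib.1.1.1, (ib.1.2.*2 + ib.1.1.2)%N), val ib.2)) cg.
    by rewrite /T /l; under eq_fun do rewrite big_allpairs; rewrite big_allpairs.
  have h2 : lo - C / M.*2.-1%:R <= l.
    exact: (@closed_cvg _ _ _ _ T (fun y => lo - C / M.*2.-1%:R <= y) (@closed_ge _ _) h1 _ Tl).
  have h3 : l <= (4 * B)%:R * r.
    rewrite /l exchange_big /=.
    apply: le_trans (_ : \sum_(b < B) (4 * r) <= _); last first.
      by rewrite sumr_const card_ord -[X in X <= _]mulr_natl natrM; lra.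
    apply: ler_sum => b _.
    rewrite -(pair_bigA _ (fun (q : bool * bool) (m : 'I_M) =>
      if `[< persistent ((q.1, (m.*2 + q.2)%N), val b) >]
      then g (limit_pt ((q.1, (m.*2 + q.2)%N), val b)) else 0)) /=.
    apply: le_trans (_ : \sum_(q : bool * bool) r <= _).
      apply: ler_sum => q _; rewrite -lee_fin fineK //.
      exact: sum_limit_pt_le.
    by rewrite sumr_const card_prod card_bool -[X in X <= _]mulr_natl.
  lra.
rewrite leNgt; apply/negP => h.
set d := lo - (4 * B)%:R * r.
have d0 : 0 < d by rewrite subr_gt0.
pose M := (Num.truncn (C / d)).+1.
have := main M isT; apply/negP; rewrite -ltNge -ltrBrDl -/d.
have M0 : (0 : R) < M.*2.-1%:R by rewrite ltr0n.
rewrite ltr_pdivrMr // mulrC -ltr_pdivrMr //.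
apply: lt_le_trans (_ : M%:R <= _).
  by have /andP[] := truncn_itv (divr_ge0 C0 (ltW d0)).
by rewrite ler_nat /M doubleS /= -addnn ltnS leq_addr.
Qed.

Lemma limit_set_discrete : limit_point limit_set = set0.
Proof.
rewrite -subset0 => x /limit_point_infinite_setP /(_ (ball x 1)) h.
have /h : nbhs x (ball x 1) by apply: nbhsx_ballx.
apply.
pose N := (Num.truncn ((`|x| + 1) / eta)).+2.
pose s := [seq ((i : bool * 'I_N).1, val i.2, val b) | i <- enum {: bool * 'I_N}, b <- enum 'I_B].
apply: (@sub_finite_set _ _ [set` map limit_pt s]); last exact: finite_seq.
move=> y [xy [[[sg n] b] [/= bB _] yE]] /=.
rewrite yE; apply: map_f.
have nN : (n < N)%N.
  rewrite ltnNge; apply/negP => Nn.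
  have hn : (`|x| + 1) / eta + 1 < n%:R.
    apply: lt_le_trans (_ : N%:R <= _); last by rewrite ler_nat.
    rewrite /N -addn1 natrD ltrD2r.
    have xe : 0 <= (`|x| + 1) / eta by rewrite divr_ge0 ?addr_ge0 // ltW.
    by have /andP[] := truncn_itv xe.
  have h2 : `|x| + 1 + eta < eta * n%:R.
    have : eta * ((`|x| + 1) / eta + 1) < eta * n%:R by rewrite ltr_pM2l.
    suff -> : eta * ((`|x| + 1) / eta + 1) = `|x| + 1 + eta by [].
    by field; rewrite gt_eqF.
  have /andP[] := limit_pt_itv ((sg, n), b); rewrite -yE /window_left /=.
  have hy : `|y| <= `|x| + 1.
    move: xy; rewrite /ball /= => /ltW xy.
    by rewrite -(subrK x y) addrC (le_trans (ler_normD _ _)) // lerD2l distrC.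
  have h3 : eta * n.+1%:R = eta * n%:R + eta by rewrite -addn1 natrD mulrDr mulr1.
  have := ler_norm y; have := ler_norm (- y); rewrite normrN h3.
  by case: sg {yE} => /=; lra.
apply/allpairsP; exists ((sg, Ordinal nN), Ordinal bB) => /=.
by rewrite !mem_enum.
Qed.

End Limit.

(** * Square integrable functions on a set of finite measure *)

Section SquareIntegrable.
Context d (T : measurableType d) (R : realType) (mu : {measure set T -> \bar R}).
Implicit Types f g h : T -> R.

Definition rint f := mu.-integrable setT (EFin \o f).

Lemma rint_comb a b f g : rint f -> rint g -> rint (fun t => a * f t + b * g t).
Proof.
move=> fi gi.
have := integrableD measurableT (integrableZl measurableT a fi) (integrableZl measurableT b gi).
by apply: eq_integrable => // t _.
Qed.

Lemma rint_le f g : measurable_fun setT f -> rint g -> (forall t, `|f t| <= g t) -> rint f.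
Proof.
move=> mf gi fg; apply: le_integrable gi => //; first exact/measurable_EFinP.
move=> t _ /=; by rewrite lee_fin (le_trans (fg t)) // ler_norm.
Qed.

Lemma rint_ge0 f : measurable_fun setT f -> (forall t, 0 <= f t) ->
  (\int[mu]_t (f t)%:E < +oo)%E -> rint f.
Proof.
move=> mf f0 fi; apply/integrableP; split; first exact/measurable_EFinP.
by under eq_integral do rewrite /= ger0_norm //.
Qed.

Lemma Rint_comb a b f g : rint f -> rint g ->
  \int[mu]_t (a * f t + b * g t) = a * (\int[mu]_t f t) + b * (\int[mu]_t g t).
Proof.
move=> fi gi.
have z (c : R) (k : T -> R) : rint k -> rint (fun t => c * k t).
  by move=> ki; have := rint_comb c 0 ki ki; apply: eq_integrable => // t _ /=;
    rewrite mul0r addr0.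
by rewrite RintegralD ?RintegralZl //; apply: z.
Qed.

Lemma Rint_indic (D : set T) : measurable D -> \int[mu]_t (\1_D t : R) = fine (mu D).
Proof. by move=> mD; rewrite /Rintegral integral_indic // setIT. Qed.

Lemma Rint_le f g : rint f -> rint g -> (forall t, f t <= g t) ->
  \int[mu]_t f t <= \int[mu]_t g t.
Proof. by move=> fi gi fg; apply: le_Rintegral. Qed.

Variables (U : set T) (mU : measurable U) (finU : (mu U < +oo)%E).

(** Square integrable functions that vanish off U are defined on the whole space, so
    that sums and products need no restriction of domains. *)
Definition l2on h := [/\ measurable_fun setT h,
  (\int[mu]_t ((h t) ^+ 2)%:E < +oo)%E & forall t, ~ U t -> h t = 0].

Definition sqint h : R := \int[mu]_t (h t) ^+ 2.

Lemma l2_sqr h : l2on h -> rint (fun t => h t ^+ 2).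
Proof.
by case=> mh hi _; apply: rint_ge0 => // [|t]; [exact: measurable_funX | exact: sqr_ge0].
Qed.

Lemma rint_indic : rint \1_U.
Proof.
apply: rint_ge0 => [|t|]; [exact: measurable_indic | by rewrite indicE |].
by rewrite integral_indic // setIT.
Qed.

Lemma sqint_ge0 h : 0 <= sqint h.
Proof. by apply: Rintegral_ge0 => t _; exact: sqr_ge0. Qed.

Lemma l2_comb a b f g : l2on f -> l2on g -> l2on (fun t => a * f t + b * g t).
Proof.
move=> lf lg; have [mf _ f0] := lf; have [mg _ g0] := lg.
have mh : measurable_fun setT (fun t => a * f t + b * g t).
  by apply: measurable_funD; apply: measurable_funM.
split=> //; last by move=> t nU; rewrite f0 // g0 // !mulr0 addr0.
have : rint (fun t => (a * f t + b * g t) ^+ 2).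
  apply: rint_le (rint_comb (2 * a ^+ 2) (2 * b ^+ 2) (l2_sqr lf) (l2_sqr lg)) _.
    exact: measurable_funX.
  move=> t; rewrite ger0_norm ?sqr_ge0 //.
  by have := sqr_ge0 (a * f t - b * g t); nra.
move=> /integrableP[_]; under eq_integral do rewrite /= ger0_norm ?sqr_ge0 //.
by [].
Qed.

Lemma sqint_comb a b f g : l2on f -> l2on g ->
  sqint (fun t => a * f t + b * g t) <= 2 * a ^+ 2 * sqint f + 2 * b ^+ 2 * sqint g.
Proof.
move=> lf lg; rewrite /sqint -Rint_comb; try exact: l2_sqr.
apply: Rint_le; first exact: l2_sqr (l2_comb a b lf lg).
  by apply: rint_comb; exact: l2_sqr.
by move=> t; have := sqr_ge0 (a * f t - b * g t); nra.
Qed.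

Lemma l2_pair_rint f (phi : T -> R) : l2on f -> measurable_fun setT phi ->
  (forall t, `|phi t| <= 1) -> rint (fun t => f t * phi t).
Proof.
move=> lf mphi phi1; have [mf _ f0] := lf.
apply: rint_le (rint_comb 1 1 (l2_sqr lf) rint_indic) _.
  exact: measurable_funM.
move=> t; rewrite !mul1r normrM.
have [Ut|nUt] := pselect (U t).
  rewrite indicE mem_set //=.
  have := phi1 t; have := normr_ge0 (phi t); rewrite -(real_normK (num_real (f t))).
  by have := normr_ge0 (f t); nra.
by rewrite f0 // normr0 mul0r addr_ge0 ?sqr_ge0 // indicE.
Qed.

(** The Cauchy-Schwarz inequality against a function bounded by 1 on U, from the
    arithmetic-geometric mean inequality with a free parameter s. *)
Lemma l2_pair_sqr f (phi : T -> R) : l2on f -> measurable_fun setT phi ->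
  (forall t, `|phi t| <= 1) ->
  (\int[mu]_t (f t * phi t)) ^+ 2 <= fine (mu U) * sqint f.
Proof.
move=> lf mphi phi1; have [mf _ f0] := lf.
set m := fine _; set q := sqint f; set x := \int[mu]_t _.
have m0 : 0 <= m by rewrite fine_ge0.
have q0 : 0 <= q := sqint_ge0 f.
have fi := l2_pair_rint lf mphi phi1.
have Im : \int[mu]_t \1_U t = m.
  by rewrite /Rintegral integral_indic // setIT.
have main s : 0 < s -> `|x| <= 1 / (2 * s) * q + s / 2 * m.
  move=> s0; apply: le_trans (le_normr_Rintegral measurableT fi) _.
  rewrite -Im -Rint_comb; [|exact: l2_sqr|exact: rint_indic].
  apply: Rint_le.
  - have := fi; move=> /integrable_norm; apply: eq_integrable => // t _.
  - apply: rint_comb; [exact: l2_sqr|exact: rint_indic].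
  move=> t; rewrite normrM.
  have [Ut|nUt] := pselect (U t); last first.
    rewrite f0 // normr0 mul0r expr0n mulr0 add0r indicE.
    by rewrite mulr_ge0 // divr_ge0 // ltW.
  rewrite indicE mem_set //= mulr1.
  have h1 : `|f t| * `|phi t| <= `|f t| by rewrite ler_piMr.
  apply: le_trans h1 _; rewrite -(real_normK (num_real (f t))).
  rewrite -(ler_pM2l (_ : 0 < 2 * s)); last by rewrite mulr_gt0.
  have -> : 2 * s * (1 / (2 * s) * `|f t| ^+ 2 + s / 2) = `|f t| ^+ 2 + s ^+ 2.
    by field; rewrite gt_eqF.
  by have := sqr_ge0 (`|f t| - s); nra.
rewrite -(real_normK (num_real x)).
have [x0|x0] := ltP 0 `|x|; last first.
  have -> : `|x| = 0 by apply/eqP; rewrite eq_le x0 normr_ge0.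
  by rewrite expr0n mulr_ge0.
have [m1|m1] := ltP 0 m; last first.
  have {m1}m1 : m = 0 by apply/eqP; rewrite eq_le m1 m0.
  have := main ((q + 1) / `|x|); rewrite divr_gt0 ?ltr_wpDl // => /(_ isT).
  rewrite m1 mulr0 addr0 -(ler_pM2l (_ : 0 < 2 * (q + 1) / `|x|)); last first.
    by rewrite divr_gt0 // mulr_gt0 // ltr_wpDl.
  have -> : 2 * (q + 1) / `|x| * `|x| = 2 * (q + 1) by field; rewrite gt_eqF.
  have -> : 2 * (q + 1) / `|x| * (1 / (2 * ((q + 1) / `|x|)) * q) = q.
    by field; rewrite !gt_eqF // ltr_wpDl.
  by lra.
have := main (`|x| / m); rewrite divr_gt0 // => /(_ isT).
have -> : 1 / (2 * (`|x| / m)) * q + `|x| / m / 2 * m = m * q / (2 * `|x|) + `|x| / 2.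
  by field; rewrite !gt_eqF.
move=> h; have h2 : `|x| / 2 <= m * q / (2 * `|x|) by lra.
move: h2; rewrite ler_pdivlMr ?mulr_gt0 // => h2.
by rewrite expr2; lra.
Qed.

End SquareIntegrable.

Section Density.
Import HBNNSimple.
Context d (T : measurableType d) (R : realType) (mu : {measure set T -> \bar R}).
Variables (U : set T) (mU : measurable U) (finU : (mu U < +oo)%E).
Local Notation l2on := (l2on mu U).
Local Notation sqint := (sqint mu).
Implicit Types f g h : T -> R.

Variable V : (T -> R) -> Prop.
Hypothesis V_l2 : forall g, V g -> l2on g.
Hypothesis V0 : V (fun=> 0).
Hypothesis V_comb : forall a b f g, V f -> V g -> V (fun t => a * f t + b * g t).
Hypothesis V_indic : forall (A : set T) e, measurable A -> A `<=` U -> 0 < e ->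
  exists2 g, V g & sqint (fun t => 1 * \1_A t + -1 * g t) <= e.

Definition approximable h := forall e, 0 < e ->
  exists2 g, V g & sqint (fun t => 1 * h t + -1 * g t) <= e.

Lemma l2_indic (A : set T) : measurable A -> A `<=` U -> l2on \1_A.
Proof.
move=> mA AU; split; first exact: measurable_indic.
  have E (t : T) : ((\1_A t : R) ^+ 2)%:E = (\1_A t)%:E.
    by rewrite indicE; case: (t \in A); rewrite ?expr1n ?expr0n.
  under eq_integral do rewrite E.
  rewrite integral_indic // setIT; apply: le_lt_trans finU.
  by apply: le_measure; rewrite ?inE.
move=> t nU; rewrite indicE memNset // => At; exact/nU/AU.
Qed.

Lemma approximable_comb a b f g : l2on f -> l2on g ->
  approximable f -> approximable g -> approximable (fun t => a * f t + b * g t).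
Proof.
move=> lf lg af ag e e0.
pose ef := e / (4 * (1 + a ^+ 2)); pose eg := e / (4 * (1 + b ^+ 2)).
have a1 : 0 < 1 + a ^+ 2 by rewrite ltr_wpDr ?sqr_ge0.
have b1 : 0 < 1 + b ^+ 2 by rewrite ltr_wpDr ?sqr_ge0.
have [|f' Vf hf] := af ef; first by rewrite divr_gt0 // mulr_gt0.
have [|g' Vg hg] := ag eg; first by rewrite divr_gt0 // mulr_gt0.
exists (fun t => a * f' t + b * g' t); first exact: V_comb.
have -> : (fun t => 1 * (a * f t + b * g t) + -1 * (a * f' t + b * g' t)) =
  (fun t => a * (1 * f t + -1 * f' t) + b * (1 * g t + -1 * g' t)).
  by apply/funext => t; ring.
apply: le_trans (sqint_comb a b (l2_comb 1 (-1) lf (V_l2 Vf)) (l2_comb 1 (-1) lg (V_l2 Vg))) _.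
have e1 : a ^+ 2 * ef <= e / 4.
  rewrite /ef mulrA ler_pdivrMr ?mulr_gt0 //.
  by have -> : e / 4 * (4 * (1 + a ^+ 2)) = e + e * a ^+ 2 by [field]; lra.
have e2 : b ^+ 2 * eg <= e / 4.
  rewrite /eg mulrA ler_pdivrMr ?mulr_gt0 //.
  by have -> : e / 4 * (4 * (1 + b ^+ 2)) = e + e * b ^+ 2 by [field]; lra.
have := ler_wpM2l (sqr_ge0 a) hf; have := ler_wpM2l (sqr_ge0 b) hg; lra.
Qed.

Lemma approximable_limit h : l2on h ->
  (forall e, 0 < e -> exists g, [/\ l2on g, approximable g &
     sqint (fun t => 1 * h t + -1 * g t) <= e]) -> approximable h.
Proof.
move=> lh hh e e0; have e4 : 0 < e / 4 by rewrite divr_gt0.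
have [g [lg ag hg]] := hh _ e4; have [k Vk hk] := ag _ e4; exists k => //.
have -> : (fun t => 1 * h t + -1 * k t) =
  (fun t => 1 * (1 * h t + -1 * g t) + 1 * (1 * g t + -1 * k t)).
  by apply/funext => t; ring.
apply: le_trans (sqint_comb 1 1 (l2_comb 1 (-1) lh lg) (l2_comb 1 (-1) lg (V_l2 Vk))) _.
by rewrite expr1n; lra.
Qed.

Lemma approximable_indic_sum (I : eqType) (s : seq I) (c : I -> R) (A : I -> set T) :
  (forall i, i \in s -> measurable (A i) /\ A i `<=` U) ->
  l2on (fun t => \sum_(i <- s) c i * \1_(A i) t) /\
  approximable (fun t => \sum_(i <- s) c i * \1_(A i) t).
Proof.
elim: s => [|i s IH] hs.
  have -> : (fun t => \sum_(i <- [::]) c i * \1_(A i) t) = (fun=> 0) :> (T -> R).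
    by apply/funext => t; rewrite big_nil.
  split; first exact: V_l2.
  move=> e e0; exists (fun=> 0) => //.
  have -> : (fun t : T => 1 * 0 + -1 * 0) = (fun=> 0) :> (T -> R).
    by apply/funext => t; ring.
  rewrite /sqint /Rintegral; under eq_integral do rewrite expr0n.
  by rewrite integral0 ltW.
have [|ls as_] := IH; first by move=> j js; apply: hs; rewrite in_cons js orbT.
have [mi Ui] := hs i (mem_head _ _).
have -> : (fun t => \sum_(i <- i :: s) c i * \1_(A i) t) =
   (fun t => c i * \1_(A i) t + 1 * \sum_(i <- s) c i * \1_(A i) t).
  by apply/funext => t; rewrite big_cons mul1r.
split; first by apply: l2_comb => //; exact: l2_indic.
by apply: approximable_comb => //; [exact: l2_indic | move=> e e0; exact: V_indic].
Qed.

Lemma approximable_nnsfun (s : {nnsfun T >-> R}) : (forall t, ~ U t -> s t = 0) ->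
  l2on s /\ approximable s.
Proof.
move=> sU.
have /finite_seqP[l lE] := @fimfunP _ _ s.
pose ys := [seq y <- undup l | y != 0].
have E : (s : T -> R) = (fun t => \sum_(y <- ys) y * \1_(s @^-1` [set y]) t).
  apply/funext => t; rewrite fimfunE lE.
  have -> : [set` l] = [set` undup l] by apply/seteqP; split=> x /=; rewrite mem_undup.
  rewrite -fsbig_seq ?undup_uniq // /ys big_filter [RHS]big_mkcond.
  by apply: eq_bigr => y _; case: eqP => [->|]; rewrite ?mul0r.
rewrite E; apply: approximable_indic_sum => y; rewrite mem_filter => /andP[/eqP y0 _].
split; first exact: measurable_sfunP.
by move=> t /= st; apply: contrapT => /sU; rewrite st.
Qed.

Lemma approximable_ge0 h : l2on h -> (forall t, 0 <= h t) -> approximable h.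
Proof.
move=> lh h0; have [mh hi hU] := lh; apply: approximable_limit => // e e0.
have mh' : measurable_fun setT (EFin \o h) by exact/measurable_EFinP.
pose g n := nnsfun_approx measurableT mh' n.
have cg t : (fun n => g n t) @ \oo --> h t.
  have /fine_cvgP[_] := @cvg_nnsfun_approx _ _ _ _ measurableT _ mh' (fun x _ => h0 x) t Logic.I.
  by [].
have gh n t : g n t <= h t.
  have nd : nondecreasing_seq (fun n => g n t).
    by move=> i j ij; have /lefP := nd_nnsfun_approx measurableT mh' ij; apply.
  have := nondecreasing_cvgn_le nd (cvgP _ (cg t)) n.
  by rewrite (cvg_lim _ (cg t)).
have gU n t : ~ U t -> g n t = 0.
  move=> nU; apply/eqP; rewrite eq_le; apply/andP; split; last exact: fun_ge0.
  by rewrite -(hU t nU).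
have [lg ag] : (forall n, l2on (g n)) /\ (forall n, approximable (g n)).
  by split=> n; have [] := approximable_nnsfun (gU n).
have : (fun n => \int[mu]_t ((1 * h t + -1 * g n t) ^+ 2)%:E)%E @ \oo --> 0%E.
  have -> : 0%E = (\int[mu]_(t in setT) (cst 0%E t))%E by rewrite integral0.
  apply: (@dominated_cvg _ _ _ _ _ measurableT _ _ (fun t => (h t ^+ 2)%:E)).
  - move=> n; apply/measurable_EFinP; apply: measurable_funX.
    by have [] := l2_comb 1 (-1) lh (lg n).
  - move=> t _; apply: cvg_EFin; first exact: nearW.
    have -> : fine \o (fun n => ((1 * h t + -1 * g n t) ^+ 2)%:E) =
       (fun n => (1 * h t + -1 * g n t) ^+ 2) by [].
    have -> : (0 : R) = (1 * h t + -1 * h t) ^+ 2 by ring.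
    have c : (fun n => 1 * h t + -1 * g n t) @ \oo --> 1 * h t + -1 * h t.
      by apply: cvgD; [exact: cvg_cst | apply: cvgM; [exact: cvg_cst | exact: cg]].
    exact: (cvgM c c).
  - by [].
  - exact: l2_sqr lh.
  move=> n t _ /=; rewrite lee_fin ger0_norm ?sqr_ge0 //.
  have g0 : 0 <= g n t by exact: fun_ge0.
  by have := gh n t; nra.
move/fine_cvgP => [_ /cvgrPdist_le /(_ e e0)] [N _ hN].
exists (g N); split=> //.
by have := hN N (leqnn N); rewrite /= sub0r normrN => /(le_trans (ler_norm _)).
Qed.

(** A linear class that approximates the indicators of measurable subsets of U
    approximates all of L^2(U): simple functions by linearity, nonnegative functions
    by simple ones and dominated convergence, and then h as a difference. *)
Lemma l2_density h : l2on h -> approximable h.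
Proof.
move=> lh; have [mh hi hU] := lh.
pose hp t := Num.max (h t) 0; pose hn t := Num.max (- h t) 0.
have mhp : measurable_fun setT hp by exact: measurable_maxr.
have mhn : measurable_fun setT hn by apply: measurable_maxr => //; exact: measurableT_comp.
have le (k : T -> R) : measurable_fun setT k -> (forall t, k t ^+ 2 <= h t ^+ 2) -> l2on k.
  move=> mk kh; split => //; last first.
    move=> t /hU h0; apply/eqP; rewrite -sqrf_eq0 eq_le sqr_ge0 andbT.
    by rewrite (le_trans (kh t)) // h0 expr0n.
  apply: le_lt_trans hi; apply: ge0_le_integral => //.
  - by move=> t _; rewrite lee_fin sqr_ge0.
  - by apply/measurable_EFinP; exact: measurable_funX.
  - by apply/measurable_EFinP; exact: measurable_funX.
  - by move=> t _; rewrite lee_fin.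
have lp : l2on hp.
  apply: le => // t; rewrite /hp; case: (leP (h t) 0) => _ //; by rewrite expr0n sqr_ge0.
have ln : l2on hn.
  apply: le => // t; rewrite /hn; case: (leP (- h t) 0) => _; last by rewrite sqrrN.
  by rewrite expr0n sqr_ge0.
have -> : h = (fun t => 1 * hp t + -1 * hn t).
  apply/funext => t; rewrite /hp /hn.
  by case: (leP (h t) 0) => ht; case: (leP (- h t) 0) => ht'; lra.
by apply: approximable_comb => //; apply: approximable_ge0 => // t; rewrite le_max lexx orbT.
Qed.

End Density.

(** * Dyadic cells and step functions *)

Section Cells.
Local Open Scope complex_scope.
Variable R : realType.
Local Notation C := R[i].
Local Notation mesh := (@mesh R).
Local Notation node := (@node R).

Definition cellset (k j : nat) : set R := [set t | node k j <= t < node k j.+1].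

Lemma meshS k : mesh k = 2 * mesh k.+1.
Proof. by rewrite /mesh exprS invfM mulrA divff ?mul1r // pnatr_eq0. Qed.

Lemma node_refine k j : node k.+1 (j.*2 + ncells k) = node k j.
Proof.
rewrite /node natrD mulrDl; have := ncells_mesh R k; rewrite meshS => h.
have e : (ncells k)%:R * mesh k.+1 = 2 ^+ k by lra.
by rewrite e meshS -mul2n natrM exprS; ring.
Qed.

Lemma ncellsS k : ncells k.+1 = (4 * ncells k)%N.
Proof. by rewrite /ncells expnS; lia. Qed.

Lemma cellset_refine k j t : cellset k j t <->
  cellset k.+1 (j.*2 + ncells k) t \/ cellset k.+1 (j.*2.+1 + ncells k) t.
Proof.
rewrite /cellset /= -addSn !addSn -addSn node_refine.
have -> : node k j.+1 = node k.+1 (j.*2.+1.+1 + ncells k).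
  by rewrite -[j.*2.+2]/(j.+1.*2) node_refine.
have := nodeS R k.+1 (j.*2 + ncells k); rewrite -addSn.
have := nodeS R k.+1 (j.*2.+1 + ncells k); rewrite -addSn node_refine.
set a := node k j; set b := node _ (j.*2.+1 + _); set c := node _ _.
have h0 := mesh_gt0 R k.+1 => e1 e2.
split=> [/andP[h1 h2]|[]/andP[h1 h2]].
- have [tb|tb] := ltP t b; [left | right]; apply/andP; split=> //.
- by apply/andP; split=> //; lra.
- by apply/andP; split=> //; lra.
Qed.

Lemma cellset_inj k i j t : cellset k i t -> cellset k j t -> i = j.
Proof.
move=> /andP[i1 i2] /andP[j1 j2].
have h0 := mesh_gt0 R k.
have key a b : node k a < node k b.+1 -> (a <= b)%N.
  by rewrite /node ltrD2r ltr_pM2r // ltr_nat.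
by apply/eqP; rewrite eqn_leq !key //; [apply: le_lt_trans j1 i2 | apply: le_lt_trans i1 j2].
Qed.

Lemma cellset_cover k t : - 2 ^+ k <= t < 2 ^+ k ->
  exists2 j, (j < ncells k)%N & cellset k j t.
Proof.
move=> /andP[t1 t2]; have h0 := mesh_gt0 R k.
pose y := (t + 2 ^+ k) / mesh k.
have y0 : 0 <= y by rewrite divr_ge0 ?(ltW h0) //; lra.
have /andP[y1 y2] := truncn_itv y0.
have yE : y * mesh k = t + 2 ^+ k by rewrite /y divfK // gt_eqF.
exists (Num.truncn y).
  rewrite -(ltr_nat R); apply: le_lt_trans y1 _.
  by rewrite -(ltr_pM2r h0) yE ncells_mesh; lra.
rewrite /cellset /= /node; apply/andP; split.
  by rewrite lerBlDr -yE ler_pM2r.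
by rewrite ltrBrDr -yE ltr_pM2r.
Qed.

(** Level k + 1 covers an interval twice as long, hence the offset: the cell j of
    level k consists of the cells 2 j + ncells k and 2 j + 1 + ncells k of level k + 1. *)
Definition refine (V : nmodType) k (f : nat -> V) (i : nat) : V :=
  if (ncells k <= i)%N then f ((i - ncells k)./2) else 0.

Definition bounded_index (V : nmodType) k (f : nat -> V) :=
  forall j, (ncells k <= j)%N -> f j = 0.

Lemma refine_even (V : nmodType) k (f : nat -> V) j :
  refine k f (j.*2 + ncells k) = f j.
Proof. by rewrite /refine leq_addl addnK doubleK. Qed.

Lemma refine_odd (V : nmodType) k (f : nat -> V) j :
  refine k f (j.*2.+1 + ncells k) = f j.
Proof. by rewrite /refine leq_addl addnK -[j.*2.+1]/(true + j.*2)%N half_bit_double. Qed.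

Lemma sum_double (W : nmodType) n (F : nat -> W) :
  \sum_(i < n.*2) F i = \sum_(j < n) (F j.*2 + F j.*2.+1).
Proof.
elim: n => [|n IH]; first by rewrite !big_ord0.
by rewrite doubleS !big_ord_recr /= IH addrA.
Qed.

Lemma sum_refine (V W : nmodType) k (f : nat -> V) (phi : nat -> V -> W) :
  bounded_index k f -> (forall i, phi i 0 = 0) ->
  \sum_(i < ncells k.+1) phi i (refine k f i) =
  \sum_(j < ncells k) (phi (j.*2 + ncells k)%N (f j) + phi (j.*2.+1 + ncells k)%N (f j)).
Proof.
move=> bf phi0; set N := ncells k.
have -> : ncells k.+1 = (N + (N.*2 + N))%N by rewrite ncellsS -/N; lia.
rewrite big_split_ord /= [X in X + _]big1 => [|i _]; last first.
  by rewrite /refine leqNgt ltn_ord.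
rewrite add0r big_split_ord /= [X in _ + X]big1 => [|i _]; last first.
  rewrite /refine leq_addr addnC addnK bf //.
  by rewrite -/N geq_half_double; lia.
rewrite addr0 (sum_double N (fun i => phi (N + i)%N (refine k f (N + i)))).
apply: eq_bigr => j _; rewrite ![(N + _)%N]addnC.
by rewrite refine_even refine_odd.
Qed.

Lemma refine_bounded (V : nmodType) k (f : nat -> V) :
  bounded_index k f -> bounded_index k.+1 (refine k f).
Proof.
move=> bf i; rewrite ncellsS => hi; rewrite /refine; case: ifP => // hN.
by apply: bf; rewrite geq_half_double; lia.
Qed.

Definition supported (V : nmodType) (O : set R) k (f : nat -> V) :=
  bounded_index k f /\ forall j, f j <> 0 -> cellset k j `<=` O.

Lemma refine_supported (V : nmodType) (O : set R) k (f : nat -> V) :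
  supported O k f -> supported O k.+1 (refine k f).
Proof.
case=> bf sf; split; first exact: refine_bounded.
move=> i; rewrite /refine; case: ifP => // hN fi t ti.
apply: (sf _ fi); apply/cellset_refine.
have := odd_double_half (i - ncells k).
case: (odd _) => /= e; [right | left].
  by rewrite (_ : _ + _ = i)%N //; lia.
by rewrite (_ : _ + _ = i)%N //; lia.
Qed.

Fixpoint refines (V : nmodType) k (f : nat -> V) p : nat -> V :=
  if p is p'.+1 then refine (k + p') (refines k f p') else f.

Lemma refines_supported (V : nmodType) (O : set R) k (f : nat -> V) p :
  supported O k f -> supported O (k + p) (refines k f p).
Proof.
by move=> sf; elim: p => [|p IH]; rewrite ?addn0 // addnS; apply: refine_supported.
Qed.

Definition hat k (f : nat -> C) (l : R) : C :=
  \sum_(j < ncells k) f j * ihat (node k j) (node k j.+1) l.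

Definition sqcoef k (f : nat -> C) : R := mesh k * \sum_(j < ncells k) sqmod (f j).

Lemma hat_refine k f l : bounded_index k f -> hat k.+1 (refine k f) l = hat k f l.
Proof.
move=> bf; rewrite /hat.
rewrite (sum_refine (phi := fun i c => c * ihat (node k.+1 i) (node k.+1 i.+1) l)) //.
  apply: eq_bigr => j _; rewrite -mulrDr; congr (_ * _).
  rewrite -addSn ihatD node_refine -addSn -[j.*2.+2]/(j.+1.*2).
  by rewrite node_refine.
by move=> i; rewrite mul0r.
Qed.

Lemma sqmod0 : sqmod (0 : C) = 0.
Proof. by rewrite /sqmod /= expr0n addr0. Qed.

Lemma sqcoef_refine k f : bounded_index k f -> sqcoef k.+1 (refine k f) = sqcoef k f.
Proof.
move=> bf; rewrite /sqcoef (sum_refine (phi := fun _ c => sqmod c)) //; last first.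
  by move=> _; exact: sqmod0.
by rewrite (meshS k) big_split /=; ring.
Qed.

Lemma hat_refines k f p l : bounded_index k f -> hat (k + p) (refines k f p) l = hat k f l.
Proof.
move=> bf; elim: p => [|p IH]; first by rewrite addn0.
rewrite addnS /= hat_refine // => i hi.
have : supported setT k f by split.
by move=> /(@refines_supported _ setT k f p)[h _]; apply: h.
Qed.

Lemma sqcoef_refines k f p : bounded_index k f -> sqcoef (k + p) (refines k f p) = sqcoef k f.
Proof.
move=> bf; elim: p => [|p IH]; first by rewrite addn0.
rewrite addnS /= sqcoef_refine // => i hi.
have : supported setT k f by split.
by move=> /(@refines_supported _ setT k f p)[h _]; apply: h.
Qed.

Definition rstep k (f : nat -> R) (t : R) : R :=
  \sum_(j < ncells k) f j * \1_(cellset k j) t.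

Lemma indic_refine k j t : \1_(cellset k j) t =
  \1_(cellset k.+1 (j.*2 + ncells k)) t + \1_(cellset k.+1 (j.*2.+1 + ncells k)) t :> R.
Proof.
rewrite !indicE; have [h|h] := pselect (cellset k j t); last first.
  rewrite !memNset ?addr0 // => h'; apply: h; apply/cellset_refine; [by right | by left].
rewrite (mem_set h); have /cellset_refine[h'|h'] := h.
  rewrite (mem_set h') memNset ?addr0 // => h2.
  by have := cellset_inj h' h2; lia.
rewrite (mem_set h') memNset ?add0r // => h2.
by have := cellset_inj h' h2; lia.
Qed.

Lemma rstep_refine k f : bounded_index k f -> rstep k.+1 (refine k f) = rstep k f.
Proof.
move=> bf; apply/funext => t; rewrite /rstep.
rewrite (sum_refine (phi := fun i c => c * \1_(cellset k.+1 i) t)) //.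
  by apply: eq_bigr => j _; rewrite -mulrDr -indic_refine.
by move=> i; rewrite mul0r.
Qed.

Lemma rstep_refines k f p : bounded_index k f -> rstep (k + p) (refines k f p) = rstep k f.
Proof.
move=> bf; elim: p => [|p IH]; first by rewrite addn0.
rewrite addnS /= rstep_refine // => i hi.
have : supported setT k f by split.
by move=> /(@refines_supported _ setT k f p)[h _]; apply: h.
Qed.

Lemma rstep_cell k f j t : (j < ncells k)%N -> cellset k j t -> rstep k f t = f j.
Proof.
move=> jN tj; rewrite /rstep (bigD1 (Ordinal jN)) //= big1 => [|i ij].
  by rewrite indicE mem_set // mulr1 addr0.
rewrite indicE memNset ?mulr0 // => ti; move/eqP: ij; apply; apply: val_inj.
exact: cellset_inj ti tj.
Qed.

Lemma rstep_out k f t : (forall j, (j < ncells k)%N -> ~ cellset k j t) -> rstep k f t = 0.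
Proof.
by move=> h; rewrite /rstep big1 // => j _; rewrite indicE memNset ?mulr0 //; apply: h.
Qed.

Lemma rstep_sqr k f t : rstep k f t ^+ 2 = rstep k (fun j => f j ^+ 2) t.
Proof.
have [[j [jN tj]]|nj] := pselect (exists j, (j < ncells k)%N /\ cellset k j t).
  by rewrite !(rstep_cell _ jN tj).
by rewrite !rstep_out ?expr0n // => j jN tj; apply: nj; exists j.
Qed.

Lemma rstep_supported (O : set R) k f t : supported O k f -> ~ O t -> rstep k f t = 0.
Proof.
move=> [_ sf] nO; rewrite /rstep big1 // => j _.
have [->|fj] := eqVneq (f j) 0; first by rewrite mul0r.
by rewrite indicE memNset ?mulr0 // => tj; apply: nO; apply: sf tj; apply/eqP.
Qed.

Definition inner (O : set R) k : nat -> R :=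
  fun j => if (j < ncells k)%N && `[< cellset k j `<=` O >] then 1 else 0.

Lemma inner_supported O k : supported O k (inner O k).
Proof.
split=> [j|j]; rewrite /inner; first by rewrite leqNgt => /negbTE->.
by case: ifP => // /andP[_ /asboolP].
Qed.

Definition inner_set (O : set R) k := [set t | exists2 j, (j < ncells k)%N &
  cellset k j t /\ cellset k j `<=` O].

Lemma rstep_inner O k : rstep k (inner O k) = \1_(inner_set O k).
Proof.
apply/funext => t; rewrite indicE.
have [[j [jN tj]]|nj] := pselect (exists j, (j < ncells k)%N /\ cellset k j t).
  rewrite (rstep_cell _ jN tj) /inner jN /=; case: asboolP => h.
    by rewrite mem_set //; exists j.
  rewrite memNset // => -[i iN [ti hi]]; apply: h.
  by rewrite (cellset_inj tj ti).
rewrite rstep_out => [|j jN tj]; last by apply: nj; exists j.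
by rewrite memNset // => -[i iN [ti _]]; apply: nj; exists i.
Qed.

Lemma inner_set_sub O k : inner_set O k `<=` O.
Proof. by move=> t [j _ [tj]]; apply. Qed.

Lemma inner_setS O k : inner_set O k `<=` inner_set O k.+1.
Proof.
move=> t [j jN [tj jO]].
have h j' : (cellset k.+1 j' `<=` cellset k j) -> cellset k.+1 j' `<=` O.
  by move=> h; apply: subset_trans jO.
case/cellset_refine: tj => tj.
  exists (j.*2 + ncells k)%N; first by rewrite ncellsS; lia.
  by split=> //; apply: h => s hs; apply/cellset_refine; left.
exists (j.*2.+1 + ncells k)%N; first by rewrite ncellsS; lia.
by split=> //; apply: h => s hs; apply/cellset_refine; right.
Qed.

Lemma inner_set_mono O : nondecreasing_seq (inner_set O).
Proof.
apply/nondecreasing_seqP => k; apply/subsetPset; exact: inner_setS.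
Qed.

Lemma pow2_gt (x : R) : exists k, x < 2 ^+ k.
Proof.
exists (Num.truncn `|x|).+1; apply: le_lt_trans (ler_norm x) _.
have /andP[_ h] := truncn_itv (normr_ge0 x); apply: lt_le_trans h _.
by rewrite -natrX ler_nat ltnW // ltn_expl.
Qed.

Lemma bigcup_inner_set O : open O -> \bigcup_k inner_set O k = O.
Proof.
move=> oO; apply/seteqP; split; first by move=> t [k _] /inner_set_sub.
move=> t Ot; have : nbhs t O by apply: open_nbhs_nbhs.
rewrite -nbhs_ballE => -[r /= r0 hr].
have [k hk] := pow2_gt (r^-1 + `|t|).
have k1 : `|t| < 2 ^+ k by apply: le_lt_trans hk; rewrite lerDr invr_ge0 ltW.
have k2 : mesh k < r.
  rewrite /mesh -[r]invrK ltf_pV2 ?posrE ?invr_gt0 ?exprn_gt0 //.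
  by apply: le_lt_trans hk; rewrite lerDl.
have [|j jN tj] := @cellset_cover k t.
  by move: k1; rewrite ltr_norml => /andP[h1 h2]; rewrite (ltW h1).
exists k => //; exists j => //; split=> // s sj; apply: hr.
rewrite /ball /=; move: tj sj; rewrite /cellset /= nodeS => /andP[t1 t2] /andP[s1 s2].
by apply: le_lt_trans k2; rewrite ler_norml; apply/andP; split; lra.
Qed.

End Cells.

(** * Trigonometric integrals over cells *)

Section Integrals.
Local Open Scope complex_scope.
Variable R : realType.
Local Notation C := R[i].
Local Notation T := (lebesgueTypeR R).
Local Notation mu := (@completed_lebesgue_measure R).
Local Notation leb := (@lebesgue_measure R).
Local Notation mesh := (@mesh R).
Local Notation node := (@node R).
Local Notation cellset := (@cellset R).

Lemma borel_Lmeasurable (A : set R) : measurable (A : set (measurableTypeR R)) ->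
  measurable (A : set T).
Proof. exact: sub_caratheodory. Qed.

Lemma borel_Lmeasurable_fun (f : R -> R) :
  measurable_fun setT (f : measurableTypeR R -> R) -> measurable_fun setT (f : T -> R).
Proof. by move=> mf _ Y mY; apply: borel_Lmeasurable; apply: mf. Qed.

Lemma open_Lmeasurable (O : set R) : open O -> measurable (O : set T).
Proof. by move=> oO; apply: borel_Lmeasurable; exact: open_measurable. Qed.

Lemma id_Lmeasurable : measurable_fun setT (id : T -> measurableTypeR R).
Proof. by move=> _ Y mY; rewrite setTI; exact: borel_Lmeasurable. Qed.

Lemma cos_Lmeasurable (l : R) : measurable_fun setT (fun t : T => cos (l * t) : R).
Proof.
apply: borel_Lmeasurable_fun; apply: continuous_measurable_fun => t.
apply: continuous_comp; last exact: continuous_cos.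
by apply: cvgM; [exact: cvg_cst | exact: cvg_id].
Qed.

Lemma sin_Lmeasurable (l : R) : measurable_fun setT (fun t : T => sin (l * t) : R).
Proof.
apply: borel_Lmeasurable_fun; apply: continuous_measurable_fun => t.
apply: continuous_comp; last exact: continuous_sin.
by apply: cvgM; [exact: cvg_cst | exact: cvg_id].
Qed.

Lemma cellsetE k j : cellset k j = `[node k j, node k j.+1[%classic.
Proof. by apply/seteqP; split=> t; rewrite /cellset /= in_itv. Qed.

Lemma cellset_Lmeasurable k j : measurable (cellset k j : set T).
Proof. by apply: borel_Lmeasurable; rewrite cellsetE; exact: measurable_itv. Qed.

Lemma mu_itv (a b : R) : a <= b -> mu `[a, b[%classic = (b - a)%:E.
Proof.
move=> ab; rewrite -[mu _]/(leb _) lebesgue_measure_itv /= lte_fin.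
by case: ltP => // ba; rewrite (_ : b = a) ?subrr //; apply/eqP; rewrite eq_le ab ba.
Qed.

Lemma mu_cellset k j : (mu : {measure set T -> \bar R}) (cellset k j) = (mesh k)%:E.
Proof.
have h0 := mesh_gt0 R k.
rewrite -[LHS]/(@completed_lebesgue_measure R (cellset k j)) cellsetE mu_itv; first by rewrite nodeS addrC addKr.
by rewrite nodeS lerDl ltW.
Qed.

(** The completed measure integrates Borel functions as Lebesgue measure does: the
    identity is measurable and pushes one forward to the other. *)
Lemma integral_completed (a b : R) (f : R -> R) : a <= b -> continuous f ->
  (forall t, `|f t| <= 1) ->
  (\int[mu]_(x in `[a, b[%classic) (f x)%:E = \int[leb]_(x in `[a, b[%classic) (f x)%:E)%E.
Proof.
move=> ab cf f1.
have mf : measurable_fun setT (EFin \o f : measurableTypeR R -> \bar R).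
  by apply/measurable_EFinP; exact: continuous_measurable_fun.
have mab : measurable (`[a, b[%classic : set (measurableTypeR R)) by exact: measurable_itv.
transitivity (\int[pushforward mu (id : T -> measurableTypeR R)]_(x in `[a, b[%classic) (f x)%:E)%E.
  symmetry; apply: (@integral_pushforward _ _ T (measurableTypeR R) R id id_Lmeasurable mu
     `[a, b[%classic (EFin \o f) mf _ mab).
suff : mu.-integrable (`[a, b[%classic : set T) (EFin \o f) by [].
apply: (@le_integrable _ T R mu _ (borel_Lmeasurable mab) _ (cst 1%:E)).
- apply: measurable_funTS; apply/measurable_EFinP; apply: borel_Lmeasurable_fun.
  exact: continuous_measurable_fun.
- by move=> t _ /=; rewrite lee_fin normr1.
- apply/integrableP; split; first exact: measurable_cst.
  under eq_integral do rewrite /= normr1.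
  by rewrite integral_cst //= ?mul1e ?mu_itv ?ltry //; exact: borel_Lmeasurable.
by [].
Qed.

Lemma FTC_itv (a b : R) (f F : R -> R) : a <= b -> continuous f ->
  (forall t, `|f t| <= 1) -> (forall t, is_derive t (1 : R) F (f t)) ->
  (\int[mu]_(x in `[a, b[%classic) (f x)%:E = (F b - F a)%:E)%E.
Proof.
move=> ab cf f1 dF; rewrite integral_completed //.
have [ab'|ba] := ltP a b; last first.
  rewrite (_ : b = a); last by apply/eqP; rewrite eq_le ab ba.
  by rewrite set_itvco0 integral_set0 subrr.
have cF : continuous F.
  by move=> t; apply/differentiable_continuous/derivable1_diffP; have [] := dF t.
rewrite integral_itv_bndo_bndc; last first.
  apply: measurable_funTS; apply/measurable_EFinP; exact: continuous_measurable_fun.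
rewrite (continuous_FTC2 (F := F) ab') //.
- exact: continuous_subspaceT.
- split.
  + by move=> t _; have [] := dF t.
  + by apply: cvg_at_right_filter; exact: cF.
  + by apply: cvg_at_left_filter; exact: cF.
- by move=> t _; rewrite derive1E; have := dF t => dFt; rewrite derive_val.
Qed.

Lemma Rint_indic_itv (a b : R) (f : R -> R) :
  \int[mu]_t (\1_(`[a, b[%classic : set T) t * f t) =
  fine (\int[mu]_(t in `[a, b[%classic) (f t)%:E)%E.
Proof.
rewrite -[RHS]/(\int[mu]_(t in `[a, b[%classic) f t) [RHS]Rintegral_mkcond.
apply: eq_Rintegral => t _; rewrite patchE indicE.
by case: (t \in _); rewrite ?mul1r ?mul0r.
Qed.

Lemma cosl_continuous (l : R) : continuous (fun t : R => cos (l * t)).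
Proof.
move=> t; apply: continuous_comp; last exact: continuous_cos.
by apply: cvgM; [exact: cvg_cst | exact: cvg_id].
Qed.

Lemma sinl_continuous (l : R) : continuous (fun t : R => sin (l * t)).
Proof.
move=> t; apply: continuous_comp; last exact: continuous_sin.
by apply: cvgM; [exact: cvg_cst | exact: cvg_id].
Qed.

Lemma mull_derive (l t : R) : is_derive t (1 : R) (fun x : R => l * x) l.
Proof.
have h := @is_deriveZ R R R id l t 1 1 (is_derive_id _ _).
by apply: (is_derive_eq h); rewrite /GRing.scale /= mulr1.
Qed.

Lemma sinl_derive (l t : R) : l != 0 ->
  is_derive t (1 : R) (fun x : R => l^-1 * sin (l * x)) (cos (l * t)).
Proof.
move=> l0.
have h1 := @is_derive1_comp R sin (fun x => l * x) t _ _ (is_derive_sin _) (mull_derive l t).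
have h2 := @is_deriveZ R R R _ l^-1 t 1 _ h1.
by apply: (is_derive_eq h2); rewrite /GRing.scale /=; field.
Qed.

Lemma cosl_derive (l t : R) : l != 0 ->
  is_derive t (1 : R) (fun x : R => (- l^-1) * cos (l * x)) (sin (l * t)).
Proof.
move=> l0.
have h1 := @is_derive1_comp R cos (fun x => l * x) t _ _ (is_derive_cos _) (mull_derive l t).
have h2 := @is_deriveZ R R R _ (- l^-1) t 1 _ h1.
by apply: (is_derive_eq h2); rewrite /GRing.scale /=; field.
Qed.

Lemma integral_cos (a b l : R) : a <= b ->
  \int[mu]_t (\1_(`[a, b[%classic : set T) t * cos (l * t)) = complex.Re (ihat a b l).
Proof.
move=> ab; rewrite Rint_indic_itv /ihat; case: eqP => [->|/eqP l0] /=.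
  have dF (t : R) : is_derive t (1 : R) id (cos (0 * t)).
    by rewrite mul0r cos0; exact: is_derive_id.
  by rewrite (FTC_itv ab (@cosl_continuous 0) (fun t => cos_max _) dF).
rewrite (FTC_itv ab (@cosl_continuous l) (fun t => cos_max _) (fun t => sinl_derive t l0)) /=.
by field.
Qed.

Lemma integral_sin (a b l : R) : a <= b ->
  \int[mu]_t (\1_(`[a, b[%classic : set T) t * sin (l * t)) = - complex.Im (ihat a b l).
Proof.
move=> ab; rewrite Rint_indic_itv /ihat; case: eqP => [->|/eqP l0] /=.
  have dF (t : R) : is_derive t (1 : R) (fun=> 0 : R) (sin (0 * t)).
    by rewrite mul0r sin0; exact: is_derive_cst.
  rewrite (FTC_itv ab (@sinl_continuous 0) (fun t => sin_max _) dF) /=.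
  by rewrite subrr oppr0.
rewrite (FTC_itv ab (@sinl_continuous l) (fun t => sin_max _) (fun t => cosl_derive t l0)) /=.
by field.
Qed.

End Integrals.

(** * Step functions inside an open set *)

Section StepIntegrals.
Local Open Scope complex_scope.
Variable R : realType.
Local Notation C := R[i].
Local Notation T := (lebesgueTypeR R).
Local Notation mu := (@completed_lebesgue_measure R : {measure set (lebesgueTypeR R) -> \bar R}).
Local Notation mesh := (@mesh R).
Local Notation node := (@node R).
Local Notation cellset := (@cellset R).
Implicit Types (f : nat -> R) (k : nat).

Lemma cell_pair_rint k j (phi : T -> R) : measurable_fun setT phi ->
  (forall t, `|phi t| <= 1) -> rint mu (fun t : T => \1_(cellset k j : set T) t * phi t).
Proof.
move=> mphi phi1; have mc := @cellset_Lmeasurable R k j.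
have fc : (mu (cellset k j) < +oo)%E by rewrite mu_cellset ltry.
apply: (@rint_le _ T R mu _ (\1_(cellset k j : set T)) _ (rint_indic mc fc)).
  by apply: measurable_funM => //; exact: measurable_indic.
move=> t; rewrite normrM indicE; case: (t \in _); last by rewrite normr0 mul0r.
by rewrite normr1 mul1r.
Qed.

Lemma Rint_rstep k f (phi : T -> R) : measurable_fun setT phi ->
  (forall t, `|phi t| <= 1) ->
  rint mu (fun t : T => rstep k f t * phi t) /\
  \int[mu]_t (rstep k f t * phi t) =
  \sum_(j < ncells k) f j * \int[mu]_t (\1_(cellset k j : set T) t * phi t).
Proof.
move=> mphi phi1; rewrite /rstep.
elim: (ncells k) => [|n [IH1 IH2]].
  have E (t : T) : (\sum_(j < 0) f j * \1_(cellset k j) t) * phi t = 0.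
    by rewrite big_ord0 mul0r.
  rewrite big_ord0; split.
    have := rint_comb 0 0 (cell_pair_rint k 0 mphi phi1) (cell_pair_rint k 0 mphi phi1).
    by apply: eq_integrable => // t _; rewrite /= E !mul0r addr0.
  by under eq_Rintegral do rewrite E; rewrite /Rintegral integral0.
have E (t : T) : (\sum_(j < n.+1) f j * \1_(cellset k j) t) * phi t =
   1 * ((\sum_(j < n) f j * \1_(cellset k j) t) * phi t) +
   f n * (\1_(cellset k n : set T) t * phi t).
  by rewrite big_ord_recr /=; ring.
have ci := cell_pair_rint k n mphi phi1.
split.
  have := rint_comb 1 (f n) IH1 ci.
  by apply: eq_integrable => // t _; rewrite /= E.
under eq_Rintegral do rewrite E.
by rewrite (Rint_comb _ _ IH1 ci) IH2 big_ord_recr /= mul1r.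
Qed.

Lemma Rint_cell k j : \int[mu]_t (\1_(cellset k j : set T) t * 1) = mesh k.
Proof.
under eq_Rintegral do rewrite mulr1.
have mc := @cellset_Lmeasurable R k j.
by rewrite (@Rint_indic _ T R mu _ mc) mu_cellset.
Qed.

Lemma Rint_rstep1 k f : rint mu (rstep k f : T -> R) /\
  \int[mu]_t rstep k f t = mesh k * \sum_(j < ncells k) f j.
Proof.
have [|t|h1 h2] := @Rint_rstep k f (fun=> 1); first exact: measurable_cst.
  by rewrite normr1.
split; first by apply: eq_integrable h1 => // t _; rewrite /= mulr1.
rewrite mulr_sumr -[LHS](_ : \int[mu]_t (rstep k f t * 1) = _); last first.
  by under eq_Rintegral do rewrite mulr1.
by rewrite h2; apply: eq_bigr => j _; rewrite Rint_cell mulrC.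
Qed.

Lemma rstep_Lmeasurable k f : measurable_fun setT (rstep k f : T -> R).
Proof.
apply: measurable_sum => j; apply: measurable_funM; first exact: measurable_cst.
by apply: measurable_indic; exact: (@cellset_Lmeasurable R).
Qed.

Lemma sqint_rstep k f :
  sqint mu (rstep k f : T -> R) = mesh k * \sum_(j < ncells k) f j ^+ 2.
Proof.
rewrite /sqint; under eq_Rintegral do rewrite rstep_sqr.
by have [_ ->] := Rint_rstep1 k (fun j => f j ^+ 2).
Qed.

Lemma rstep_l2 (U : set R) k f : supported U k f -> l2on mu (U : set T) (rstep k f).
Proof.
move=> sf; split; first exact: rstep_Lmeasurable.
  have [/integrableP[_]] := Rint_rstep1 k (fun j => f j ^+ 2); move=> h _.
  apply: le_lt_trans h; rewrite le_eqVlt; apply/orP; left; apply/eqP.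
  by apply: eq_integral => t _; rewrite /= -rstep_sqr ger0_norm ?sqr_ge0.
by move=> t nU; apply: rstep_supported sf nU.
Qed.

(** The Fourier transform of h1 + i h2 at l. *)
Definition fourier (h1 h2 : T -> R) (l : R) : C :=
  (\int[mu]_t (h1 t * cos (l * t)) + \int[mu]_t (h2 t * sin (l * t))) +i*
  (\int[mu]_t (h2 t * cos (l * t)) - \int[mu]_t (h1 t * sin (l * t))).

Lemma fourier_rstep k f1 f2 l :
  fourier (rstep k f1) (rstep k f2) l = hat k (fun j => f1 j +i* f2 j) l.
Proof.
have cN j : node k j <= node k j.+1 by rewrite nodeS lerDl ltW // mesh_gt0.
have Ec f : \int[mu]_t (rstep k f t * cos (l * t)) =
    \sum_(j < ncells k) f j * complex.Re (ihat (node k j) (node k j.+1) l).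
  have [_ ->] := Rint_rstep k f (@cos_Lmeasurable R l) (fun t => cos_max _).
  by apply: eq_bigr => j _; rewrite cellsetE integral_cos.
have Es f : \int[mu]_t (rstep k f t * sin (l * t)) =
    - \sum_(j < ncells k) f j * complex.Im (ihat (node k j) (node k j.+1) l).
  have [_ ->] := Rint_rstep k f (@sin_Lmeasurable R l) (fun t => sin_max _).
  by rewrite -sumrN; apply: eq_bigr => j _; rewrite cellsetE integral_sin // mulrN.
have reD (a b : C) : complex.Re (a + b) = complex.Re a + complex.Re b by case: a; case: b.
have imD (a b : C) : complex.Im (a + b) = complex.Im a + complex.Im b by case: a; case: b.
apply/eqP; rewrite eq_complex /fourier /hat !Ec !Es; apply/andP; split; apply/eqP.
  rewrite (big_morph _ reD (erefl _)) -sumrB; apply: eq_bigr => j _.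
  by case: (ihat _ _ _) => a b.
rewrite (big_morph _ imD (erefl _)) opprK -big_split; apply: eq_bigr => j _.
by case: (ihat _ _ _) => a b /=; rewrite addrC.
Qed.

Section OpenSet.
Local Open Scope complex_scope.
Variables (U : set R) (oU : open U) (finU : (mu U < +oo)%E).

Definition stepfun (g : T -> R) := exists k f, supported U k f /\ g = rstep k f.

Lemma stepfun_level g k : stepfun g -> exists2 p, (k <= p)%N &
  forall q, (p <= q)%N -> exists2 f, supported U q f & g = rstep q f.
Proof.
move=> [k' [f [sf ->]]]; exists (maxn k k'); first exact: leq_maxl.
move=> q; rewrite geq_max => /andP[_ kq].
exists (refines k' f (q - k')).
  by have := refines_supported (q - k') sf; rewrite subnKC.
have [bf _] := sf.
by have := rstep_refines (q - k') bf; rewrite subnKC.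
Qed.

Lemma stepfun2 g1 g2 : stepfun g1 -> stepfun g2 ->
  exists k f1 f2, [/\ supported U k f1, supported U k f2, g1 = rstep k f1 & g2 = rstep k f2].
Proof.
move=> /(stepfun_level 0)[p _ hp] /(stepfun_level p)[q pq hq].
have [f1 s1 e1] := hp q pq; have [f2 s2 e2] := hq q (leqnn q).
by exists q, f1, f2.
Qed.

Lemma stepfun_comb a b g1 g2 : stepfun g1 -> stepfun g2 ->
  stepfun (fun t => a * g1 t + b * g2 t).
Proof.
move=> h1 h2; have [k [f1 [f2 [[b1 s1] [b2 s2] -> ->]]]] := stepfun2 h1 h2.
exists k, (fun j => a * f1 j + b * f2 j); split; first split.
- by move=> j hj; rewrite b1 // b2 // !mulr0 addr0.
- move=> j; have [f10|f10] := eqVneq (f1 j) 0; last by move=> _; apply: s1; apply/eqP.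
  have [f20|f20] := eqVneq (f2 j) 0; last by move=> _; apply: s2; apply/eqP.
  by rewrite f10 f20 !mulr0 addr0.
apply/funext => t; rewrite /rstep !mulr_sumr -big_split; apply: eq_bigr => j _ /=.
by ring.
Qed.

Lemma stepfun0 : stepfun (fun=> 0).
Proof.
exists 0, (fun=> 0); split; first by split.
by apply/funext => t; rewrite /rstep big1 // => j _; rewrite mul0r.
Qed.

Lemma stepfun_l2 g : stepfun g -> l2on mu (U : set T) g.
Proof. by move=> [k [f [sf ->]]]; apply: rstep_l2. Qed.

Lemma inner_set_Lmeasurable (O : set R) k : measurable (inner_set O k : set T).
Proof.
apply/(@measurable_indicP _ T R); rewrite -rstep_inner; exact: rstep_Lmeasurable.
Qed.

Lemma mu_inner_set (O : set R) k : mu (inner_set O k) =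
  (mesh k * \sum_(j < ncells k) inner O k j)%:E.
Proof.
have [h1 h2] := Rint_rstep1 k (inner O k).
rewrite -h2 rstep_inner (@Rint_indic _ T R mu _ (@inner_set_Lmeasurable O k)).
rewrite fineK //.
have /integrableP[_] := h1; rewrite rstep_inner => h.
rewrite ge0_fin_numE //; apply: le_lt_trans h.
under eq_integral do rewrite /= ger0_norm ?indicE //.
by rewrite integral_indic ?setIT //; exact: inner_set_Lmeasurable.
Qed.

(** The inner cells of level k increase to O. *)
Lemma inner_set_exhaust (O : set R) (e : R) : open O -> (mu O < +oo)%E -> 0 < e ->
  exists k, (mu O <= mu (inner_set O k) + e%:E)%E.
Proof.
move=> oO fO e0.
have cv := @nondecreasing_cvg_mu _ T R mu (inner_set O) (@inner_set_Lmeasurable O) _ (@inner_set_mono R O).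
rewrite bigcup_inner_set // in cv.
have fo : mu O \is a fin_num by rewrite ge0_fin_numE.
have {}cv : (mu \o inner_set O) x @[x --> \oo] --> (fine (mu O))%:E.
  by rewrite fineK //; exact: cv (open_Lmeasurable oO).
have /fine_cvgP[_ /cvgrPdist_le/(_ e e0)[N _ hN]] := cv.
rewrite -(fineK fo).
exists N; have := hN N (leqnn N); rewrite /= mu_inner_set /= -EFinD lee_fin => h.
by have := le_trans (ler_norm _) h; lra.
Qed.

(** Outer regularity replaces A by an open set, and the inner cells exhaust the latter. *)
Lemma stepfun_indic (A : set T) (e : R) : measurable A -> A `<=` U -> 0 < e ->
  exists2 g, stepfun g & sqint mu (fun t => 1 * \1_A t + -1 * g t) <= e.
Proof.
move=> mA AU e0; have e2 : 0 < e / 2 by rewrite divr_gt0.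
have [ O [oO AO OA]] := @outer_measure_open_le R A _ e2.
pose W := O `&` U; have oW : open W by apply: openI.
have AW : A `<=` W by move=> t At; split; [apply: AO | apply: AU].
have mW := open_Lmeasurable oW.
have fW : (mu W < +oo)%E.
  apply: le_lt_trans finU; apply: le_measure; rewrite ?inE //; last by move=> t [].
  exact: open_Lmeasurable.
have fA : (mu A < +oo)%E by apply: le_lt_trans fW; apply: le_measure; rewrite ?inE.
have [k hk] := inner_set_exhaust oW fW e2.
set S := inner_set W k in hk.
have mS : measurable (S : set T) by exact: inner_set_Lmeasurable.
have SW : S `<=` W by exact: inner_set_sub.
have fS : (mu S < +oo)%E by apply: le_lt_trans fW; apply: le_measure; rewrite ?inE.
exists (rstep k (inner W k)).
  exists k, (inner W k); split => //; have [b1 b2] := inner_supported W k; split=> //.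
  by move=> j /b2 h t /h [].
rewrite rstep_inner -/S.
have WA : (mu (W `\` A) <= (e / 2)%:E)%E.
  rewrite measureD // ?setIidr //.
  have fin : mu A \is a fin_num by rewrite ge0_fin_numE.
  rewrite leeBlDl //; apply: le_trans OA.
  by apply: le_outer_measure; move=> t [].
have WS : (mu (W `\` S) <= (e / 2)%:E)%E.
  rewrite measureD // ?setIidr //.
  have fin : mu S \is a fin_num by rewrite ge0_fin_numE.
  by rewrite leeBlDl.
have mWA : measurable (W `\` A : set T) by exact: measurableD.
have mWS : measurable (W `\` S : set T) by exact: measurableD.
have fWA : (mu (W `\` A) < +oo)%E by apply: le_lt_trans WA _; rewrite ltry.
have fWS : (mu (W `\` S) < +oo)%E by apply: le_lt_trans WS _; rewrite ltry.
have iWA := rint_indic mWA fWA; have iWS := rint_indic mWS fWS.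
have muD := @Rint_indic _ T R mu.
apply: le_trans (_ : \int[mu]_t (1 * \1_(W `\` A) t + 1 * \1_(W `\` S) t) <= _).
  apply: Rint_le.
  - apply: l2_sqr (l2_comb 1 (-1) _ _); first exact: (l2_indic mW fW).
    by apply: (l2_indic mW fW).
  - exact: rint_comb.
  move=> t; rewrite !indicE !in_setD.
  have [tA|tA] := boolP (t \in A); have [tS|tS] := boolP (t \in S) => /=.
  - have -> : t \in W by rewrite inE; apply: SW; rewrite inE in tS.
    by rewrite /=; lra.
  - have -> : t \in W by rewrite inE; apply: AW; rewrite inE in tA.
    by rewrite /=; lra.
  - have -> : t \in W by rewrite inE; apply: SW; rewrite inE in tS.
    by rewrite /=; lra.
  - by case: (t \in W) => /=; lra.
rewrite Rint_comb // !muD // !mul1r.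
rewrite -[e](_ : e / 2 + e / 2 = e); last by field.
by apply: lerD; rewrite -lee_fin fineK // ge0_fin_numE.
Qed.

Lemma stepfun_dense h e : l2on mu (U : set T) h -> 0 < e ->
  exists2 g, stepfun g & sqint mu (fun t => 1 * h t + -1 * g t) <= e.
Proof.
move=> lh e0.
exact: (l2_density (open_Lmeasurable oU) finU stepfun_l2 stepfun0 stepfun_comb stepfun_indic lh e0).
Qed.

End OpenSet.

End StepIntegrals.

(** * Frequency sets for the levels of an open set *)

Section OpenLevels.
Local Open Scope complex_scope.
Variable R : realType.
Local Notation C := R[i].
Local Notation T := (lebesgueTypeR R).
Local Notation mu := (@completed_lebesgue_measure R : {measure set (lebesgueTypeR R) -> \bar R}).
Local Notation mesh := (@mesh R).
Local Notation node := (@node R).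
Local Notation cellset := (@cellset R).
Local Notation upper_const := (@upper_const R).

Definition inner_index (O : set R) k : {set 'I_(ncells k)} :=
  finset (fun j : 'I_(ncells k) => `[< cellset k j `<=` O >]).

Lemma mem_inner_index O k (j : 'I_(ncells k)) :
  (j \in inner_index O k) = `[< cellset k j `<=` O >].
Proof. by rewrite finset.inE. Qed.

Lemma sum_inner O k : \sum_(j < ncells k) inner O k j = #|inner_index O k|%:R :> R.
Proof.
rewrite -sumr_const [RHS]big_mkcond; apply: eq_bigr => j _.
by rewrite mem_inner_index /inner ltn_ord.
Qed.

Lemma mu_inner_card (O : set R) k : mu (inner_set O k) = (mesh k * #|inner_index O k|%:R)%:E.
Proof. by rewrite mu_inner_set sum_inner. Qed.

Lemma cellset_abs k j t : (j < ncells k)%N -> cellset k j t -> `|t| <= 2 ^+ k.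
Proof.
move=> jN /andP[t1 t2]; have h0 := mesh_gt0 R k.
have n0 : - 2 ^+ k <= node k j by rewrite /node lerDr mulr_ge0 // ltW.
have n1 : node k j.+1 <= 2 ^+ k.
  rewrite /node lerBlDr; have := ncells_mesh R k.
  have : (j.+1)%:R * mesh k <= (ncells k)%:R * mesh k by rewrite ler_pM2r // ler_nat.
  by lra.
by rewrite ler_norml; apply/andP; split; lra.
Qed.

Lemma inner_set_idem U k K : (k <= K)%N -> inner_set (inner_set U k) K = inner_set U k :> set R.
Proof.
move=> kK; apply/seteqP; split; first exact: inner_set_sub.
move=> t tW; have /subsetPset := @inner_set_mono R (inner_set U k) _ _ kK.
apply; case: tW => j jN [tj jU]; exists j => //; split=> // s sj.
by exists j.
Qed.

Lemma inner_index_node U k K (j : 'I_(ncells K)) :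
  j \in inner_index (inner_set U k) K -> `|node K j| <= 2 ^+ k.
Proof.
rewrite mem_inner_index => /asboolP h.
have [|i iN [ti _]] := h (node K j); last exact: cellset_abs ti.
by rewrite /cellset /= lexx nodeS ltrDl mesh_gt0.
Qed.

Lemma inner_indexS (O O' : set R) k : O `<=` O' -> inner_index O k \subset inner_index O' k.
Proof.
move=> OO; apply/fintype.subsetP => j; rewrite !mem_inner_index => /asboolP h; apply/asboolP.
exact: subset_trans h OO.
Qed.

(** The bound that [level_count] gives for the number of frequencies in a window. *)
Definition window_bound : nat := (Num.truncn (2 * upper_const / (cos 1 : R) ^+ 2)).+1.

Lemma le_window_bound n : n%:R * (cos 1 : R) ^+ 2 <= 2 * upper_const -> (n <= window_bound)%N.
Proof.
move=> h; have c1 := cos1_gt0 R; have c2 : 0 < (cos 1 : R) ^+ 2 by rewrite exprn_gt0.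
rewrite -ler_pdivlMr // in h.
have y0 : 0 <= 2 * upper_const / (cos 1 : R) ^+ 2 by apply: le_trans h.
have /andP[_ h2] := truncn_itv y0.
by rewrite -(ler_nat R) ltW // (le_lt_trans h).
Qed.

Lemma supported_sum (O : set R) k f (W : nmodType) (phi : nat -> C -> W) :
  supported O k f -> (forall i, phi i 0 = 0) ->
  \sum_(j < ncells k) phi j (f j) = \sum_(j in inner_index O k) phi j (f j).
Proof.
move=> [_ sf] phi0; rewrite [RHS]big_mkcond; apply: eq_bigr => j _.
rewrite mem_inner_index; case: asboolP => // h.
have [->|fj] := eqVneq (f j) 0; first by rewrite phi0.
by case: h; apply: sf; apply/eqP.
Qed.

Section Open.
Local Open Scope complex_scope.
Variables (U : set R) (oU : open U) (finU : (mu U < +oo)%E).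
Local Notation m := (fine (mu U)).
Hypothesis m0 : 0 < m.

(** Choose k0 so that the inner cells of level k0 carry half the measure of U. They lie
    between - 2^k0 and 2^k0, so that [level_count], applied to them at every later level,
    bounds the number of frequencies in the windows of length 2^-k0 uniformly in k. *)
Lemma level_open : exists k0, forall k, (k0 <= k)%N -> exists X : seq R, [/\ uniq X,
  (forall c, (count (fun x => window (2 ^+ k0)^-1 x == c) X <= window_bound)%N) &
  forall f : nat -> C, supported U k f ->
    (cos 1 / 2) ^+ 2 * (m / 2) * sqcoef k f <= \sum_(l <- X) sqmod (hat k f l)
      <= upper_const * m * sqcoef k f].
Proof.
have m2 : 0 < m / 2 by rewrite divr_gt0.
have [k0 hk0] := inner_set_exhaust oU finU m2.
exists k0 => k k0k; set W := inner_set U k0 in hk0 *.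
pose D := inner_index U k; pose D' := inner_index W k.
have h0 := mesh_gt0 R k.
have WU : W `<=` U by exact: inner_set_sub.
have mW : mu W = (mesh k * #|D'|%:R)%:E.
  by rewrite -mu_inner_card inner_set_idem.
have fU : mu U \is a fin_num by rewrite ge0_fin_numE.
have lW : m / 2 <= mesh k * #|D'|%:R.
  by move: hk0; rewrite mW -[X in (X <= _)%E](fineK fU) -EFinD lee_fin; lra.
have lU : mesh k * #|D|%:R <= m.
  have : (mu (inner_set U k) <= mu U)%E.
    apply: le_measure; rewrite ?inE; [exact: inner_set_Lmeasurable | exact: open_Lmeasurable|].
    exact: inner_set_sub.
  by rewrite mu_inner_card -[X in (_ <= X)%E](fineK fU) lee_fin.
have DD : D' \subset D by exact: inner_indexS.
have cD : (#|D'| <= #|D|)%N by exact: subset_leq_card.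
have cD0 : (0 < #|D'|)%N.
  by rewrite lt0n; apply/eqP => e; move: lW; rewrite e mulr0; lra.
have D'0 : D' != finset.set0 by rewrite -card_gt0.
have D0 : D != finset.set0 by rewrite -card_gt0 (leq_trans cD0).
have lD : mesh k * #|D'|%:R <= mesh k * #|D|%:R by rewrite ler_pM2l // ler_nat.
have S0 := ltW (upper_const_gt0 R).
have [X [uX hexp hX]] := @level_selection R k D D0; exists X; split=> //.
  move=> c; apply: le_window_bound.
  set n := count _ _.
  pose nu : R := window_left (2 ^+ k0)^-1 c.
  have r0 : (0 : R) < 2 ^+ k0 by rewrite exprn_gt0.
  have hc := @level_count R k D D' X (2 ^+ k0) nu r0 hexp DD D'0 (@inner_index_node U k0 k).
  have nn : (n <= count (fun l : R => `|l - nu| <= (2 ^+ k0)^-1)%R X)%N.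
    apply: sub_count => x /= /eqP xc.
    have r1 : (0 : R) < (2 ^+ k0)^-1 by rewrite invr_gt0.
    have /andP[x1 x2] := window_itv r1 xc.
    by rewrite -/nu in x1 x2; rewrite ler_norml; apply/andP; split; lra.
  have d0 : (0 : R) < #|D'|%:R by rewrite ltr0n.
  have d2 : (#|D|%:R : R) <= 2 * #|D'|%:R.
    by rewrite -(ler_pM2l h0) mulrCA; lra.
  rewrite -(ler_pM2r d0).
  apply: le_trans (_ : upper_const * #|D|%:R <= _); last first.
    by rewrite (mulrC 2) -(mulrA upper_const); apply: ler_wpM2l.
  apply: le_trans hc; rewrite ler_pM2r // ler_wpM2r ?sqr_ge0 // ler_nat; exact: nn.

move=> f sf.
have hE l : hat k f l = \sum_(j in D) f j * ihat (node k j) (node k j.+1) l.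
  by rewrite /hat (supported_sum (phi := fun i c => c * ihat (node k i) (node k i.+1) l) sf) // => i; rewrite mul0r.
have sE : \sum_(j < ncells k) sqmod (f j) = \sum_(j in D) sqmod (f j).
  by rewrite (supported_sum (phi := fun i c => sqmod c) sf) // => i; exact: sqmod0.
under eq_bigr do rewrite hE.
have /andP[h1 h2] := hX (fun j : 'I_(ncells k) => f j).
rewrite /sqcoef sE; set q := \sum_(j in D) sqmod _ in h1 h2 *.
have q0 : 0 <= mesh k * q.
  by rewrite mulr_ge0 ?(ltW h0) // sumr_ge0 // => j _; exact: sqmod_ge0.
have E : mesh k ^+ 2 * #|D|%:R * q = (mesh k * #|D|%:R) * (mesh k * q) by ring.
rewrite E in h1 h2; apply/andP; split.
  apply: le_trans h1; rewrite -mulrA ler_wpM2l ?sqr_ge0 //.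
  by rewrite ler_wpM2r //; lra.
apply: le_trans h2 _; rewrite -[leRHS]mulrA ler_wpM2l //.
by rewrite ler_wpM2r.
Qed.

End Open.
End OpenLevels.

(** * Frames for step functions *)

Section HatRegularity.
Local Open Scope complex_scope.
Variable R : realType.
Local Notation C := R[i].
Local Notation T := (lebesgueTypeR R).
Local Notation mu := (@completed_lebesgue_measure R : {measure set (lebesgueTypeR R) -> \bar R}).
Local Notation mesh := (@mesh R).
Local Notation node := (@node R).
Local Notation cellset := (@cellset R).

Lemma lipschitz_of_derive (f f' : R -> R) : (forall x, is_derive x (1 : R) f (f' x)) ->
  (forall x, `|f' x| <= 1) -> forall x y, `|f x - f y| <= `|x - y|.
Proof.
move=> df f1 x y; wlog yx : x y / y <= x.
  by move=> h; have [yx|/ltW xy] := leP y x; [exact: h | rewrite distrC (distrC x); exact: h].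
have [|c _ ->] := @MVT_segment R f f' y x yx (fun x _ => df x).
  apply: continuous_subspaceT => t.
  by apply/differentiable_continuous/derivable1_diffP; have [] := df t.
by rewrite normrM ler_piMl.
Qed.

(** The Lipschitz constant is the length 2^-k of the cell times the bound 2^k for its
    points. *)
Lemma cell_pair_lipschitz k j (c : R -> R) : (j < ncells k)%N ->
  (forall l, measurable_fun setT (fun t : T => c (l * t) : R)) -> (forall x, `|c x| <= 1) ->
  (forall x y, `|c x - c y| <= `|x - y|) -> forall l l',
  `|\int[mu]_t (\1_(cellset k j : set T) t * c (l * t)) -
    \int[mu]_t (\1_(cellset k j : set T) t * c (l' * t))| <= `|l - l'|.
Proof.
move=> jN mc c1 cL l l'.
have i1 := cell_pair_rint k j (mc l) (fun t => c1 (l * t)).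
have i2 := cell_pair_rint k j (mc l') (fun t => c1 (l' * t)).
rewrite -[X in `|X|](_ : 1 * (\int[mu]_t (\1_(cellset k j : set T) t * c (l * t))) +
   -1 * (\int[mu]_t (\1_(cellset k j : set T) t * c (l' * t))) = _); last by ring.
rewrite -Rint_comb //.
have i3 := rint_comb 1 (-1) i1 i2.
apply: le_trans (le_normr_Rintegral measurableT i3) _.
have mcell := @cellset_Lmeasurable R k j.
have fcell : (mu (cellset k j) < +oo)%E by rewrite mu_cellset ltry.
have ii := rint_indic mcell fcell.
apply: (@le_trans _ _ (\int[mu]_t (`|l - l'| * 2 ^+ k * \1_(cellset k j : set T) t + 0 * \1_(cellset k j : set T) t))).
  apply: Rint_le.
  - by have := i3; move=> /integrable_norm; apply: eq_integrable => // t _.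
  - exact: rint_comb.
  move=> t; rewrite mul0r addr0 mul1r mulN1r -mulrBr normrM.
  rewrite indicE; have [tj|tj] := boolP (t \in _); last by rewrite normr0 mul0r mulr0.
  rewrite normr1 mul1r mulr1; apply: le_trans (cL _ _) _.
  rewrite -mulrBl normrM ler_wpM2l //; apply: cellset_abs jN _.
  by rewrite inE in tj.
rewrite Rint_comb // (@Rint_indic _ T R mu _ mcell) mu_cellset /= mul0r addr0.
by rewrite -mulrA /mesh divff ?mulr1 // expf_neq0 // pnatr_eq0.
Qed.

Lemma lipschitz_continuous (f : R -> R) : (forall x y, `|f x - f y| <= `|x - y|) -> continuous f.
Proof.
move=> h x; apply/cvgrPdist_le => e e0; near=> y.
apply: le_trans (h x y) _; near: y.
by apply/nbhs_ballP; exists e => //= y; rewrite /ball /= => /ltW.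
Unshelve. all: by end_near. Qed.

Lemma ihat_node_continuous k j : (j < ncells k)%N ->
  continuous (fun l => complex.Re (ihat (node k j) (node k j.+1) l)) /\
  continuous (fun l => complex.Im (ihat (node k j) (node k j.+1) l)).
Proof.
move=> jN; have cN : node k j <= node k j.+1 by rewrite nodeS lerDl ltW // mesh_gt0.
split; apply: lipschitz_continuous => l l'.
  have := @cell_pair_lipschitz k j cos jN (@cos_Lmeasurable R) (@cos_max R) _ l l'.
  rewrite cellsetE !integral_cos //; apply.
  apply: lipschitz_of_derive (@is_derive_cos R) _ => x.
  by rewrite normrN sin_max.
have := @cell_pair_lipschitz k j sin jN (@sin_Lmeasurable R) (@sin_max R) _ l l'.
rewrite cellsetE !integral_sin // opprK -normrN opprD !opprK.
apply.
apply: lipschitz_of_derive (@is_derive_sin R) _ => x; exact: cos_max.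
Qed.

Lemma hat_continuous k f : continuous (fun l => sqmod (hat k f l) : R).
Proof.
have reD (a b : C) : complex.Re (a + b) = complex.Re a + complex.Re b by case: a; case: b.
have imD (a b : C) : complex.Im (a + b) = complex.Im a + complex.Im b by case: a; case: b.
have cs (F : 'I_(ncells k) -> R -> R) : (forall i, continuous (F i)) ->
    continuous (fun l => \sum_j F j l).
  by move=> cF l; apply: (cvg_big add_continuous) => j _; exact: cF.
have cre : continuous (fun l => complex.Re (hat k f l)).
  have -> : (fun l => complex.Re (hat k f l)) = (fun l => \sum_(j < ncells k)
      (complex.Re (f j) * complex.Re (ihat (node k j) (node k j.+1) l) -
       complex.Im (f j) * complex.Im (ihat (node k j) (node k j.+1) l))).
    apply/funext => l; rewrite /hat (big_morph _ reD (erefl _)); apply: eq_bigr => j _.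
    by case: (f j) => a b; case: (ihat _ _ _).
  apply: cs => j l; have [h1 h2] := ihat_node_continuous (ltn_ord j).
  by apply: cvgB; apply: cvgM; [exact: cvg_cst | exact: h1 | exact: cvg_cst | exact: h2].
have cim : continuous (fun l => complex.Im (hat k f l)).
  have -> : (fun l => complex.Im (hat k f l)) = (fun l => \sum_(j < ncells k)
      (complex.Re (f j) * complex.Im (ihat (node k j) (node k j.+1) l) +
       complex.Im (f j) * complex.Re (ihat (node k j) (node k j.+1) l))).
    apply/funext => l; rewrite /hat (big_morph _ imD (erefl _)); apply: eq_bigr => j _.
    by case: (f j) => a b; case: (ihat _ _ _).
  apply: cs => j l; have [h1 h2] := ihat_node_continuous (ltn_ord j).
  by apply: cvgD; apply: cvgM; [exact: cvg_cst | exact: h2 | exact: cvg_cst | exact: h1].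
move=> l; rewrite /sqmod; apply: cvgD; rewrite /= expr2.
  by apply: cvgM; exact: cre.
by apply: cvgM; exact: cim.
Qed.

Lemma sqmodD (a b : C) : sqmod (a + b) <= 2 * sqmod a + 2 * sqmod b.
Proof.
case: a => a1 a2; case: b => b1 b2; rewrite /sqmod /=.
have := sqr_ge0 (a1 - b1); have := sqr_ge0 (a2 - b2); rewrite !expr2.
by set x1 := a1 * b1; lra.
Qed.

Lemma hat_decay k f : exists2 K, 0 <= K & forall l : R, sqmod (hat k f l) * l ^+ 2 <= K.
Proof.
rewrite /hat; elim: (ncells k) => [|n [K K0 IH]].
  by exists 0 => // l; rewrite big_ord0 sqmod0 mul0r.
exists (2 * K + 2 * (sqmod (f n) * 8)).
  by rewrite addr_ge0 // mulr_ge0 // mulr_ge0 // sqmod_ge0.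
move=> l; rewrite big_ord_recr /=.
apply: (le_trans (ler_wpM2r (sqr_ge0 l) (sqmodD _ _))).
rewrite mulrDl; apply: lerD; rewrite -mulrA ler_wpM2l // sqmodM -mulrA.
by rewrite ler_wpM2l ?sqmod_ge0 // ihat_decay.
Qed.

(** The factors come from the transform of a cell, from the cells that fit inside U,
    and from the limit points that may have merged. *)
Definition lower_const : R := (cos 1 / 2) ^+ 2 / 2 / (4 * window_bound R)%:R.

Lemma lower_const_gt0 : 0 < lower_const.
Proof.
by rewrite /lower_const !divr_gt0 ?ltr0n ?exprn_gt0 ?divr_gt0 ?cos1_gt0.
Qed.

(** A step function keeps its transform and its norm when it is refined, so the bounds
    for one step function hold at all later levels and pass to the limit set. *)
Lemma step_frame (U : set R) : open U -> (mu U < +oo)%E -> 0 < fine (mu U) ->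
  exists2 L : set R, limit_point L = set0 & forall k f, supported U k f ->
    exists r : R, [/\ (\esum_(l in L) (sqmod (hat k f l))%:E = r%:E)%E,
      lower_const * fine (mu U) * sqcoef k f <= r & r <= upper_const R * fine (mu U) * sqcoef k f].
Proof.
move=> oU finU m0; set m := fine _ in m0 *.
have [k0 hk0] := level_open oU finU m0.
have eta0 : 0 < (2 ^+ k0)^-1 :> R by rewrite invr_gt0 exprn_gt0.
have /choice[Y hY] : forall k, exists X : seq R, [/\ uniq X,
    (forall c, (count (fun x => window (2 ^+ k0)^-1 x == c) X <= window_bound R)%N) &
    (k0 <= k)%N -> forall f, supported U k f ->
    (cos 1 / 2) ^+ 2 * (m / 2) * sqcoef k f <= \sum_(l <- X) sqmod (hat k f l)
      <= upper_const R * m * sqcoef k f].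
  move=> k; have [kk|kk] := leqP k0 k; last by exists [::].
  by have [X [h1 h2 h3]] := hk0 k kk; exists X.
have uY k : uniq (Y k) by have [] := hY k.
have nY k c : (count (fun x => window (2 ^+ k0)^-1 x == c) (Y k) <= window_bound R)%N.
  by have [] := hY k.
exists (limit_set Y (window_bound R) eta0); first exact: limit_set_discrete.
move=> k f sf; have [K K0 hK] := hat_decay k f.
have [|r [r1 r2 r3]] := @limit_set_sum R Y (2 ^+ k0)^-1 (window_bound R) eta0 uY nY
  (fun l => sqmod (hat k f l)) ((cos 1 / 2) ^+ 2 * (m / 2) * sqcoef k f)
  (upper_const R * m * sqcoef k f) K (maxn k k0) (@hat_continuous k f) (fun l => sqmod_ge0 _) K0 hK.
  move=> p; rewrite geq_max => /andP[kp k0p].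
  have [_ _ /(_ k0p (refines k f (p - k)))] := hY p.
  have /= := refines_supported (p - k) sf; rewrite subnKC // => sp /(_ sp).
  have [bf _] := sf.
  have := sqcoef_refines (p - k) bf; rewrite subnKC // => ->.
  under eq_bigr => l _ do (have := hat_refines (p - k) l bf; rewrite subnKC // => ->).
  by [].
exists r; split=> //.
have B0 : 0 < (4 * window_bound R)%:R :> R by rewrite ltr0n.
rewrite -(ler_pM2l B0); apply: le_trans r3; rewrite le_eqVlt; apply/orP; left; apply/eqP.
by rewrite /lower_const; field; rewrite gt_eqF.
Qed.

End HatRegularity.

(** * From step functions to square integrable functions *)

Lemma le_of_approx (R : realFieldType) (x y K : R) : 0 <= K ->
  (forall e, 0 < e -> x <= y + K * e) -> x <= y.
Proof.
move=> K0 h; rewrite leNgt; apply/negP => yx.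
have e0 : 0 < (x - y) / (2 * (K + 1)) by rewrite divr_gt0 ?subr_gt0 // mulr_gt0 // ltr_wpDl.
have := h _ e0.
have -> : K * ((x - y) / (2 * (K + 1))) = (x - y) / 2 * (K / (K + 1)).
  by field; rewrite gt_eqF // ltr_wpDl.
have : K / (K + 1) <= 1 by rewrite ler_pdivrMr ?ltr_wpDl // mul1r lerDl.
by nra.
Qed.

Section FiniteSums.
Local Open Scope complex_scope.
Variables (R : realType) (I : choiceType) (L : set I).
Implicit Types g : I -> R.

Lemma esum_leP g (c : R) :
  (\esum_(x in L) (g x)%:E <= c%:E)%E <->
  (forall s : seq I, uniq s -> (forall x, x \in s -> L x) -> \sum_(x <- s) g x <= c).
Proof.
split=> [h s us sL|h].
  rewrite -lee_fin; apply: le_trans h; apply: esum_ge; exists [set` s].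
    by split; [exact: finite_seq | move=> x /= /sL].
  rewrite fsumEFin; last exact: finite_seq.
  by rewrite lee_fin fsbig_seq.
apply: ge_ereal_sup => _ [A [finA AL] <-].
rewrite fsumEFin // lee_fin fsbig_finite //; apply: h => //.
by move=> x; rewrite in_fset_set // inE => /AL.
Qed.

End FiniteSums.

Section OpenFrame.
Local Open Scope complex_scope.
Variable R : realType.
Local Notation C := R[i].
Local Notation T := (lebesgueTypeR R).
Local Notation mu := (@completed_lebesgue_measure R : {measure set (lebesgueTypeR R) -> \bar R}).
Variables (U : set R) (oU : open U) (finU : (mu U < +oo)%E).
Local Notation m := (fine (mu U)).
Implicit Types h g : T -> R.

Lemma fourier_comb a b h1 h2 g1 g2 l : l2on mu (U : set T) h1 -> l2on mu (U : set T) h2 ->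
  l2on mu (U : set T) g1 -> l2on mu (U : set T) g2 ->
  fourier (fun t => a * h1 t + b * g1 t) (fun t => a * h2 t + b * g2 t) l =
  a%:C * fourier h1 h2 l + b%:C * fourier g1 g2 l.
Proof.
move=> lh1 lh2 lg1 lg2.
have mU := open_Lmeasurable oU.
have key (phi : T -> R) : measurable_fun setT phi -> (forall t, `|phi t| <= 1) ->
  forall h g, l2on mu (U : set T) h -> l2on mu (U : set T) g ->
  \int[mu]_t ((a * h t + b * g t) * phi t) =
  a * (\int[mu]_t (h t * phi t)) + b * (\int[mu]_t (g t * phi t)).
  move=> mphi phi1 h g lh lg.
  rewrite -Rint_comb; try exact: l2_pair_rint.
  by apply: eq_Rintegral => t _; ring.
have kc := key _ (@cos_Lmeasurable R l) (fun t => cos_max _).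
have ks := key _ (@sin_Lmeasurable R l) (fun t => sin_max _).
rewrite /fourier !kc // !ks //.
by apply/eqP; rewrite eq_complex /=; apply/andP; split; apply/eqP; ring.
Qed.

Lemma fourier_bound h1 h2 l : l2on mu (U : set T) h1 -> l2on mu (U : set T) h2 ->
  sqmod (fourier h1 h2 l) <= 4 * m * (sqint mu h1 + sqint mu h2).
Proof.
move=> lh1 lh2; have mU := open_Lmeasurable oU.
have kc h (lh : l2on mu (U : set T) h) :=
  l2_pair_sqr mU finU lh (@cos_Lmeasurable R l) (fun t => cos_max _).
have ks h (lh : l2on mu (U : set T) h) :=
  l2_pair_sqr mU finU lh (@sin_Lmeasurable R l) (fun t => sin_max _).
have := kc _ lh1; have := kc _ lh2; have := ks _ lh1; have := ks _ lh2.
rewrite /sqmod /fourier /=.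
set c1 := \int[mu]_t (h1 t * cos _); set c2 := \int[mu]_t (h2 t * cos _).
set s1 := \int[mu]_t (h1 t * sin _); set s2 := \int[mu]_t (h2 t * sin _).
set q1 := sqint _ h1; set q2 := sqint _ h2; clearbody c1 c2 s1 s2 q1 q2.
set M := fine _; clearbody M => e1 e2 e3 e4.
have := sqr_ge0 (c1 - s2); have := sqr_ge0 (c2 + s1).
by nra.
Qed.

Lemma step_approx h1 h2 e : l2on mu (U : set T) h1 -> l2on mu (U : set T) h2 -> 0 < e ->
  exists k f1 f2, [/\ supported U k f1, supported U k f2 &
    sqint mu (fun t => 1 * h1 t + -1 * rstep k f1 t) +
    sqint mu (fun t => 1 * h2 t + -1 * rstep k f2 t) <= e].
Proof.
move=> lh1 lh2 e0; have e2 : 0 < e / 2 by rewrite divr_gt0.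
have [g1 sg1 d1] := stepfun_dense oU finU lh1 e2.
have [g2 sg2 d2] := stepfun_dense oU finU lh2 e2.
have [k [f1 [f2 [s1 s2 E1 E2]]]] := stepfun2 sg1 sg2.
by exists k, f1, f2; split=> //; rewrite -E1 -E2; lra.
Qed.

Variables (L : set R) (lo up : R).
Hypotheses (lo0 : 0 <= lo) (up0 : 0 <= up).
Hypothesis hL : forall k f, supported U k f ->
    exists r : R, [/\ (\esum_(l in L) (sqmod (hat k f l))%:E = r%:E)%E,
      lo * sqcoef k f <= r & r <= up * sqcoef k f].

Lemma step_pair k f1 f2 : supported U k f1 -> supported U k f2 ->
  exists r : R, [/\ (\esum_(l in L) (sqmod (fourier (rstep k f1) (rstep k f2) l))%:E = r%:E)%E,
      lo * (sqint mu (rstep k f1 : T -> R) + sqint mu (rstep k f2 : T -> R)) <= r &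
      r <= up * (sqint mu (rstep k f1 : T -> R) + sqint mu (rstep k f2 : T -> R))].
Proof.
move=> [b1 s1] [b2 s2].
have sf : supported U k (fun j => f1 j +i* f2 j).
  split=> [j jN|j]; first by rewrite b1 // b2.
  have [f10|/eqP f10] := eqVneq (f1 j) 0; last by move=> _; apply: s1.
  have [f20|/eqP f20] := eqVneq (f2 j) 0; last by move=> _; apply: s2.
  by rewrite f10 f20.
have [r [r1 r2 r3]] := hL sf.
have E : sqcoef k (fun j => f1 j +i* f2 j) =
    sqint mu (rstep k f1 : T -> R) + sqint mu (rstep k f2 : T -> R).
  by rewrite !sqint_rstep -mulrDr -big_split.
exists r; rewrite -E; split=> //; rewrite -r1; apply: eq_esum => l _.
by rewrite fourier_rstep.
Qed.

Lemma sqmod_split (a b : C) : sqmod a <= 2 * sqmod b + 2 * sqmod (a - b).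
Proof. by have := sqmodD b (a - b); rewrite addrC subrK. Qed.

(** A finite partial sum depends continuously on the function, since
    [fourier_bound] controls each term by the L^2 norm. *)
Lemma fourier_upper h1 h2 : l2on mu (U : set T) h1 -> l2on mu (U : set T) h2 ->
  (\esum_(l in L) (sqmod (fourier h1 h2 l))%:E <=
    (4 * up * (sqint mu h1 + sqint mu h2))%:E)%E.
Proof.
move=> lh1 lh2; apply/esum_leP => s us sL.
set E := sqint mu h1 + sqint mu h2; have m0 : 0 <= m by exact: fine_ge0.
apply: (@le_of_approx _ _ _ (4 * up + (size s)%:R * (8 * m))).
  by rewrite addr_ge0 ?mulr_ge0 //.
move=> e e0; have [k [f1 [f2 [s1 s2 de]]]] := step_approx lh1 lh2 e0.
have l1 := rstep_l2 s1; have l2 := rstep_l2 s2.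
have ld1 := l2_comb 1 (-1) lh1 l1; have ld2 := l2_comb 1 (-1) lh2 l2.
set g1 := rstep k f1 in l1 ld1 de; set g2 := rstep k f2 in l2 ld2 de.
have [r [r1 _ r3]] := step_pair s1 s2.
have [hs _] := @esum_leP R R L (fun l => sqmod (fourier g1 g2 l)) r.
have {}hs : \sum_(l <- s) sqmod (fourier g1 g2 l) <= r by apply: hs => //; rewrite r1.
have gE : sqint mu (g1 : T -> R) + sqint mu (g2 : T -> R) <= 2 * E + 2 * e.
  have b1 := sqint_comb 1 (-1) lh1 ld1; have b2 := sqint_comb 1 (-1) lh2 ld2.
  have e1 (h g : T -> R) : (fun t => 1 * h t + -1 * (1 * h t + -1 * g t)) = g.
    by apply/funext => t; ring.
  rewrite !e1 in b1 b2; rewrite /E.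
  move: b1 b2 de; set q1 := sqint mu (fun t => 1 * h1 t + _).
  set q2 := sqint mu (fun t => 1 * h2 t + _) => b1 b2 de; lra.
have hd : \sum_(l <- s) sqmod (fourier h1 h2 l - fourier g1 g2 l) <= (size s)%:R * (4 * m * e).
  have -> : (size s)%:R * (4 * m * e) = \sum_(l <- s) (4 * m * e).
    by rewrite big_const_seq count_predT iter_addr_0 mulr_natl.
  apply: ler_sum => l _.
  have := fourier_bound l ld1 ld2; rewrite fourier_comb // rmorphN1 rmorph1 mul1r mulN1r.
  move/le_trans; apply; by rewrite ler_wpM2l // mulr_ge0.
apply: le_trans (_ : 2 * r + 2 * ((size s)%:R * (4 * m * e)) <= _).
  apply: le_trans (_ : \sum_(l <- s) (2 * sqmod (fourier g1 g2 l) +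
    2 * sqmod (fourier h1 h2 l - fourier g1 g2 l)) <= _).
    by apply: ler_sum => l _; exact: sqmod_split.
  by rewrite big_split /= -!mulr_sumr; apply: lerD; rewrite ler_pM2l.
have h4 : 2 * r <= 2 * (up * (2 * E + 2 * e)).
  by rewrite ler_pM2l //; apply: le_trans r3 _; rewrite ler_wpM2l.
rewrite [leRHS](_ : _ = 2 * (up * (2 * E + 2 * e)) + 2 * ((size s)%:R * (4 * m * e))).
  by rewrite lerD2r.
by ring.
Qed.

(** The infinite sum for the error of approximation is controlled by [fourier_upper]. *)
Lemma fourier_lower h1 h2 : l2on mu (U : set T) h1 -> l2on mu (U : set T) h2 ->
  ((lo / 4 * (sqint mu h1 + sqint mu h2))%:E <=
    \esum_(l in L) (sqmod (fourier h1 h2 l))%:E)%E.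
Proof.
move=> lh1 lh2; set E := sqint mu h1 + sqint mu h2.
have fin g1 g2 : l2on mu (U : set T) g1 -> l2on mu (U : set T) g2 -> exists2 r : R,
    (\esum_(l in L) (sqmod (fourier g1 g2 l))%:E = r%:E)%E &
    r <= 4 * up * (sqint mu g1 + sqint mu g2).
  move=> lg1 lg2; have hu := fourier_upper lg1 lg2.
  have h0 : (0 <= \esum_(l in L) (sqmod (fourier g1 g2 l))%:E)%E.
    by apply: esum_ge0 => l _; rewrite lee_fin sqmod_ge0.
  have ff : (\esum_(l in L) (sqmod (fourier g1 g2 l))%:E)%E \is a fin_num.
    by rewrite ge0_fin_numE //; apply: le_lt_trans hu (ltry _).
  by exists (fine (\esum_(l in L) (sqmod (fourier g1 g2 l))%:E)%E); rewrite -?lee_fin fineK.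
have [r rE _] := fin _ _ lh1 lh2; rewrite rE lee_fin.
apply: (@le_of_approx _ _ _ (4 * up + lo / 2)).
  by rewrite addr_ge0 ?mulr_ge0 ?divr_ge0.
move=> e e0; have [k [f1 [f2 [s1 s2 de]]]] := step_approx lh1 lh2 e0.
have l1 := rstep_l2 s1; have l2 := rstep_l2 s2.
have ld1 := l2_comb 1 (-1) lh1 l1; have ld2 := l2_comb 1 (-1) lh2 l2.
have [q [qE q1 _]] := step_pair s1 s2.
set g1 := rstep k f1 in l1 ld1 de qE q1; set g2 := rstep k f2 in l2 ld2 de qE q1.
have [d dE d1] := fin _ _ ld1 ld2.
have gE : E <= 2 * (sqint mu (g1 : T -> R) + sqint mu (g2 : T -> R)) + 2 * e.
  have b1 := sqint_comb 1 1 l1 ld1; have b2 := sqint_comb 1 1 l2 ld2.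
  have e1 (h g : T -> R) : (fun t => 1 * g t + 1 * (1 * h t + -1 * g t)) = h.
    by apply/funext => t; ring.
  rewrite !e1 in b1 b2; rewrite /E.
  move: b1 b2 de; set x1 := sqint mu (fun t => 1 * h1 t + _).
  set x2 := sqint mu (fun t => 1 * h2 t + _) => b1 b2 de; lra.
have qr : q <= 2 * r + 2 * d.
  rewrite -lee_fin -qE.
  apply: le_trans (_ : (\esum_(l in L) (((sqmod (fourier h1 h2 l))%:E +
    (sqmod (fourier h1 h2 l))%:E) + ((sqmod (fourier (fun t => 1 * h1 t + -1 * g1 t)
    (fun t => 1 * h2 t + -1 * g2 t) l))%:E + (sqmod (fourier (fun t => 1 * h1 t + -1 * g1 t)
    (fun t => 1 * h2 t + -1 * g2 t) l))%:E)) <= _)%E).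
    apply: le_esum => l _; rewrite -!EFinD lee_fin fourier_comb //.
    rewrite rmorphN1 rmorph1 mul1r mulN1r.
    set x := fourier h1 h2 l; set y := fourier g1 g2 l.
    have := sqmod_split y x; rewrite -(sqmodN (y - x)) opprB.
    by set X := sqmod x; set Y := sqmod (x - y); lra.
  have n0 (a b : R -> R) l : L l -> (0 <= (sqmod (fourier a b l))%:E)%E.
    by move=> _; rewrite lee_fin sqmod_ge0.
  rewrite esumD; [|by move=> l Ll; rewrite adde_ge0 // n0..].
  rewrite esumD; [|by move=> l Ll; rewrite n0..].
  rewrite esumD; [|by move=> l Ll; rewrite n0..].
  by rewrite rE dE -!EFinD lee_fin; lra.
have d2 : d <= 4 * up * e.
  by apply: le_trans d1 _; rewrite ler_wpM2l // mulr_ge0.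
have h4 : lo * E <= lo * (2 * (sqint mu (g1 : T -> R) + sqint mu (g2 : T -> R)) + 2 * e).
  by rewrite ler_wpM2l.
move: q1 h4; set Q := sqint _ _ + sqint _ _ => q1 h4.
lra.
Qed.

End OpenFrame.

(** * From an open set to a measurable subset *)

Section Transfer.
Local Open Scope complex_scope.
Variable R : realType.
Local Notation C := R[i].
Local Notation T := (lebesgueTypeR R).
Local Notation mu := (@completed_lebesgue_measure R : {measure set (lebesgueTypeR R) -> \bar R}).
Local Notation normc := ComplexField.Normc.normc.

Lemma normc_sqr (z : C) : normc z ^+ 2 = sqmod z.
Proof. by case: z => a b; rewrite /= sqr_sqrtr // addr_ge0 ?sqr_ge0. Qed.

Lemma expsys_cis (l t : R) : expsys l t = cis (l * t).
Proof. by []. Qed.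

Variables (S U : set R) (mS : Lmeasurable S) (finS : (Lmeasure S < +oo)%E).
Hypotheses (oU : open U) (SU : S `<=` U) (finU : (mu U < +oo)%E).

Lemma inL2_expsys (l : R) : inL2 S (@expsys R l).
Proof.
split; [exact: measurable_funTS (@cos_Lmeasurable R l) |
        exact: measurable_funTS (@sin_Lmeasurable R l) |].
under eq_integral do rewrite normc_sqr expsys_cis sqmod_cis.
by rewrite (@integral_cst _ T R mu S mS) mul1e.
Qed.

Definition on_set (f : R -> R) : T -> R := (f : T -> R) \_ (S : set T).

Lemma on_setE f t : on_set f t = if t \in S then f t else 0.
Proof. by rewrite /on_set patchE. Qed.

Variable F : R -> C.
Hypothesis hF : inL2 S F.
Local Notation F1 := (on_set (fun t => complex.Re (F t))).
Local Notation F2 := (on_set (fun t => complex.Im (F t))).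

Lemma on_set_l2 (f : R -> R) : Lmeasurable_fun S f ->
  (forall t, f t ^+ 2 <= sqmod (F t)) -> l2on mu (U : set T) (on_set f).
Proof.
move=> mf fF; have [mRe mIm iF] := hF.
have mf' : measurable_fun setT (on_set f) by apply/(measurable_restrictT _ mS).
split=> //; last by move=> t nU; rewrite on_setE memNset // => /SU.
apply: le_lt_trans iF.
rewrite [leRHS]integral_mkcond; apply: (@ge0_le_integral _ T R mu).
- exact: measurableT.
- by move=> t _; rewrite lee_fin sqr_ge0.
- by apply/measurable_EFinP; apply: measurable_funX.
- apply/(measurable_restrictT _ mS)/measurable_EFinP.
  under eq_fun do rewrite normc_sqr /sqmod.
  by apply: measurable_funD; apply: measurable_funX.
move=> t _; rewrite on_setE patchE normc_sqr; case: ifP => _; rewrite lee_fin //.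
by rewrite expr0n.
Qed.

Lemma F1_l2 : l2on mu (U : set T) F1.
Proof.
by have [mRe _ _] := hF; apply: on_set_l2 => // t; rewrite /sqmod lerDl sqr_ge0.
Qed.

Lemma F2_l2 : l2on mu (U : set T) F2.
Proof.
by have [_ mIm _] := hF; apply: on_set_l2 => // t; rewrite /sqmod lerDr sqr_ge0.
Qed.

Lemma L2norm_sqint : L2norm S F ^+ 2 = sqint mu F1 + sqint mu F2.
Proof.
rewrite /L2norm sqr_sqrtr; last by apply: Rintegral_ge0 => t _; exact: sqr_ge0.
rewrite -[RHS](_ : 1 * sqint mu F1 + 1 * sqint mu F2 = _); last by rewrite !mul1r.
rewrite /sqint -Rint_comb; [|exact: l2_sqr F1_l2|exact: l2_sqr F2_l2].
rewrite Rintegral_mkcond; apply: eq_Rintegral => t _.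
rewrite patchE normc_sqr !on_setE; case: ifP => _; rewrite !mul1r //.
by rewrite expr0n addr0.
Qed.

Lemma L2dot_fourier (l : R) : L2dot S F (@expsys R l) = fourier F1 F2 l.
Proof.
have mU := open_Lmeasurable oU.
have c1 := l2_pair_rint mU finU F1_l2 (@cos_Lmeasurable R l) (fun t => cos_max _).
have c2 := l2_pair_rint mU finU F2_l2 (@cos_Lmeasurable R l) (fun t => cos_max _).
have s1 := l2_pair_rint mU finU F1_l2 (@sin_Lmeasurable R l) (fun t => sin_max _).
have s2 := l2_pair_rint mU finU F2_l2 (@sin_Lmeasurable R l) (fun t => sin_max _).
rewrite /L2dot /cintegral /fourier; congr (_ +i* _).
  rewrite -[RHS](_ : 1 * (\int[mu]_t (F1 t * cos (l * t))) +
     1 * (\int[mu]_t (F2 t * sin (l * t))) = _); last by rewrite !mul1r.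
  rewrite -Rint_comb // Rintegral_mkcond; apply: eq_Rintegral => t _.
  rewrite patchE !on_setE; case: ifP => _; last by rewrite !mul0r !mulr0 addr0.
  by case: (F t) => a b /=; ring.
rewrite -[RHS](_ : 1 * (\int[mu]_t (F2 t * cos (l * t))) +
     -1 * (\int[mu]_t (F1 t * sin (l * t))) = _); last by rewrite mul1r mulN1r.
rewrite -Rint_comb // Rintegral_mkcond; apply: eq_Rintegral => t _.
rewrite patchE !on_setE; case: ifP => _; last by rewrite !mul0r !mulr0 addr0.
by case: (F t) => a b /=; ring.
Qed.

End Transfer.

Theorem theorem1 (R : realType) :
  exists c C : R,
    [/\ 0 < c, 0 < C &
        forall S : set R, Lmeasurable S ->
          (0 < Lmeasure S)%E -> (Lmeasure S < +oo)%E ->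
          exists Lambda : set R,
            discrete_set Lambda /\
            L2frame S Lambda (@expsys R)
              (c * fine (Lmeasure S)) (C * fine (Lmeasure S))].
Proof.
have c0 := lower_const_gt0 R; have C0 := upper_const_gt0 R.
exists (lower_const R / 4), (8 * upper_const R).
split; [exact: divr_gt0 | exact: mulr_gt0 |].
move=> S mS S0 finS; set s := fine (Lmeasure S).
have s0 : 0 < s by rewrite fine_gt0 // S0 finS.
have fS : Lmeasure S \is a fin_num by rewrite fin_numElt finS (lt_trans _ S0).
have [U [oU SU US]] := @outer_measure_open_le R S _ s0.
pose mu : {measure set (lebesgueTypeR R) -> \bar R} := @completed_lebesgue_measure R.
have US' : (mu U <= Lmeasure S + s%:E)%E by exact: US.
have finU : (mu U < +oo)%E by apply: le_lt_trans US' _; rewrite -(fineK fS) -EFinD ltry.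
have fU : mu U \is a fin_num by rewrite ge0_fin_numE.
have sm : s <= fine (mu U).
  rewrite -lee_fin !fineK //.
  by apply: (@le_measure _ _ _ mu); rewrite ?inE //; exact: open_Lmeasurable.
have ms : fine (mu U) <= 2 * s.
  rewrite -lee_fin fineK //; apply: le_trans US' _.
  by rewrite -(fineK fS) -EFinD lee_fin -/s; lra.
have m0 : 0 < fine (mu U) by apply: lt_le_trans sm.
have [L dL hL] := step_frame oU finU m0.
exists L; split; first exact: dL.
have c1 : 0 < lower_const R / 4 * s by apply: mulr_gt0 => //; apply: divr_gt0.
have C1 : 0 < 8 * upper_const R * s by apply: mulr_gt0 => //; apply: mulr_gt0.
split; [exact: c1 | exact: C1 | |].
  by move=> l _; exact: inL2_expsys.
move=> F hF.
have l1 := F1_l2 mS SU hF; have l2 := F2_l2 mS SU hF.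
have -> : (\esum_(j in L) ((ComplexField.Normc.normc (L2dot S F (expsys j))) ^+ 2)%:E =
   \esum_(j in L) (sqmod (fourier (on_set S (fun t => complex.Re (F t)))
     (on_set S (fun t => complex.Im (F t))) j))%:E)%E.
  by apply: eq_esum => l _; rewrite normc_sqr (L2dot_fourier mS oU SU finU hF).
rewrite (L2norm_sqint mS SU hF); set E := sqint _ _ + sqint _ _.
have E0 : 0 <= E by rewrite addr_ge0 // sqint_ge0.
have lo0 := ltW (mulr_gt0 c0 m0); have up0 := ltW (mulr_gt0 C0 m0).
apply/andP; split.
  have hl := fourier_lower oU finU lo0 up0 hL l1 l2; apply: le_trans hl.
  rewrite lee_fin -/E; apply: ler_wpM2r => //; rewrite -mulrAC; apply: ler_wpM2r => //.
  exact: ler_wpM2l (ltW c0) _ _ sm.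
have hu := fourier_upper oU finU up0 hL l1 l2; apply: le_trans hu _.
rewrite lee_fin -/E; apply: ler_wpM2r => //.
by have := ler_wpM2l (ltW C0) ms; lra.
Qed.
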